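(* Let $\eta\in\mathbb{R}$ and let $f\in\mathcal{P}(\mathbb{S}^2)$ be an $L^r$-local minimiser of $\mathcal{F}$ for some $r\in[1,\infty]$. Then there exist $Q,\Lambda\in\mathrm{Sym}_0(3)$ and $Z>0$ such that $f$ satisfies the Euler-Lagrange equation $$f(p)=\frac1Z\exp(\Lambda p\cdot p)\max(Qp\cdot p-\eta,0),$$ $$Q=\int_{\mathbb{S}^2}f(p)\left(p\otimes p-\tfrac13I\right)dp,\qquad \Lambda=\int_{\mathbb{S}^2}\frac{f(p)}{Qp\cdot p-\eta}\left(p\otimes p-\tfrac13I\right)dp.$$ Furthermore, $(Q,\Lambda)$ is a critical point of the dual function $F:\mathrm{dom}(J)\times\mathrm{Sym}_0(3)\to\mathbb{R}$, $$F(Q_0,\lambda)=\lambda\cdot Q_0-\ln\left(\int_{\mathbb{S}^2}\exp(\lambda p\cdot p)\max(Q_0p\cdot p-\eta,0)\,dp\right).$$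
   Context: $\mathbb{S}^2\subset\mathbb{R}^3$ is the unit sphere and $dp$ is the 2-dimensional Hausdorff measure on it. $\mathrm{Sym}_0(3)$ is the space of traceless symmetric real $3\times3$ matrices with $A\cdot B=\mathrm{Tr}(AB)$; $\mathcal{Q}=\{Q\in\mathrm{Sym}_0(3):v_{\min}(Q)>-\frac13\}$, $v_{\min}$ denoting the smallest eigenvalue. $\mathcal{P}(\mathbb{S}^2)=\{f\in L^1(\mathbb{S}^2): f\ge 0 \text{ a.e.},\ \int_{\mathbb{S}^2}f\,dp=1\}$. For fixed $\eta\in\mathbb{R}$ the energy $\mathcal{F}:\mathcal{P}(\mathbb{S}^2)\to\mathbb{R}\cup\{+\infty\}$ is $$\mathcal{F}(f)=\int_{\mathbb{S}^2}f(p)\ln f(p)-f(p)\ln\left(\int_{\mathbb{S}^2}\left((p\cdot q)^2-\tfrac13\right)f(q)\,dq-\eta\right)dp,$$ where $-\ln$ is extended by $+\infty$ for non-positive arguments, $0\times(+\infty)=0$ and $0\ln 0=0$. For $Q\in\mathcal{Q}$, $A(Q)=\{f\in\mathcal{P}(\mathbb{S}^2):\int_{\mathbb{S}^2}(p\otimes p-\frac13I)f(p)\,dp=Q\}$, $J(Q)=\inf_{f\in A(Q)}\mathcal{F}(f)$ and $\mathrm{dom}(J)=\{Q\in\mathcal{Q}:J(Q)<+\infty\}$ (an open subset of $\mathrm{Sym}_0(3)$). $f\in\mathcal{P}(\mathbb{S}^2)\cap L^r(\mathbb{S}^2)$ with $\mathcal{F}(f)<+\infty$ is an $L^r$-local minimiser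 if there is $\epsilon>0$ with $\mathcal{F}(f)\le\mathcal{F}(g)$ for all $g\in\mathcal{P}(\mathbb{S}^2)\cap L^r(\mathbb{S}^2)$ with $\|g-f\|_{L^r}<\epsilon$. Quotients $\frac{f(p)}{Qp\cdot p-\eta}$ are taken to be $0$ where $Qp\cdot p\le\eta$. Equalities between densities are a.e. *)

(* Defs.v *)
From HB Require Import structures.
From mathcomp Require Import all_boot all_order all_algebra.
From mathcomp Require Import all_classical all_reals all_analysis.

Set Implicit Arguments.
Unset Strict Implicit.
Unset Printing Implicit Defensive.
Import Order.TTheory GRing.Theory Num.Theory.
Import numFieldNormedType.Exports.

Local Open Scope classical_set_scope.
Local Open Scope ring_scope.

(* The analysis library has no Hausdorff measure, so it is built here for an
   arbitrary distance function.  As in the usual definition, the covering sets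
   are arbitrary subsets; the factor pi / 4 normalises the 2-dimensional
   measure so that it agrees with area. *)
Section hausdorff_measure.
Context {R : realType} {T : pointedType} (dist : T -> T -> R).
Local Open Scope ereal_scope.

(* The element 0 only matters for A = set0, whose diameter is thus 0. *)
Definition ediam (A : set T) : \bar R :=
  ereal_sup ([set 0] `|` [set (dist x.1 x.2)%:E | x in A `*` A]).

Definition disc_area (A : set T) : \bar R := (pi / 4)%:E * ediam A ^+ 2.

Definition delta_cover (delta : R) (A : set T) : set ((set T)^nat) :=
  [set F | (forall i, ediam (F i) <= delta%:E) /\ A `<=` \bigcup_i F i].

Definition hausdorff2_delta (delta : R) (A : set T) : \bar R :=
  ereal_inf [set \sum_(i <oo) disc_area (F i) | F in delta_cover delta A].

Definition hausdorff2 (A : set T) : \bar R :=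
  ereal_sup [set hausdorff2_delta delta A | delta in [set delta : R | (0 < delta)%R]].

Lemma ediam_ge0 A : 0 <= ediam A.
Proof. by apply: ereal_sup_ubound; left. Qed.

Lemma ediam0 : ediam set0 = 0.
Proof.
rewrite /ediam; have -> : [set (dist x.1 x.2)%:E | x in set0 `*` set0] = set0.
  by apply/seteqP; split => // y [x [[]]].
by rewrite setU0 ereal_sup1.
Qed.

Lemma disc_area_ge0 A : 0 <= disc_area A.
Proof.
by rewrite /disc_area mule_ge0 ?expe_ge0 ?ediam_ge0 // lee_fin divr_ge0 ?pi_ge0.
Qed.

Lemma disc_area0 : disc_area set0 = 0.
Proof. by rewrite /disc_area ediam0 expe2 mule0 mule0. Qed.

Lemma hausdorff2_delta_ge0 delta A : 0 <= hausdorff2_delta delta A.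
Proof.
apply: le_ereal_inf_tmp => _ [F _ <-].
by apply: nneseries_ge0 => i _ _; exact: disc_area_ge0.
Qed.

Lemma hausdorff2_delta_sigma_subadditive delta :
  sigma_subadditive (hausdorff2_delta delta).
Proof.
move=> A; have [[i ioo]|] := pselect (exists i, hausdorff2_delta delta (A i) = +oo).
  rewrite (eseries_pinfty _ _ ioo) ?leey// => n _.
  by rewrite -ltNye (lt_le_trans _ (hausdorff2_delta_ge0 _ _)).
rewrite -forallNE => Aoo.
suff add2e (e : {posnum R}) : hausdorff2_delta delta (\bigcup_n A n) <=
    \sum_(i <oo) hausdorff2_delta delta (A i) + e%:num%:E.
  by apply/lee_addgt0Pr => _/posnumP[].
rewrite (le_trans _ (epsilon_trick _ _ _))//; last first.
  by move=> n; exact: hausdorff2_delta_ge0.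
pose P n (B : (set T)^nat) := delta_cover delta (A n) B /\
  \sum_(k <oo) disc_area (B k) <=
    hausdorff2_delta delta (A n) + (e%:num / (2 ^ n.+1)%:R)%:E.
have [G PG] : {G : ((set T)^nat)^nat & forall n, P n (G n)}.
  apply: (@choice _ _ P) => n; rewrite /P.
  have en1 : (0 < e%:num / (2 ^ n.+1)%:R :> R)%R by [].
  have fA : hausdorff2_delta delta (A n) \is a fin_num.
    rewrite ge0_fin_numE ?hausdorff2_delta_ge0// ltey; exact/eqP/Aoo.
  have [x [B cB <-] xS] := lb_ereal_inf_adherent en1 fA.
  by exists B; split => //; exact/ltW.
have dG_ge0 x : 0 <= (disc_area \o uncurry G) x by exact: disc_area_ge0.
apply: (@le_trans _ _ (\esum_(i in setT) (disc_area \o uncurry G) i)).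
  apply: ereal_inf_lbound => /=.
  have /card_esym/ppcard_eqP[f] := card_nat2.
  exists (uncurry G \o f).
    split => [i|t [i _ Ait]]; first by rewrite /= /uncurry; case: (f i) => a b; exact: (PG a).1.1.
    have [j _ ?] := (PG i).1.2 _ Ait.
    by exists (f^-1%FUN (i, j)) => //=; rewrite invK ?inE.
  rewrite -(esum_pred_image (disc_area \o uncurry G) _ xpredT) ?[fun=> _]set_true//.
  by rewrite image_eq.
rewrite (_ : esum _ _ = \sum_(i <oo) \sum_(j <oo ) disc_area (G i j)); last first.
  pose J : nat -> set (nat * nat) := fun i => [set (i, j) | j in setT].
  rewrite (_ : setT = \bigcup_k J k); last first.
    by rewrite predeqE => -[a b]; split => // _; exists a => //; exists b.
  rewrite esum_bigcupT /=; last 2 first.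
    - apply/trivIsetP => i j _ _ ij.
      rewrite predeqE => -[n m] /=; split => //= -[] [_] _ [<-{n} _].
      by move=> [m' _] [] /esym/eqP; rewrite (negbTE ij).
    - by move=> /= [n m]; exact: disc_area_ge0.
  rewrite -(image_id [set: nat]) -fun_true esum_pred_image//; last first.
    by move=> n _; apply: esum_ge0 => m _; exact: disc_area_ge0.
  apply: eq_eseriesr => /= j _.
  rewrite -(esum_pred_image (disc_area \o uncurry G) (pair j) predT)//=; last first.
    by move=> ? ? _ _; exact: (@can_inj _ _ _ snd).
    by move=> n _; exact: disc_area_ge0.
  by congr esum; rewrite predeqE => -[a b]; split; move=> [i _ <-]; exists i.
apply: lee_lim.
- apply: is_cvg_nneseries => n *.
  by apply: nneseries_ge0 => m *; exact: (dG_ge0 (n, m)).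
- by apply: is_cvg_nneseries => n *; apply: adde_ge0 => //; exact: hausdorff2_delta_ge0.
- by near=> n; apply: lee_sum => i _; exact: (PG i).2.
Unshelve. all: by end_near. Qed.

Lemma hausdorff2_ge0 A : 0 <= hausdorff2 A.
Proof.
apply: (le_trans (hausdorff2_delta_ge0 1 A)).
by apply: ereal_sup_ubound; exists 1%R => //=.
Qed.

Lemma hausdorff20 : hausdorff2 set0 = 0.
Proof.
apply/eqP; rewrite eq_le hausdorff2_ge0 andbT.
apply: ge_ereal_sup => _ [delta /= delta0 <-].
apply: ereal_inf_lbound; exists (fun=> set0).
  by split => // _; rewrite ediam0 lee_fin ltW.
by rewrite eseries0 // => i _ _; exact: disc_area0.
Qed.

Lemma le_hausdorff2 : {homo hausdorff2 : A B / A `<=` B >-> A <= B}.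
Proof.
move=> A B AB; apply: ge_ereal_sup => _ [delta /= delta0 <-].
apply: (@le_trans _ _ (hausdorff2_delta delta B)).
  apply/ereal_inf_le_tmp => _ [F [dF BF] <-].
  by exists F => //; split => //; exact: subset_trans BF.
by apply: ereal_sup_ubound; exists delta.
Qed.

Lemma hausdorff2_sigma_subadditive : sigma_subadditive hausdorff2.
Proof.
move=> A; apply: ge_ereal_sup => _ [delta /= delta0 <-].
apply: (le_trans (hausdorff2_delta_sigma_subadditive delta A)).
apply: lee_nneseries => [i *|i *]; first exact: hausdorff2_delta_ge0.
by apply: ereal_sup_ubound; exists delta.
Qed.

HB.instance Definition _ := isOuterMeasure.Build R T hausdorff2
  hausdorff20 hausdorff2_ge0 le_hausdorff2 hausdorff2_sigma_subadditive.

End hausdorff_measure.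

(* The norm that the library puts on 'rV[R]_3 is the sup norm, hence the
   explicit Euclidean one. *)
Definition dotp (R : realType) (p q : 'rV[R]_3) : R := (p *m q^T) 0 0.

Definition enorm (R : realType) (p : 'rV[R]_3) : R := Num.sqrt (dotp p p).

Record sphere (R : realType) :=
  Sphere { sphere_val : 'rV[R]_3 ; _ : enorm sphere_val == 1 }.

HB.instance Definition _ (R : realType) := [isSub for @sphere_val R].
HB.instance Definition _ (R : realType) := [Choice of sphere R by <:].

Lemma enorm_delta (R : realType) : enorm (delta_mx 0 0 : 'rV[R]_3) == 1.
Proof. by rewrite /enorm /dotp trmx_delta mul_delta_mx mxE /= sqrtr1. Qed.

HB.instance Definition _ (R : realType) :=
  isPointed.Build (sphere R) (Sphere (enorm_delta R)).

Definition sphere_dist (R : realType) (p q : sphere R) : R :=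
  enorm (sphere_val p - sphere_val q).

Definition sphere_hausdorff (R : realType) :
    {outer_measure set (sphere R) -> \bar R} :=
  hausdorff2 (@sphere_dist R).

(* The unit sphere with the sigma-algebra of the sets that are Caratheodory
   measurable for its 2-dimensional Hausdorff outer measure. *)
Definition S2 (R : realType) := caratheodory_type (sphere_hausdorff R).

Definition dp (R : realType) : {measure set (S2 R) -> \bar R} :=
  sphere_hausdorff R : set (caratheodory_type (sphere_hausdorff R)) -> \bar R.

Definition pt (R : realType) (p : S2 R) : 'rV[R]_3 := sphere_val p.

Definition quadf (R : realType) (A : 'M[R]_3) (p : S2 R) : R :=
  dotp (pt p *m A) (pt p).

Definition Sym0 (R : realType) : set 'M[R]_3 :=
  [set A | A^T = A /\ \tr A = 0].

Definition vmin (R : realType) (A : 'M[R]_3) : R := inf [set a | eigenvalue A a].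

Definition Qadm (R : realType) : set 'M[R]_3 :=
  [set Q | Sym0 Q /\ - (1 / 3) < vmin Q].

Definition tensor0 (R : realType) (p : S2 R) : 'M[R]_3 :=
  (pt p)^T *m pt p - (1 / 3)%:M.

Definition mx_integral (R : realType) (h : S2 R -> 'M[R]_3) : 'M[R]_3 :=
  \matrix_(i, j) \int[dp R]_p h p i j.

Definition prob_density (R : realType) : set (S2 R -> R) :=
  [set f | [/\ (dp R).-integrable setT (EFin \o f),
               {ae dp R, forall p, 0 <= f p} &
               \int[dp R]_p f p = 1]].

(* In the library ln 0 = 0, lne x = -oo for x <= 0, and 0 * -oo = 0. *)
Definition energy (R : realType) (eta : R) (f : S2 R -> R) : \bar R :=
  (\int[dp R]_p ((f p * ln (f p))%:E - (f p)%:E *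
     lne (\int[dp R]_q ((dotp (pt p) (pt q) ^+ 2 - 1 / 3) * f q) - eta)%R%:E))%E.

Definition Lr_norm (R : realType) (r : \bar R) (f : S2 R -> R) : \bar R :=
  Lnorm (dp R) r (EFin \o f).

Definition prob_density_Lr (R : realType) (r : \bar R) : set (S2 R -> R) :=
  [set f | prob_density f /\ f \in Lfun (dp R) r].

Definition Lr_local_minimiser (R : realType) (eta : R) (r : \bar R)
    (f : S2 R -> R) : Prop :=
  [/\ prob_density_Lr r f, (energy eta f < +oo)%E &
      exists2 eps : R, 0 < eps &
        forall g, prob_density_Lr r g ->
          (Lr_norm r (g \- f)%R < eps%:E)%E -> (energy eta f <= energy eta g)%E].

Definition Qclass (R : realType) (Q : 'M[R]_3) : set (S2 R -> R) :=
  [set f | prob_density f /\ mx_integral (fun p => f p *: tensor0 p) = Q].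

Definition Jfun (R : realType) (eta : R) (Q : 'M[R]_3) : \bar R :=
  ereal_inf [set energy eta f | f in Qclass Q].

Definition domJ (R : realType) (eta : R) : set 'M[R]_3 :=
  [set Q | Qadm Q /\ (Jfun eta Q < +oo)%E].

Definition quotient_density (R : realType) (eta : R) (f : S2 R -> R)
    (Q : 'M[R]_3) (p : S2 R) : R :=
  if quadf Q p <= eta then 0 else f p / (quadf Q p - eta).

Definition dual_function (R : realType) (eta : R) (X : 'M[R]_3 * 'M[R]_3) : R :=
  \tr (X.2 *m X.1) -
  ln (\int[dp R]_p (expR (quadf X.2 p) * Num.max (quadf X.1 p - eta) 0)).

(* x0 is in D and the Frechet derivative at x0 of F, as a function on D, is 0.
   The notion is meant for D relatively open in a linear subspace of V (such as
   domJ eta `*` Sym0): the derivative is then the one along that subspace. *)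
Definition critical_point (R : realType) (V : normedModType R) (D : set V)
    (F : V -> R) (x0 : V) : Prop :=
  D x0 /\
  forall eps : R, 0 < eps ->
    \forall x \near within D (nbhs x0), `|F x - F x0| <= eps * `|x - x0|.

(* Main.v *)
Require Import Defs.
From HB Require Import structures.
From mathcomp Require Import all_boot all_order all_algebra.
From mathcomp Require Import all_classical all_reals all_analysis measurable_realfun.
From mathcomp Require Import lra zify.

Set Implicit Arguments.
Unset Strict Implicit.
Unset Printing Implicit Defensive.
Import Order.TTheory GRing.Theory Num.Theory.
Import numFieldNormedType.Exports.

Local Open Scope classical_set_scope.
Local Open Scope ring_scope.

(* Let Q be the traceless second moment of f and w(p) = Qp.p - eta. On a set where
   f and w are bounded and bounded below, bounded perturbations of f orthogonal to
   all quadratic forms leave Q unchanged, so stationarity forces ln f - ln w to be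
   a quadratic form there, the same one on all these sets. The infinite slope of
   x ln x at 0 then excludes that f = 0 on a set of positive measure where w > 0.
   Hence f = c exp(Lambda p.p) max(w, 0). Comparing f with the densities
   c exp(Lambda p.p) max(w + t dp.p, 0), corrected so that the second moment is
   exactly Q + t d, gives an inequality between linear functions of the traceless
   matrix d, therefore an equality, which is the formula for Lambda.

   A nonzero quadratic form vanishes only on a null set of the sphere. This makes
   the second moment matrix of f positive definite, so that Q is admissible, and,
   applied to w, makes the dual function differentiable at (Q, Lambda). The
   formulas for Q and Lambda say that its two partial derivatives vanish. *)

(** * Hausdorff measure of a metric *)

(** For a density g of mass 1 the inner integral of the energy is [quadf (Qof g) p], so the energy
    is nonlocal only through [Qof g]. A variation with [mom phi = 0] preserves the mass (the trace
    of [mom phi]) and the field at once, and its effect on the energy is then pointwise. This is why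
    moments are restored exactly, by quadratic forms cut off to a set where the density is bounded
    below. Varying Q moves the boundary of {w > 0}, where the logarithm is singular; there only a
    one-sided comparison is made, and the convexity of the positive part gives it the right
    direction. No derivative of the energy is taken: [variation_inequality] asks for an integrable
    pointwise bound on the increment. All variations are bounded, and uniformly small functions are
    small in every L^r, which treats all r together. About the Hausdorff measure on the sphere three
    facts are established: coordinates are measurable, the total mass is finite, orthogonal maps
    preserve it. Nullity of quadrics follows by placing infinitely many congruent copies on the
    sphere, almost every point lying on boundedly many of them. *)

Section hausdorff_metric.
Context {R : realType} {T : pointedType} (dist : T -> T -> R).
Local Open Scope ereal_scope.

Lemma dist_le_ediam (A : set T) a b : A a -> A b -> (dist a b)%:E <= ediam dist A.
Proof. by move=> Aa Ab; apply: ereal_sup_ubound; right; exists (a, b). Qed.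

Lemma ediam_le (A : set T) (d : R) : (0 <= d)%R ->
  (forall a b, A a -> A b -> (dist a b <= d)%R) -> ediam dist A <= d%:E.
Proof.
move=> d0 dA; apply: ge_ereal_sup => _ [->|[[a b] /= [Aa Ab] <-]].
  by rewrite lee_fin.
by rewrite lee_fin dA.
Qed.

Lemma hausdorff2_delta_anti (d1 d2 : R) (A : set T) : (d1 <= d2)%R ->
  hausdorff2_delta dist d2 A <= hausdorff2_delta dist d1 A.
Proof.
move=> d12; apply: ereal_inf_le_tmp => _ [F [dF AF] <-].
exists F => //; split => // i; apply: le_trans (dF i) _.
by rewrite lee_fin.
Qed.

(** A covering set of diameter at most [delta] cannot meet both A and B, so a cover of the union
    splits into a cover of A and one of B in which no set is counted twice. *)
Lemma hausdorff2_delta_sep (d delta : R) (A B : set T) : (delta < d)%R ->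
  (forall a b, A a -> B b -> d <= dist a b)%R ->
  hausdorff2_delta dist delta A + hausdorff2_delta dist delta B <=
  hausdorff2_delta dist delta (A `|` B).
Proof.
move=> dd sepAB; apply: le_ereal_inf_tmp => _ [F [dF ABF] <-].
(* [G C] keeps the members of the cover that meet C; the others become empty and cost nothing. *)
pose G (C : set T) i := if `[< F i `&` C !=set0 >] then F i else set0.
have GF C i : disc_area dist (G C i) <= disc_area dist (F i).
  rewrite /G; case: asboolP => // _; rewrite disc_area0; exact: disc_area_ge0.
have coverG C : C `<=` A `|` B -> delta_cover dist delta C (G C).
  move=> CAB; split=> [i|x Cx].
    rewrite /G; case: asboolP => // _; rewrite ediam0.
    exact: le_trans (ediam_ge0 dist (F i)) (dF i).
  have [i _ Fix] := ABF _ (CAB _ Cx); exists i => //.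
  by rewrite /G; case: asboolP => //; apply; exists x.
apply: (@le_trans _ _ (\sum_(i <oo) disc_area dist (G A i) +
    \sum_(i <oo) disc_area dist (G B i))).
  apply: leeD; apply: ereal_inf_lbound.
    by exists (G A) => //; apply: coverG => x; left.
  by exists (G B) => //; apply: coverG => x; right.
rewrite -nneseriesD; [|by move=> *; exact: disc_area_ge0..].
apply: lee_nneseries => [i _ _|i _].
  by apply: adde_ge0; exact: disc_area_ge0.
rewrite /G; case: asboolP => [[a [Fa Aa]]|_]; last first.
  by rewrite disc_area0 add0e; exact: GF.
case: asboolP => [[b [Fb Bb]]|_]; last by rewrite disc_area0 adde0.
have := dist_le_ediam Fa Fb; move/le_trans => /(_ _ (dF i)); rewrite lee_fin.
by move=> /(le_trans (sepAB _ _ Aa Bb)); rewrite leNgt dd.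
Qed.

Lemma hausdorff2_sep (d : R) (A B : set T) : (0 < d)%R ->
  (forall a b, A a -> B b -> d <= dist a b)%R ->
  hausdorff2 dist A + hausdorff2 dist B <= hausdorff2 dist (A `|` B).
Proof.
move=> d0 sepAB.
have [->|Sfin] := eqVneq (hausdorff2 dist (A `|` B)) +oo; first exact: leey.
have fin_le C (e : R) : hausdorff2 dist C != +oo -> (0 < e)%R ->
    hausdorff2_delta dist e C \is a fin_num.
  move=> Coo e0; rewrite ge0_fin_numE ?hausdorff2_delta_ge0// lt_neqAle leey.
  rewrite andbT; apply: contra_neq Coo => eC; apply/eqP.
  rewrite -leye_eq -eC; apply: ereal_sup_ubound.
  by exists e.
have Afin : hausdorff2 dist A != +oo.
  apply: contra_neq Sfin => eA; apply/eqP; rewrite -leye_eq -eA.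
  by apply: le_hausdorff2 => x; left.
have Bfin : hausdorff2 dist B != +oo.
  apply: contra_neq Sfin => eA; apply/eqP; rewrite -leye_eq -eA.
  by apply: le_hausdorff2 => x; right.
(* Two independent scales allow the two suprema to be taken one after the other; both are compared
   with a common scale smaller than d. *)
have key (d1 d2 : R) : (0 < d1)%R -> (0 < d2)%R ->
    hausdorff2_delta dist d1 A + hausdorff2_delta dist d2 B <=
    hausdorff2 dist (A `|` B).
  move=> d10 d20; pose e := Num.min (Num.min d1 d2) (d / 2)%R.
  have e0 : (0 < e)%R by rewrite !lt_min d10 d20 divr_gt0.
  apply: (@le_trans _ _ (hausdorff2_delta dist e A + hausdorff2_delta dist e B)).
    by apply: leeD; apply: hausdorff2_delta_anti; rewrite !ge_min lexx ?orbT.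
  apply: (@le_trans _ _ (hausdorff2_delta dist e (A `|` B))).
    apply: (@hausdorff2_delta_sep d) => //.
    rewrite /e gt_min; apply/orP; right.
    by rewrite ltr_pdivrMr// ltr_pMr// (_ : 1 = 1%:R)%R// ltr_nat.
  by apply: ereal_sup_ubound; exists e.
have h0 : hausdorff2 dist A \is a fin_num.
  by rewrite ge0_fin_numE ?hausdorff2_ge0// ltey.
rewrite addeC -leeBrDr//; apply: ge_ereal_sup => _ [d2 /= d20 <-].
rewrite leeBrDr// addeC -leeBrDr ?(fin_le B)//.
apply: ge_ereal_sup => _ [d1 /= d10 <-].
by rewrite leeBrDr ?(fin_le B)//; exact: key.
Qed.

(* Only the rings {r k.+1 < u <= r k} around {u <= a} matter: rings of equal
   parity are at positive distance from each other, so their measures sum to at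
   most 2 H(X), and the rings beyond k = n carry a vanishing part of X. *)
Lemma caratheodory_sublevel (u : T -> R) (a : R) :
  (forall x y, `|u x - u y| <= dist x y)%R ->
  (hausdorff2 dist).-caratheodory [set x | (u x <= a)%R].
Proof.
move=> lipu; apply: le_caratheodory_measurable => X.
pose H : {outer_measure set T -> \bar R} := hausdorff2 dist.
change (H (X `&` [set x | (u x <= a)%R]) + H (X `&` ~` [set x | (u x <= a)%R]) <=
  H X).
have [->|Xfin] := eqVneq (H X) +oo; first exact: leey.
have Hle (A B : set T) : A `<=` B -> H A <= H B by exact: le_hausdorff2.
have H0 A : 0 <= H A by exact: hausdorff2_ge0.
pose r (n : nat) : R := (a + n.+1%:R^-1)%R.
have r_anti (m n : nat) : (m < n)%N -> (r n < r m)%R.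
  by move=> mn; rewrite ltrD2l ltf_pV2 ?posrE ?ltr0n// ltr_nat ltnS.
have sep (s t : R) (A B : set T) : (t < s)%R ->
    (forall x, A x -> s <= u x)%R -> (forall x, B x -> u x <= t)%R ->
    H A + H B <= H (A `|` B).
  move=> ts As Bt; apply: (@hausdorff2_sep (s - t)%R); first by rewrite subr_gt0.
  move=> x y /As sx /Bt yt; apply: le_trans (lipu x y); rewrite (le_trans _ (ler_norm _))//.
  by lra.
pose D (k : nat) : set T := X `&` [set x | (r k.+1 < u x <= r k)%R].
pose E (k : nat) : set T := X `&` [set x | (r k < u x)%R].
(* In the induction the new ring lies below level [r (n.*2 + b).+1] and [E (n.*2 + b)] above level
   [r (n.*2 + b)]; the skipped ring between them provides the gap. *)
have sumD (b n : nat) :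
    \sum_(0 <= k < n) H (D (k.*2 + b).+1) <= H (E (n.*2 + b)%N).
  elim: n => [|n IH]; first by rewrite big_nil.
  rewrite big_nat_recr//=; apply: (le_trans (leeD2r _ IH)).
  apply: le_trans (@sep (r (n.*2 + b)%N) (r (n.*2 + b).+1) _ _ _ _ _) _.
  - by apply: r_anti.
  - by move=> x [_ /= /ltW].
  - by move=> x [_ /= /andP[]].
  - apply: Hle => x [[Xx /= ux]|[Xx /= /andP[ux _]]]; split => //=.
    by apply: le_lt_trans ux; apply/ltW/r_anti; rewrite doubleS; lia.
pose W (k : nat) := D (k.*2 + 0).+1 `|` D (k.*2 + 1).+1.
have sumW : \sum_(0 <= k <oo) H (W k) < +oo.
  apply: (@le_lt_trans _ _ (H X + H X)); last by rewrite lte_add_pinfty// ltey.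
  apply: lime_le; first exact: is_cvg_nneseries.
  apply: nearW => n.
  apply: (@le_trans _ _ (\sum_(0 <= k < n) H (D (k.*2 + 0).+1) +
     \sum_(0 <= k < n) H (D (k.*2 + 1).+1))).
    rewrite -big_split/=; apply: lee_sum => i _; exact: outer_measureU2.
  by apply: leeD; apply: le_trans (sumD _ _) _; apply: Hle => x [].
have tailW : \sum_(N <= k <oo) H (W k) @[N --> \oo] --> 0.
  exact: (@nneseries_tail_cvg _ (fun k => H (W k)) xpredT).
have XE n : X `&` ~` [set x | (u x <= a)%R] `<=`
    E (n.*2 + 1)%N `|` \bigcup_(k in ~` `I_n) W k.
  move=> x [Xx /= /negP]; rewrite -ltNge => ax.
  have [rx|rx] := ltP (r (n.*2 + 1)%N) (u x); first by left.
  right.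
  have [j jP] : exists j, (r (j.*2 + 3)%N < u x)%R.
    have [j] : exists j : nat, (a + j.+1%:R^-1 < u x)%R.
      have := @ltr_add_invr _ a (u x) ax; move=> [k kP]; exists k; exact: kP.
    move=> jx; exists j; apply: le_lt_trans jx; rewrite lerD2l lef_pV2 ?posrE//.
    by rewrite ler_nat; lia.
  (* [W m] covers the levels from [r (m.*2 + 3)] to [r (m.*2 + 1)], so the least m whose lower level
     is passed locates x. *)
  case: (ex_minnP (ex_intro (fun j => r (j.*2 + 3)%N < u x)%R j jP)) => m mP mmin.
  have nm : (n <= m)%N.
    rewrite leqNgt; apply/negP => mn; have : (r (n.*2 + 1)%N <= r (m.*2 + 3)%N)%R.
      by rewrite lerD2l lef_pV2 ?posrE// ler_nat; lia.
    by move=> /(le_trans rx); rewrite leNgt mP.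
  have ux1 : (u x <= r (m.*2 + 1)%N)%R.
    case: m mP mmin nm => [|m] mP mmin nm.
      by move: nm rx; rewrite leqn0 => /eqP ->.
    rewrite leNgt; apply/negP => lt1; have := mmin m.
    have -> : (m.*2 + 3 = m.+1.*2 + 1)%N by lia.
    by rewrite lt1 ltnn => /(_ isT).
  exists m; first by rewrite /= ltnNge nm.
  have [u2|u2] := ltP (r (m.*2 + 2)%N) (u x).
    left; split => //=; rewrite addn0 -(addn1 m.*2) ux1 andbT.
    by rewrite (_ : (m.*2 + 1).+1 = m.*2 + 2)%N// -addnS.
  right; split => //=; rewrite (_ : (m.*2 + 1).+2 = m.*2 + 3)%N -?addnS// mP.
  by rewrite u2.
have main n : H (X `&` [set x | (u x <= a)%R]) +
    H (X `&` ~` [set x | (u x <= a)%R]) <=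
    H X + \sum_(n <= k <oo) H (W k).
  apply: (@le_trans _ _ (H (X `&` [set x | (u x <= a)%R]) +
     (H (E (n.*2 + 1)%N) + \sum_(n <= k <oo) H (W k)))).
    apply: leeD2l; apply: le_trans (Hle _ _ (XE n)) _.
    apply: le_trans (outer_measureU2 _ _ _) _.
    apply: leeD2l; exact: outer_measure_sigma_subadditive_tail.
  rewrite addeA; apply: leeD2r; rewrite addeC.
  apply: le_trans (@sep (r (n.*2 + 1)%N) a _ _ _ _ _) _.
  - by rewrite /r ltrDl invr_gt0 ltr0n.
  - by move=> x [_ /ltW].
  - by move=> x [].
  - by apply: Hle => x [[]|[]].
have XfinN : H X \is a fin_num by rewrite ge0_fin_numE// ltey.
have cvgX : H X + \sum_(n <= k <oo) H (W k) @[n --> \oo] --> H X + 0.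
  by apply: cvgeD => //; [rewrite fin_num_adde_defr|exact: cvg_cst].
rewrite -[leRHS]adde0 -(cvg_lim _ cvgX)//.
by apply: lime_ge; [apply/cvg_ex; exists (H X + 0)|exact: nearW].
Qed.

(** The images of a cover form a cover of the image with no larger diameters. The reverse inequality
    for orthogonal maps comes from the inverse map. *)
Lemma hausdorff2_isometry (g : T -> T) (A : set T) :
  (forall x y, dist (g x) (g y) = dist x y) ->
  hausdorff2 dist (g @` A) <= hausdorff2 dist A.
Proof.
move=> isog; apply: ge_ereal_sup => _ [d /= d0 <-].
apply: (@le_trans _ _ (hausdorff2_delta dist d A)); last first.
  by apply: ereal_sup_ubound; exists d.
apply: le_ereal_inf_tmp => _ [F [dF AF] <-].
have ediam_img B : ediam dist (g @` B) <= ediam dist B.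
  apply: ge_ereal_sup => _ [->|[[_ _] /= [[a Aa <-] [b Bb <-]] <-]].
    exact: ediam_ge0.
  by rewrite isog; exact: dist_le_ediam.
apply: (@le_trans _ _ (\sum_(i <oo) disc_area dist (g @` F i))).
  apply: ereal_inf_lbound; exists (fun i => g @` F i) => //; split => [i|_ [x Ax <-]].
    exact: le_trans (ediam_img _) (dF i).
  by have [i _ Fix] := AF _ Ax; exists i => //; exists x.
apply: lee_nneseries => [i _ _|i _]; first exact: disc_area_ge0.
apply: lee_wpmul2l; first by rewrite lee_fin divr_ge0 ?pi_ge0.
by rewrite !expe2; apply: lee_pmul => //; exact: ediam_ge0.
Qed.

Lemma hausdorff2_finite_cover (n : nat) (d : R) (F : nat -> set T) (A : set T) :
  (0 <= d)%R -> A `<=` \bigcup_(i in `I_n) F i ->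
  (forall i x y, (i < n)%N -> F i x -> F i y -> dist x y <= d)%R ->
  hausdorff2_delta dist d A <= (n%:R * (pi / 4 * d ^+ 2))%:E.
Proof.
move=> d0 AF dF.
pose G i := if (i < n)%N then F i else set0.
apply: (@le_trans _ _ (\sum_(i <oo) disc_area dist (G i))).
  apply: ereal_inf_lbound; exists G => //; split => [i|x Ax].
    rewrite /G; case: ifPn => [iN|_]; last by rewrite ediam0.
    by apply: ediam_le => // a b; exact: dF.
  by have [i /= iN Fi] := AF _ Ax; exists i => //; rewrite /G iN.
rewrite (nneseries_split 0 n); last by move=> k _; exact: disc_area_ge0.
rewrite add0n [X in _ + X]eseries0 ?adde0; last first.
  by move=> i iN _; rewrite /G ltnNge iN/= disc_area0.
have: \sum_(0 <= k < n) disc_area dist (G k) <= \sum_(0 <= k < n) (pi / 4 * d ^+ 2)%:E.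
  rewrite big_nat [leRHS]big_nat; apply: lee_sum => i /andP[_ iN].
  rewrite /disc_area [leRHS]EFinM; apply: lee_wpmul2l.
    by rewrite lee_fin divr_ge0 ?pi_ge0.
  have dG : ediam dist (G i) <= d%:E.
    by rewrite /G iN; apply: ediam_le => // a b; exact: dF.
  by rewrite EFin_expe !expe2; apply: lee_pmul => //; exact: ediam_ge0.
move=> /le_trans; apply.
by rewrite sumEFin sumr_const_nat subn0 mulr_natl.
Qed.

End hausdorff_metric.

(** * The sphere has finite measure *)

Section sphere_geometry.
Context {R : realType}.
Implicit Types (p q : S2 R) (A M : 'M[R]_3) (v : 'rV[R]_3).

(* The indices c, c + 1, c + 2 are taken modulo 3. *)
Lemma sum_I3 (F : 'I_3 -> R) (c : 'I_3) : \sum_i F i = F c + F (c + 1) + F (c + 2).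
Proof.
rewrite !big_ord_recl big_ord0 addr0.
have E (i j : 'I_3) : val i = val j -> F i = F j by move=> /val_inj ->.
have -> : F (lift ord0 ord0) = F 1 by exact: E.
have -> : F (lift ord0 (lift ord0 ord0)) = F 2 by exact: E.
case: c => -[|[|[|//]]] ic.
- rewrite (E (Ordinal ic) ord0)// (E (Ordinal ic + 1) 1)// (E (Ordinal ic + 2) 2)//; lra.
- rewrite (E (Ordinal ic) 1)// (E (Ordinal ic + 1) 2)// (E (Ordinal ic + 2) ord0)//; lra.
- rewrite (E (Ordinal ic) 2)// (E (Ordinal ic + 1) ord0)// (E (Ordinal ic + 2) 1)//; lra.
Qed.

Lemma sum_I3E (F : 'I_3 -> R) : \sum_i F i = F 0 + F 1 + F 2.
Proof. by rewrite (sum_I3 F 0) !add0r. Qed.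

Lemma dotpE v w : dotp v w = \sum_i v 0 i * w 0 i.
Proof. by rewrite /dotp mxE; apply: eq_bigr => i _; rewrite mxE. Qed.

Lemma dotp_ge0 v : 0 <= dotp v v.
Proof. by rewrite dotpE sumr_ge0// => i _; rewrite -expr2 sqr_ge0. Qed.

Lemma dotp_pt p : dotp (pt p) (pt p) = 1.
Proof.
have /eqP := valP p; rewrite /= /enorm => h.
by rewrite -[LHS]sqr_sqrtr ?dotp_ge0// /pt h expr1n.
Qed.

Lemma sum_pt_sq p : \sum_i pt p 0 i ^+ 2 = 1.
Proof. by rewrite -(dotp_pt p) dotpE; apply: eq_bigr => i _; rewrite expr2. Qed.

Lemma pt_le1 p i : `|pt p 0 i| <= 1.
Proof.
have := sum_pt_sq p; rewrite (sum_I3 _ i) => h.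
rewrite -(@ler_pXn2r _ 2) ?nnegrE// expr1n real_normK ?num_real//.
have := sqr_ge0 (pt p 0 (i + 1)); have := sqr_ge0 (pt p 0 (i + 2)).
lra.
Qed.

Lemma quadfE A p : quadf A p = \sum_i \sum_j A i j * (pt p 0 i * pt p 0 j).
Proof.
rewrite /quadf dotpE exchange_big/=; apply: eq_bigr => j _.
rewrite mxE mulr_suml; apply: eq_bigr => i _; lra.
Qed.

Lemma coord_lipschitz p q i : `|pt p 0 i - pt q 0 i| <= sphere_dist p q.
Proof.
rewrite /sphere_dist /enorm -sqrtr_sqr ler_wsqrtr// dotpE (bigD1 i)//=.
rewrite !mxE -expr2 lerDl sumr_ge0// => j _; by rewrite -expr2 sqr_ge0.
Qed.

(** Coordinates are 1-Lipschitz for the Euclidean distance, so their sublevel sets are Caratheodory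
    measurable. The measurability of all quadratic forms rests on this. *)
Lemma measurable_coord i : measurable_fun [set: S2 R] (fun p => pt p 0 i).
Proof.
apply: (measurability (@RGenOInfty.G R)).
  exact: RGenOInfty.measurableE.
move=> _ [_ [r ->] <-]; rewrite setTI.
rewrite (_ : _ @^-1` _ = ~` [set p : S2 R | pt p 0 i <= r]); last first.
  by apply/seteqP; split => p /=; rewrite in_itv/= andbT ltNge => /negP.
apply: measurableC.
exact: (@caratheodory_sublevel _ _ _ (fun p : sphere R => sphere_val p 0 i) r
  (fun p q => coord_lipschitz p q i)).
Qed.

Lemma measurable_quadf A : measurable_fun [set: S2 R] (quadf A).
Proof.
rewrite (_ : quadf A = fun p => \sum_i \sum_j A i j * (pt p 0 i * pt p 0 j)); last first.
  by apply/funext => p; exact: quadfE.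
apply: measurable_sum => i; apply: measurable_sum => j.
apply: measurable_funM; first exact: measurable_cst.
apply: measurable_funM.
  exact: (measurable_coord i).
exact: (measurable_coord j).
Qed.

(** Where s x and s x' are at least 1/2, their sum is at least 1, so |s x - s x'| is at most the
    absolute value of (s x)^2 - (s x')^2, which the sphere equation expresses by y and z and bounds
    by 4 h. The squares add up to at most (16 + 1 + 1) h^2, below (5 h)^2. *)
Lemma cell_diameter (s h a b x y z x' y' z' : R) : s ^+ 2 = 1 ->
  1 / 2 <= s * x -> 1 / 2 <= s * x' ->
  x ^+ 2 + y ^+ 2 + z ^+ 2 = 1 -> x' ^+ 2 + y' ^+ 2 + z' ^+ 2 = 1 ->
  `|y| <= 1 /\ `|z| <= 1 -> `|y'| <= 1 /\ `|z'| <= 1 ->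
  a <= y -> y <= a + h -> a <= y' -> y' <= a + h ->
  b <= z -> z <= b + h -> b <= z' -> z' <= b + h ->
  (x - x') ^+ 2 + (y - y') ^+ 2 + (z - z') ^+ 2 <= (5 * h) ^+ 2.
Proof.
move=> s2 sx sx' e e' [y1 z1] [y1' z1'] ay ya ay' ya' bz zb bz' zb'.
have sq (u u' c : R) : c <= u -> u <= c + h -> c <= u' -> u' <= c + h ->
    `|u| <= 1 -> `|u'| <= 1 ->
    (u - u') ^+ 2 <= h ^+ 2 /\ `|u ^+ 2 - u' ^+ 2| <= 2 * h.
  move=> cu uc cu' uc' u1 u1'.
  have du : `|u - u'| <= h by rewrite ler_norml; apply/andP; split; clear -cu uc cu' uc'; lra.
  have h0 : 0 <= h by exact: le_trans du.
  split; first by rewrite -real_normK ?num_real// ler_pXn2r ?nnegrE.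
  rewrite subr_sqr normrM mulrC; apply: ler_pM => //.
  by apply: le_trans (ler_normD _ _) _; clear -u1 u1'; lra.
have [y2 y3] := sq y y' a ay ya ay' ya' y1 y1'.
have [z2 z3] := sq z z' b bz zb bz' zb' z1 z1'.
have h0 : 0 <= h by clear -ay ya; lra.
have dx : `|s * x - s * x'| <= 4 * h.
  have e1 : (s * x - s * x') * (s * x + s * x') = (y' ^+ 2 - y ^+ 2) + (z' ^+ 2 - z ^+ 2).
    have -> : (s * x - s * x') * (s * x + s * x') = s ^+ 2 * (x ^+ 2 - x' ^+ 2).
      by clear; lra.
    by rewrite s2; clear -e e'; lra.
  have sx1 : 1 <= s * x + s * x' by clear -sx sx'; lra.
  apply: (@le_trans _ _ (`|s * x - s * x'| * (s * x + s * x'))).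
    by rewrite ler_peMr.
  rewrite -[X in _ * X]ger0_norm; last by clear -sx1; lra.
  rewrite -normrM e1; apply: le_trans (ler_normD _ _) _.
  by rewrite distrC [X in _ + X]distrC; clear -y3 z3; lra.
have dx2 : (x - x') ^+ 2 <= (4 * h) ^+ 2.
  have -> : (x - x') ^+ 2 = `|s * x - s * x'| ^+ 2.
    by rewrite real_normK ?num_real// -mulrBr exprMn s2 mul1r.
  by rewrite ler_pXn2r ?nnegrE// mulr_ge0.
have := sqr_ge0 h; clear -dx2 y2 z2; nra.
Qed.

(** The cap is a graph over the other two coordinates, and a square grid of mesh 2 / N there induces
    (N + 1)^2 cells of diameter at most 10 / N. Since N + 1 <= 2 N, their total cost is bounded
    independently of [delta]. *)
Lemma cap_hausdorff (c : 'I_3) (s : R) (delta : R) : s ^+ 2 = 1 -> 0 < delta ->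
  (hausdorff2_delta (@sphere_dist R) delta [set p | (1 / 2 <= s * pt p 0 c)%R] <=
   (4 * (pi / 4 * 10 ^+ 2))%:E)%E.
Proof.
move=> s2 d0.
pose N := (Num.truncn (10 / delta)).+1.
have N0 : 0 < N%:R :> R by rewrite ltr0n.
pose h : R := 2 / N%:R.
have h0 : 0 <= h by rewrite divr_ge0.
have hd : 5 * h <= delta.
  have /andP[_ h1] := truncn_itv (ltW (divr_gt0 (ltr0n R 10) d0)).
  have e10 : 5 * 2 = 10 :> R by lra.
  by rewrite /h mulrA e10 ler_pdivrMr// [leRHS]mulrC -ler_pdivrMr// ltW.
(* The index k encodes the grid position as quotient and remainder by [N.+1]. *)
pose F (k : nat) : set (sphere R) := [set p | [/\ 1 / 2 <= s * pt p 0 c,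
  -1 + h * (k %/ N.+1)%:R <= pt p 0 (c + 1) <= -1 + h * (k %/ N.+1).+1%:R &
  -1 + h * (k %% N.+1)%:R <= pt p 0 (c + 2) <= -1 + h * (k %% N.+1).+1%:R]].
(* There are [N.+1] intervals rather than N because x = 1 falls into the one of index N. *)
have cell (x : R) : `|x| <= 1 ->
    exists2 i, (i < N.+1)%N & -1 + h * i%:R <= x <= -1 + h * i.+1%:R.
  rewrite ler_norml => /andP[x1 x2].
  have hp : 0 < h by rewrite divr_gt0.
  have x0 : 0 <= (x + 1) / h by rewrite divr_ge0// addrC -lerBlDl sub0r.
  have /andP[i1 i2] := truncn_itv x0.
  exists (Num.truncn ((x + 1) / h)).
    rewrite ltnS truncn_le_nat; apply: (@le_lt_trans _ _ N%:R); last by rewrite ltr_nat.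
    rewrite ler_pdivrMr// /h mulrCA mulfV ?gt_eqF// mulr1; lra.
  move: i1 i2; rewrite ler_pdivlMr// ltr_pdivrMr// [leLHS]mulrC => i1.
  by rewrite [ltRHS]mulrC => i2; apply/andP; split; lra.
apply: (@le_trans _ _ (hausdorff2_delta (@sphere_dist R) (5 * h)
  [set p | (1 / 2 <= s * pt p 0 c)%R])).
  exact: hausdorff2_delta_anti.
apply: le_trans (@hausdorff2_finite_cover _ _ _ (N.+1 * N.+1) (5 * h) F _ _ _ _) _.
- by rewrite mulr_ge0.
- move=> p /= pc.
  have [i iN ip] := cell _ (pt_le1 p (c + 1)).
  have [j jN jp] := cell _ (pt_le1 p (c + 2)).
  exists (i * N.+1 + j)%N => /=.
    apply: (@leq_trans (i * N.+1 + N.+1)); first by rewrite ltn_add2l.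
    by rewrite -mulSnr leq_mul2r iN orbT.
  by rewrite /F /= divnMDl// (divn_small jN) addn0 modnMDl (modn_small jN).
- move=> k p q _ [/= p0 /andP[p1 p1'] /andP[p2 p2']] [/= q0 /andP[q1 q1'] /andP[q2 q2']].
  rewrite /sphere_dist /enorm -[leRHS]ger0_norm ?mulr_ge0// -sqrtr_sqr ler_wsqrtr//.
  rewrite dotpE (sum_I3 _ c) !mxE -!expr2.
  have := sum_pt_sq p; have := sum_pt_sq q; rewrite !(sum_I3 _ c) => eqq eqp.
  move: p1 p1' p2 p2' q1 q1' q2 q2'; rewrite -[(_ %/ _).+1%:R]natr1 -[(_ %% _).+1%:R]natr1.
  rewrite !mulrDr !mulr1 !(addrA (-1 : R)) => p1 p1' p2 p2' q1 q1' q2 q2'.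
  apply: (cell_diameter s2 p0 q0 eqp eqq _ _ p1 p1' q1 q1' p2 p2' q2 q2').
    by split; exact: pt_le1.
  by split; exact: pt_le1.
rewrite lee_fin natrM /h.
have NN : N.+1%:R <= 2 * N%:R :> R.
  by rewrite -natrM ler_nat; lia.
have -> : N.+1%:R * N.+1%:R * (pi / 4 * (5 * (2 / N%:R)) ^+ 2) =
    (N.+1%:R / N%:R) ^+ 2 * (pi / 4 * 10 ^+ 2) :> R.
  move: (N%:R^-1 : R) => x; move: (N.+1%:R : R) => y; lra.
apply: ler_wpM2r; first by rewrite mulr_ge0 ?exprn_ge0 ?divr_ge0 ?pi_ge0.
have a2 : N.+1%:R / N%:R <= 2 :> R by rewrite ler_pdivrMr.
rewrite (_ : 4 = 2 ^+ 2) ?expr2; last lra.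
by apply: ler_pM => //; rewrite divr_ge0.
Qed.

(** The squared coordinates sum to 1, so they are not all at most 1/4, and six caps of height 1/2
    cover the sphere. In [capi], i encodes the axis i / 2 and the sign (-1)^(i mod 2). *)
Lemma dp_fin : (dp R setT < +oo)%E.
Proof.
pose cap (c : 'I_3) (s : R) : set (sphere R) := [set p | 1 / 2 <= s * pt p 0 c].
have capfin c s : s ^+ 2 = 1 -> (sphere_hausdorff R (cap c s) < +oo)%E.
  move=> s2; apply: (@le_lt_trans _ _ (4 * (pi / 4 * 10 ^+ 2))%:E); last exact: ltry.
  by apply: ge_ereal_sup => _ [d /= d0 <-]; exact: cap_hausdorff.
pose capi i := cap (inord (i %/ 2)) ((-1) ^+ (i %% 2)).
have sub : [set: sphere R] `<=` \bigcup_(i in `I_6) capi i.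
  move=> p _; apply: contrapT => np.
  have small (c : 'I_3) : pt p 0 c ^+ 2 <= 1 / 4.
    have nc b : ~ (1 / 2 <= (-1) ^+ (b %% 2) * pt p 0 c).
      move=> h; apply: np; exists (c * 2 + b %% 2)%N => /=.
        have := ltn_ord c; have := ltn_pmod b (isT : (0 < 2)%N); lia.
      rewrite /capi /cap /= divnMDl// (divn_small (ltn_pmod _ _))// addn0.
      by rewrite modnMDl modn_mod inord_val.
    have := nc 0%N; have := nc 1%N; rewrite /= expr0 expr1 mul1r mulN1r.
    move=> /negP; rewrite -ltNge => h1 /negP; rewrite -ltNge => h2.
    nra.
  have := sum_pt_sq p; rewrite sum_I3E.
  have := small 0; have := small 1; have := small 2; lra.
apply: (@le_lt_trans _ _ (sphere_hausdorff R (\bigcup_(i in `I_6) capi i))).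
  exact: le_outer_measure.
rewrite bigcup_mkord.
apply: le_lt_trans (outer_measure_subadditive (sphere_hausdorff R) capi 6) _.
apply: lte_sum_pinfty => i _; apply: capfin.
by rewrite -exprM mulnC exprM sqrrN expr1n expr1n.
Qed.

End sphere_geometry.

(** * Quadrics are null sets *)

(* Every point lies in at most n of the sets F k, so the sum of any number of
   their measures, which are equal, is at most n times the total mass. *)
Lemma measure0_few_roots {R : realType} d (T : measurableType d)
  (mu : {measure set T -> \bar R}) (F : nat -> set T) (m : \bar R)
  (P : T -> {poly R}) (n : nat) :
  (mu setT < +oo)%E -> (forall k, measurable (F k)) -> (forall k, mu (F k) = m) ->
  (forall x k, F k x -> root (P x) k%:R) -> (forall x, (size (P x) <= n.+1)%N) ->
  {ae mu, forall x, P x != 0} -> m = 0%E.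
Proof.
move=> muT mF muF FP sizeP P0.
(* The sum of the measures is the integral of the number of k < K with x in [F k]. These k give
   distinct roots of the nonzero polynomial [P x], of degree at most n. *)
have few K : (\sum_(k < K) mu (F k) <= n%:R%:E * mu setT)%E.
  have -> : (\sum_(k < K) mu (F k) = \int[mu]_x (\sum_(k < K) (\1_(F k) x)%:E))%E.
    rewrite ge0_integral_sum//.
      by apply: eq_bigr => k _; rewrite integral_indic// setIT.
    by move=> k; apply/measurable_EFinP/measurable_indic.
  rewrite -integral_cst//; apply: ae_ge0_le_integral => //.
  - by move=> x _; rewrite sume_ge0// => k _; rewrite lee_fin.
  - apply: emeasurable_sum => k; apply/measurable_EFinP/measurable_indic; exact: mF.
  - by move=> x _; rewrite lee_fin.
  - apply: filterS P0 => x Px _; rewrite sumEFin lee_fin /=.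
    under eq_bigr do rewrite indicE.
    rewrite -natr_sum ler_nat -ltnS.
    apply: leq_trans (sizeP x).
    rewrite (_ : (\sum_(k < K) (x \in F k) = size [seq k <- iota 0 K | x \in F k])%N); last first.
      rewrite size_filter -sum1_count [RHS]big_mkcond/=.
      rewrite -(big_mkord xpredT (fun k => nat_of_bool (x \in F k))) /index_iota subn0.
      by apply: eq_bigr => k _; case: (x \in F k).
    rewrite -(size_map (fun k : nat => k%:R : R)); apply: max_poly_roots => //.
      apply/allP => y /mapP[k]; rewrite mem_filter => /andP[/set_mem Fk _] ->{y}.
      exact: FP.
    by rewrite map_inj_uniq ?filter_uniq ?iota_uniq// => i j /eqP; rewrite eqr_nat => /eqP.
have m0 : (0 <= m)%E by rewrite -(muF 0%N).
have mfin : m \is a fin_num.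
  rewrite ge0_fin_numE// -(muF 0%N); apply: le_lt_trans muT.
  by apply: le_measure; rewrite ?inE.
have Tfin : mu setT \is a fin_num by rewrite ge0_fin_numE.
have {}few K : (\sum_(k < K) m <= n%:R%:E * mu setT)%E.
  by have := few K; under eq_bigr do rewrite muF.
move: few m0; move: mfin Tfin => /fineK <- /fineK <-.
move: (fine m) (fine (mu setT)) => a b few; rewrite lee_fin => a0.
congr EFin; apply/eqP; rewrite eq_le a0 andbT leNgt; apply/negP => ap.
(* This number of sets exceeds n b / a, which contradicts [few]. *)
have := few (Num.truncn (n%:R * b / a)).+1.
rewrite sumEFin sumr_const card_ord -EFinM lee_fin -[X in X <= _]mulr_natl -ler_pdivlMr//.
rewrite leNgt => /negP; apply.
have b0 : 0 <= n%:R * b / a.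
  have : (0 <= n%:R%:E * b%:E)%E.
    by apply: le_trans (few 0%N); rewrite big_ord0.
  by rewrite -EFinM lee_fin => h; rewrite divr_ge0.
by have /andP[] := truncn_itv b0.
Qed.

Section null_quadrics.
Context {R : realType}.
Implicit Types (p q : S2 R) (A M : 'M[R]_3) (v : 'rV[R]_3).

Lemma dotp_orthogonal M v w : M *m M^T = 1%:M -> dotp (v *m M) (w *m M) = dotp v w.
Proof. by move=> MM; rewrite /dotp trmx_mul mulmxA -(mulmxA v) MM mulmx1. Qed.

Lemma rotate_subproof M (MM : M *m M^T = 1%:M) (p : sphere R) :
  enorm (sphere_val p *m M) == 1.
Proof. by rewrite /enorm dotp_orthogonal// (valP p). Qed.

Definition rotate M (MM : M *m M^T = 1%:M) (p : sphere R) : sphere R :=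
  Sphere (rotate_subproof MM p).

(** The left set is contained in the image of the right one under p |-> p M^T. Stated for the outer
    measure, it applies to arbitrary N. *)
Lemma dp_orthogonal_le M (N : set 'rV[R]_3) : M *m M^T = 1%:M ->
  (sphere_hausdorff R [set p | N (sphere_val p *m M)%R] <=
   sphere_hausdorff R [set p | N (sphere_val p)])%E.
Proof.
move=> MM; have MM' : M^T *m M^T^T = 1%:M by rewrite trmxK mulmx1C.
apply: (@le_trans _ _ (sphere_hausdorff R (rotate MM' @` [set p | N (sphere_val p)]))).
  apply: le_outer_measure => p /= Np; exists (rotate MM p) => //.
  by apply: val_inj; rewrite /= -mulmxA MM mulmx1.
apply: hausdorff2_isometry => x y.
by rewrite /sphere_dist /enorm -mulmxBl dotp_orthogonal.
Qed.

Lemma dp_orthogonal M (N : set 'rV[R]_3) : M *m M^T = 1%:M ->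
  dp R [set p | N (pt p *m M)%R] = dp R [set p | N (pt p)].
Proof.
move=> MM; apply/eqP; rewrite eq_le; apply/andP; split.
  exact: dp_orthogonal_le.
have MM' : M^T *m M^T^T = 1%:M by rewrite trmxK mulmx1C.
apply: le_trans (dp_orthogonal_le (fun v => N (v *m M)) MM').
apply: le_outer_measure => p /= Np.
by rewrite -mulmxA mulmx1C// mulmx1.
Qed.

Definition quadric A : set (S2 R) := [set p | quadf A p = 0].

Lemma measurable_quadric A : measurable (quadric A).
Proof.
rewrite (_ : quadric A = setT `&` quadf A @^-1` [set 0]); last by rewrite setTI.
exact: (measurable_quadf A).
Qed.

Lemma dp_quadric_orthogonal A M : M *m M^T = 1%:M ->
  dp R (quadric (M *m A *m M^T)) = dp R (quadric A).
Proof.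
move=> MM; rewrite -(@dp_orthogonal M (fun v => dotp (v *m A) v = 0))//.
congr (dp R _); apply/seteqP; split => p /=;
  by rewrite /quadric /quadf /= /dotp trmx_mul !mulmxA.
Qed.

Lemma quadf_orthogonal A M p : quadf (M *m A *m M^T) p =
  dotp (pt p *m M *m A) (pt p *m M).
Proof. by rewrite /quadf /dotp trmx_mul !mulmxA. Qed.

Definition mx3 (s : seq (seq R)) : 'M[R]_3 := \matrix_(i, j) nth 0 (nth [::] s i) j.

Lemma matrix3P (A B : 'M[R]_3) :
  A 0 0 = B 0 0 -> A 0 1 = B 0 1 -> A 0 2 = B 0 2 ->
  A 1 0 = B 1 0 -> A 1 1 = B 1 1 -> A 1 2 = B 1 2 ->
  A 2 0 = B 2 0 -> A 2 1 = B 2 1 -> A 2 2 = B 2 2 -> A = B.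
Proof.
move=> *; apply/matrixP.
have I3 (i : 'I_3) : [\/ i = 0, i = 1 | i = 2].
  by case: i => -[|[|[|//]]] ?; [apply: Or31|apply: Or32|apply: Or33]; apply: val_inj.
by move=> i j; case: (I3 i) => ->; case: (I3 j) => ->.
Qed.

(* The rational parametrisation of the rotations about the third axis: incidence
   of a point with a rotated quadric becomes a polynomial equation in t. *)
Definition rotz (t : R) : 'M[R]_3 :=
  (1 + t ^+ 2)^-1 *: mx3 [:: [:: 1 - t ^+ 2; 2 * t; 0];
                           [:: - (2 * t); 1 - t ^+ 2; 0];
                           [:: 0; 0; 1 + t ^+ 2]].

Definition swapxz : 'M[R]_3 := mx3 [:: [:: 0; 0; 1]; [:: 0; 1; 0]; [:: 1; 0; 0]].

Lemma one_sqr_neq0 (t : R) : 1 + t ^+ 2 != 0.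
Proof. by rewrite gt_eqF// ltr_pwDl// sqr_ge0. Qed.

Lemma rotz_orthogonal t : rotz t *m (rotz t)^T = 1%:M.
Proof.
have E : (1 + t ^+ 2)^-1 * (1 + t ^+ 2) = 1 by rewrite mulVf ?one_sqr_neq0.
move: E; rewrite /rotz; move: (_^-1) => x E.
have E2 : x ^+ 2 * (1 + t ^+ 2) ^+ 2 = 1 by rewrite -exprMn E expr1n.
apply: matrix3P; rewrite !mxE sum_I3E !mxE /=; nra.
Qed.

Lemma swapxz_orthogonal : swapxz *m swapxz^T = 1%:M.
Proof. apply: matrix3P; rewrite !mxE sum_I3E !mxE /=; lra. Qed.

Lemma mul_rotz v t :
  [/\ (v *m rotz t) 0 0 = (1 + t ^+ 2)^-1 * (v 0 0 * (1 - t ^+ 2) - v 0 1 * (2 * t)),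
      (v *m rotz t) 0 1 = (1 + t ^+ 2)^-1 * (v 0 0 * (2 * t) + v 0 1 * (1 - t ^+ 2)) &
      (v *m rotz t) 0 2 = v 0 2].
Proof.
have E : (1 + t ^+ 2)^-1 * (1 + t ^+ 2) = 1 by rewrite mulVf ?one_sqr_neq0.
move: E; rewrite /rotz; move: (_^-1) => x E; rewrite !mxE !sum_I3E !mxE /=.
by split; [lra|lra|rewrite E; lra].
Qed.

Lemma mul_swapxz v : [/\ (v *m swapxz) 0 0 = v 0 2,
  (v *m swapxz) 0 1 = v 0 1 & (v *m swapxz) 0 2 = v 0 0].
Proof. by rewrite !mxE !sum_I3E !mxE /=; split; lra. Qed.

Lemma orthogonalM M1 M2 : M1 *m M1^T = 1%:M -> M2 *m M2^T = 1%:M ->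
  (M1 *m M2) *m (M1 *m M2)^T = 1%:M :> 'M[R]_3.
Proof. by move=> h1 h2; rewrite trmx_mul mulmxA -(mulmxA M1) h2 mulmx1. Qed.

Lemma Poly_eq0 (s : seq R) i : Poly s = 0 -> nth 0 s i = 0.
Proof. by move=> s0; rewrite -coef_Poly s0 coef0. Qed.

Lemma pt_neq0 p : ~ (pt p 0 0 = 0 /\ pt p 0 1 = 0 /\ pt p 0 2 = 0).
Proof.
move=> [x0 [y0 z0]]; have := sum_pt_sq p; rewrite sum_I3E x0 y0 z0.
by rewrite expr0n/= !addr0 => /eqP; rewrite eq_sym oner_eq0.
Qed.

Let proj_x : 'M[R]_3 := mx3 [:: [:: 1; 0; 0]; [:: 0; 0; 0]; [:: 0; 0; 0]].

Lemma dotp_proj_x v : dotp (v *m proj_x) v = v 0 0 ^+ 2.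
Proof.
rewrite dotpE sum_I3E ![(_ *m proj_x) _ _]mxE !sum_I3E /proj_x ![mx3 _ _ _]mxE /=; lra.
Qed.

(** Rotating the circle about the third axis alone would leave the poles on every copy. With
    [rotz *m swapxz *m rotz], incidence of (x, y, z) with the k-th copy is a polynomial equation in
    k with coefficients z, -2y, -4x, 2y, -z, which never all vanish on the sphere. *)
Lemma dp_great_circle : dp R (quadric proj_x) = 0%E.
Proof.
pose M (k : nat) := rotz k%:R *m swapxz *m rotz k%:R.
have MM k : M k *m (M k)^T = 1%:M.
  by rewrite /M; do ?apply: orthogonalM; rewrite ?rotz_orthogonal ?swapxz_orthogonal.
pose P p := Poly [:: pt p 0 2; - (2 * pt p 0 1); - (4 * pt p 0 0); 2 * pt p 0 1; - pt p 0 2].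
apply: (@measure0_few_roots _ _ _ (dp R) (fun k => quadric (M k *m proj_x *m (M k)^T)) _ P 4).
- exact: dp_fin.
- by move=> k; exact: measurable_quadric.
- by move=> k; exact: dp_quadric_orthogonal.
- move=> p k; rewrite /quadric/= quadf_orthogonal dotp_proj_x /M !mulmxA.
  have [-> _ _] := mul_rotz (pt p *m rotz k%:R *m swapxz) k%:R.
  have [-> -> _] := mul_swapxz (pt p *m rotz k%:R).
  have [_ -> ->] := mul_rotz (pt p) k%:R.
  have E : (1 + k%:R ^+ 2)^-1 * (1 + k%:R ^+ 2) = 1 :> R by rewrite mulVf ?one_sqr_neq0.
  have N0 := one_sqr_neq0 k%:R.
  move: (_^-1) E => u E /eqP; rewrite expf_eq0/= mulf_eq0.
  have u0 : u != 0 by apply: contra_eq_neq E => ->; rewrite mul0r eq_sym oner_eq0.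
  rewrite (negbTE u0)/= => /eqP h.
  rewrite /root /P horner_Poly /=; apply/eqP.
  (* The outer denominator has been dropped as a nonzero factor; this multiplication clears the
     inner one. *)
  have : (1 + k%:R ^+ 2) * (pt p 0 2 * (1 - k%:R ^+ 2) -
    u * (pt p 0 0 * (2 * k%:R) + pt p 0 1 * (1 - k%:R ^+ 2)) * (2 * k%:R)) = 0.
    by rewrite h mulr0.
  move: (pt p 0 0) (pt p 0 1) (pt p 0 2) E => x y z E h2.
  have : (1 + k%:R ^+ 2) * (z * (1 - k%:R ^+ 2)) -
    (u * (1 + k%:R ^+ 2)) * ((x * (2 * k%:R) + y * (1 - k%:R ^+ 2)) * (2 * k%:R)) = 0.
    by rewrite -[RHS]h2; clear; lra.
  rewrite E; clear; lra.
- by move=> p; apply: leq_trans (size_Poly _) _.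
- apply: aeW => p; apply/eqP => P0; apply: (@pt_neq0 p).
  have := Poly_eq0 0 P0; have := Poly_eq0 1 P0; have := Poly_eq0 2 P0 => /=.
  by move=> *; split; [|split]; lra.
Qed.

Lemma ae_pt0_neq0 : {ae dp R, forall p, pt p 0 0 != 0}.
Proof.
exists (quadric proj_x); split; [exact: measurable_quadric|exact: dp_great_circle|].
move=> p /= /negP; rewrite negbK => /eqP p0.
by rewrite /quadric /= /quadf dotp_proj_x p0 expr0n.
Qed.

Lemma ae_pt2_neq0 : {ae dp R, forall p, pt p 0 2 != 0}.
Proof.
exists (quadric (swapxz *m proj_x *m swapxz^T)); split; first exact: measurable_quadric.
  by rewrite dp_quadric_orthogonal ?swapxz_orthogonal//; exact: dp_great_circle.
move=> p /= /negP; rewrite negbK => /eqP p0.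
have [e0 e1 e2] := mul_swapxz (pt p).
by rewrite /quadric /= quadf_orthogonal dotp_proj_x e0 p0 expr0n.
Qed.

(* The excluded matrices are those of the quadrics invariant under rotz; P p is
   the numerator of quadf A at p rotated by rotz t, as a polynomial in t. *)
Lemma dp_quadric_rotz A : A^T = A ->
  ~ [/\ A 0 1 = 0, A 0 2 = 0, A 1 2 = 0 & A 0 0 = A 1 1] ->
  dp R (quadric A) = 0%E.
Proof.
move=> symA nA.
have s10 : A 1 0 = A 0 1 by rewrite -[in LHS]symA mxE.
have s20 : A 2 0 = A 0 2 by rewrite -[in LHS]symA mxE.
have s21 : A 2 1 = A 1 2 by rewrite -[in LHS]symA mxE.
pose P p := let x := pt p 0 0 in let y := pt p 0 1 in let z := pt p 0 2 in
  let a := A 0 0 in let b := A 1 1 in let c := A 2 2 in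
  let d := A 0 1 in let e := A 0 2 in let f := A 1 2 in Poly [::
    a * x ^+ 2 + b * y ^+ 2 + c * z ^+ 2 + 2 * d * x * y + 2 * e * x * z + 2 * f * y * z;
    4 * x * y * (b - a) + 4 * d * (x ^+ 2 - y ^+ 2) - 4 * e * y * z + 4 * f * x * z;
    a * (4 * y ^+ 2 - 2 * x ^+ 2) + b * (4 * x ^+ 2 - 2 * y ^+ 2) + 2 * c * z ^+ 2
      - 12 * d * x * y;
    4 * x * y * (a - b) + 4 * d * (y ^+ 2 - x ^+ 2) - 4 * e * y * z + 4 * f * x * z;
    a * x ^+ 2 + b * y ^+ 2 + c * z ^+ 2 + 2 * d * x * y - 2 * e * x * z - 2 * f * y * z].
apply: (@measure0_few_roots _ _ _ (dp R)
  (fun k => quadric (rotz k%:R *m A *m (rotz k%:R)^T)) _ P 4).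
- exact: dp_fin.
- by move=> k; exact: measurable_quadric.
- by move=> k; apply: dp_quadric_orthogonal; exact: rotz_orthogonal.
- move=> p k; rewrite /quadric/= quadf_orthogonal dotpE !sum_I3E.
  rewrite ![(_ *m A) _ _]mxE !sum_I3E.
  have [-> -> ->] := mul_rotz (pt p) k%:R.
  rewrite s10 s20 s21.
  have E : (1 + k%:R ^+ 2)^-1 * (1 + k%:R ^+ 2) = 1 :> R by rewrite mulVf ?one_sqr_neq0.
  have N0 := one_sqr_neq0 k%:R.
  rewrite /root /P horner_Poly /=.
  move: (A 0 0) (A 1 1) (A 2 2) (A 0 1) (A 0 2) (A 1 2) => a b c d e f.
  move: (pt p 0 0) (pt p 0 1) (pt p 0 2) => x y z.
  move: (k%:R) E N0 => t; move: (_^-1) => u E N0 h.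
  set X := x * _ - _ in h; set Y := x * _ + _ in h.
  have EX : X = (1 + t ^+ 2) * (u * X) by rewrite mulrA [_ * u]mulrC E mul1r.
  have EY : Y = (1 + t ^+ 2) * (u * Y) by rewrite mulrA [_ * u]mulrC E mul1r.
  (* X, Y and (1 + t^2) z are the rotated coordinates times 1 + t^2, so the polynomial at t is (1 +
     t^2)^2 times the quadratic form at the rotated point. *)
  apply/eqP; transitivity (a * X ^+ 2 + b * Y ^+ 2 + c * ((1 + t ^+ 2) * z) ^+ 2 +
      2 * d * X * Y + 2 * e * X * ((1 + t ^+ 2) * z) + 2 * f * Y * ((1 + t ^+ 2) * z)).
    by rewrite /X /Y; clear; lra.
  rewrite EX EY; move: (u * X) (u * Y) h => X' Y' h.
  by transitivity ((1 + t ^+ 2) ^+ 2 * 0); [rewrite -h; clear; lra|rewrite mulr0].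
- by move=> p; apply: leq_trans (size_Poly _) _.
(* If all coefficients vanish, two linear systems arise: one for (e, f), after division by z, of
   determinant x^2 + y^2 up to sign, and one for (d, a - b) of determinant (x^2 + y^2)^2 up to sign.
   Excluding x = 0 and z = 0 makes both solvable only by 0. *)
- apply: filterS2 ae_pt0_neq0 ae_pt2_neq0 => p x0 z0; apply/eqP => P0; apply: nA.
  have := Poly_eq0 0 P0; have := Poly_eq0 1 P0; have := Poly_eq0 2 P0.
  have := Poly_eq0 3 P0; have := Poly_eq0 4 P0 => /=.
  move: (A 0 0) (A 1 1) (A 2 2) (A 0 1) (A 0 2) (A 1 2) => a b c d e f.
  move: (pt p 0 0) (pt p 0 1) (pt p 0 2) x0 z0 => x y z x0 z0 h4 h3 h2 h1 h0.
  have xy0 : x ^+ 2 + y ^+ 2 != 0.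
    by rewrite gt_eqF// ltr_pwDl ?sqr_ge0// exprn_even_gt0.
  have xy20 : (x ^+ 2 + y ^+ 2) ^+ 2 != 0 by rewrite expf_neq0.
  have e1 : z * (f * x - e * y) = 0 by clear -h1 h3; lra.
  have e2 : z * (e * x + f * y) = 0 by clear -h0 h4; lra.
  have {}e1 : f * x - e * y = 0 by move/eqP: e1; rewrite mulf_eq0 (negbTE z0) => /eqP.
  have {}e2 : e * x + f * y = 0 by move/eqP: e2; rewrite mulf_eq0 (negbTE z0) => /eqP.
  have ee : e * (x ^+ 2 + y ^+ 2) = x * (e * x + f * y) - y * (f * x - e * y) by clear; lra.
  have ff : f * (x ^+ 2 + y ^+ 2) = x * (f * x - e * y) + y * (e * x + f * y) by clear; lra.
  have g1 : x * y * (b - a) + d * (x ^+ 2 - y ^+ 2) = 0 by clear -h1 h3; lra.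
  have g2 : (a - b) * (x ^+ 2 - y ^+ 2) + 4 * d * x * y = 0 by clear -h0 h4 h2; lra.
  have dd : d * (x ^+ 2 + y ^+ 2) ^+ 2 =
    (x ^+ 2 - y ^+ 2) * (x * y * (b - a) + d * (x ^+ 2 - y ^+ 2)) +
    x * y * ((a - b) * (x ^+ 2 - y ^+ 2) + 4 * d * x * y) by clear; lra.
  have ab : (a - b) * (x ^+ 2 + y ^+ 2) ^+ 2 =
    (x ^+ 2 - y ^+ 2) * ((a - b) * (x ^+ 2 - y ^+ 2) + 4 * d * x * y) -
    4 * x * y * (x * y * (b - a) + d * (x ^+ 2 - y ^+ 2)) by clear; lra.
  have z_eq (u v : R) : v != 0 -> u * v = 0 -> u = 0.
    by move=> v0 /eqP; rewrite mulf_eq0 (negbTE v0) orbF => /eqP.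
  split.
  + by apply: (z_eq _ _ xy20); rewrite dd g1 g2 !mulr0 addr0.
  + by apply: (z_eq _ _ xy0); rewrite ee e1 e2 !mulr0 subr0.
  + by apply: (z_eq _ _ xy0); rewrite ff e1 e2 !mulr0 addr0.
  + apply/eqP; rewrite -subr_eq0; apply/eqP.
    by apply: (z_eq _ _ xy20); rewrite ab g1 g2 !mulr0 subr0.
Qed.

(** If the measure is not 0, the quadric is one of the exceptional ones for the third axis and,
    after [swapxz], for the first axis too. Then A is scalar, and a nonzero scalar form has no zero
    on the sphere. *)
Lemma dp_quadric0 A : A^T = A -> A != 0 -> dp R (quadric A) = 0%E.
Proof.
move=> symA A0; apply: contrapT => nA.
have [d01 d02 d12 d11] : [/\ A 0 1 = 0, A 0 2 = 0, A 1 2 = 0 & A 0 0 = A 1 1].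
  by apply: contrapT => h; apply: nA; exact: dp_quadric_rotz.
pose A' := swapxz *m A *m swapxz^T.
have symA' : A'^T = A' by rewrite !trmx_mul trmxK symA mulmxA.
have [_ _ _] : [/\ A' 0 1 = 0, A' 0 2 = 0, A' 1 2 = 0 & A' 0 0 = A' 1 1].
  apply: contrapT => h; apply: nA.
  by rewrite -(dp_quadric_orthogonal A swapxz_orthogonal); exact: dp_quadric_rotz.
rewrite !mxE !sum_I3E ![(_ *m A) _ _]mxE !sum_I3E.
rewrite ![swapxz _ _]mxE ![swapxz^T _ _]mxE ![swapxz _ _]mxE /= => d22.
have AE : A = (A 0 0)%:M.
  have s10 : A 1 0 = A 0 1 by rewrite -[in LHS]symA mxE.
  have s20 : A 2 0 = A 0 2 by rewrite -[in LHS]symA mxE.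
  have s21 : A 2 1 = A 1 2 by rewrite -[in LHS]symA mxE.
  by apply: matrix3P; rewrite [RHS]mxE/=; lra.
have a0 : A 0 0 != 0.
  by apply: contra_neq A0 => a0; rewrite AE a0; apply/matrixP => i j; rewrite !mxE mul0rn.
apply: nA; rewrite (_ : quadric A = set0) ?measure0//.
apply/seteqP; split => // p; rewrite /quadric /= AE /quadf mul_mx_scalar.
rewrite /dotp -scalemxAl mxE -/(dotp _ _) dotp_pt mulr1 => /eqP.
by rewrite (negbTE a0).
Qed.

(** The unique continuation property of quadratic forms: it makes the Gram map of a charged set
    injective and identifies the forms found on different sets. *)
Lemma quadf_eq0_on (S : set (S2 R)) A : measurable S -> dp R S != 0%E -> A^T = A ->
  {ae dp R, forall p, S p -> quadf A p = 0} -> A = 0.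
Proof.
move=> mS S0 symA [N [mN N0 SN]]; apply: contraNeq S0 => A0.
rewrite -measure_le0; apply: (@le_trans _ _ (dp R (quadric A `|` N))).
  apply: le_measure; rewrite ?inE//.
    by apply: measurableU => //; exact: measurable_quadric.
  move=> p Sp; have [qp|qp] := eqVneq (quadf A p) 0; [by left|right].
  by apply: SN => /= /(_ Sp) /eqP; rewrite (negbTE qp).
rewrite (le_trans (measureU2 _ _ _))//; first exact: measurable_quadric.
rewrite -[leRHS]adde0; apply: leeD; rewrite le_eqVlt; apply/orP; left; apply/eqP.
  exact: dp_quadric0.
exact: N0.
Qed.

End null_quadrics.

(** * Integrals over a finite measure *)

Notation L1 mu f := (mu.-integrable setT (EFin \o f)).

Section finite_measure_integral.
Context d (T : measurableType d) (R : realType).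
Variable mu : {measure set T -> \bar R}.
Implicit Types f g : T -> R.

Lemma L1_measurable f : L1 mu f -> measurable_fun setT f.
Proof. by move=> /measurable_int/measurable_EFinP. Qed.

Lemma L1_bounded f c : (mu setT < +oo)%E -> measurable_fun setT f ->
  (forall x, `|f x| <= c) -> L1 mu f.
Proof.
move=> muT mf fc; apply: measurable_bounded_integrable => //.
by exists c; split; [exact: num_real|move=> M cM x _ /=; exact: le_trans (ltW cM)].
Qed.

Lemma L1_mulr f g c : L1 mu f -> measurable_fun setT g -> (forall x, `|g x| <= c) ->
  L1 mu (fun x => f x * g x).
Proof.
move=> If mg gc.
have : mu.-integrable setT ((EFin \o f) \* (EFin \o g))%E.
  apply: integrableMl => //.
  by exists c; split; [exact: num_real|move=> M cM x _ /=; exact: le_trans (ltW cM)].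
by apply: eq_integrable.
Qed.

Lemma L1D f g : L1 mu f -> L1 mu g -> L1 mu (fun x => f x + g x).
Proof. by move=> If Ig; have := integrableD measurableT If Ig; apply: eq_integrable. Qed.

Lemma L1B f g : L1 mu f -> L1 mu g -> L1 mu (fun x => f x - g x).
Proof. by move=> If Ig; have := integrableB measurableT If Ig; apply: eq_integrable. Qed.

Lemma L1Z f k : L1 mu f -> L1 mu (fun x => k * f x).
Proof. by move=> If; have := integrableZl measurableT k If; apply: eq_integrable. Qed.

Lemma L1_sum I (r : seq I) (F : I -> T -> R) : (forall i, L1 mu (F i)) ->
  L1 mu (fun x => \sum_(i <- r) F i x).
Proof.
move=> IF; have := @integrable_sum _ _ _ mu setT measurableT I r xpredT
  (fun i => EFin \o F i) (fun i _ => IF i).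
by apply: eq_integrable => // x _ /=; rewrite sumEFin.
Qed.

Lemma L1_ae_eq f g : L1 mu f -> measurable_fun setT g -> {ae mu, forall x, f x = g x} ->
  L1 mu g.
Proof.
move=> /integrableP[mf If] mg fg; apply/integrableP; split; first exact/measurable_EFinP.
rewrite (_ : integral _ _ _ = (\int[mu]_x `|(EFin \o f) x|)%E)//.
apply: ae_eq_integral => //.
- by apply: measurableT_comp => //; exact/measurable_EFinP.
- by apply: measurableT_comp.
- by apply: filterS fg => x /= -> _.
Qed.

Lemma L1_ae_le f g : measurable_fun setT f -> L1 mu g ->
  {ae mu, forall x, `|f x| <= g x} -> L1 mu f.
Proof.
move=> mf Ig fg.
(* Setting f to 0 where the bound fails turns the almost everywhere bound into one valid
   everywhere. *)
pose f' x := if `|f x| <= g x then f x else 0.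
have mg := L1_measurable Ig.
have mf' : measurable_fun setT f'.
  apply: measurable_fun_ifT => //; apply: measurable_fun_ler => //.
  exact: measurableT_comp.
have If' : L1 mu f'.
  apply: (le_integrable measurableT _ _ Ig); first exact/measurable_EFinP.
  move=> x _ /=; rewrite /f' lee_fin; case: ifPn => [h|_].
    by rewrite (le_trans h)// ler_norm.
  by rewrite normr0.
apply: (L1_ae_eq If') => //; apply: filterS fg => x fgx.
by rewrite /f' fgx.
Qed.

Lemma Rint_ae_eq f g : measurable_fun setT f -> measurable_fun setT g ->
  {ae mu, forall x, f x = g x} -> \int[mu]_x f x = \int[mu]_x g x.
Proof.
move=> mf mg fg; rewrite /Rintegral; congr fine; apply: ae_eq_integral => //.
- exact/measurable_EFinP.
- exact/measurable_EFinP.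
- by apply: filterS fg => x -> _.
Qed.

Lemma RintD f g : L1 mu f -> L1 mu g ->
  \int[mu]_x (f x + g x) = \int[mu]_x f x + \int[mu]_x g x.
Proof. by move=> If Ig; rewrite RintegralD. Qed.

Lemma RintB f g : L1 mu f -> L1 mu g ->
  \int[mu]_x (f x - g x) = \int[mu]_x f x - \int[mu]_x g x.
Proof. by move=> If Ig; rewrite RintegralB. Qed.

Lemma RintZ f k : L1 mu f -> \int[mu]_x (k * f x) = k * \int[mu]_x f x.
Proof. by move=> If; rewrite RintegralZl. Qed.

Lemma Rint_sum I (r : seq I) (F : I -> T -> R) : (forall i, L1 mu (F i)) ->
  \int[mu]_x (\sum_(i <- r) F i x) = \sum_(i <- r) \int[mu]_x F i x.
Proof.
move=> IF; elim: r => [|i r IH].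
  rewrite big_nil -[RHS](mul0r (fine (mu setT))) -Rintegral_cst//.
  by apply: eq_Rintegral => x _; rewrite big_nil.
rewrite big_cons -IH -RintD//; last exact: L1_sum.
by apply: eq_Rintegral => x _; rewrite big_cons.
Qed.

Lemma Rint_ae_ge0 f : L1 mu f -> {ae mu, forall x, 0 <= f x} -> 0 <= \int[mu]_x f x.
Proof.
move=> If f0; have mf := L1_measurable If.
rewrite (@Rint_ae_eq _ (fun x => Num.max (f x) 0))//.
- by apply: Rintegral_ge0 => x _; rewrite le_max lexx orbT.
- exact: measurable_maxr.
- by apply: filterS f0 => x /max_l ->.
Qed.

Lemma Rint_ae_le f g : L1 mu f -> L1 mu g -> {ae mu, forall x, f x <= g x} ->
  \int[mu]_x f x <= \int[mu]_x g x.
Proof.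
move=> If Ig fg; rewrite -subr_ge0 -RintB//; apply: Rint_ae_ge0; first exact: L1B.
by apply: filterS fg => x; rewrite subr_ge0.
Qed.

Lemma Rint_eq0_ae f : L1 mu f -> {ae mu, forall x, 0 <= f x} -> \int[mu]_x f x = 0 ->
  {ae mu, forall x, f x = 0}.
Proof.
move=> If f0 i0; have mf := L1_measurable If.
have mEf : measurable_fun setT (EFin \o f) by exact/measurable_EFinP.
have : (\int[mu]_x `|(EFin \o f) x| = 0)%E.
  rewrite (_ : integral _ _ _ = (\int[mu]_x (EFin \o f) x)%E); last first.
    apply: ae_eq_integral => //; first exact: measurableT_comp.
    by apply: filterS f0 => x fx _ /=; rewrite ger0_norm.
  move: i0; rewrite /Rintegral => i0.
  by rewrite -(fineK (integrable_fin_num measurableT If)) i0.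
move=> /(ae_eq_integral_abs mu measurableT mEf); apply: filterS => x /= h.
by have [] := h I.
Qed.

End finite_measure_integral.

(* Otherwise conversion unfolds the Hausdorff measure inside dp. *)
Opaque sphere_hausdorff.

(** * Second moments *)

Section moments.
Context {R : realType}.
Implicit Types (p : S2 R) (A B M : 'M[R]_3) (phi psi : S2 R -> R).

Definition frob A B : R := \sum_i \sum_j A i j * B i j.

(** This norm is convenient because products of coordinates are at most 1 in absolute value on the
    sphere, so it bounds [quadf A] without a constant. *)
Definition l1norm A : R := \sum_i \sum_j `|A i j|.

(** The trace is not removed: it is the integral of [phi], so one matrix records both the mass and
    the traceless moment. *)
Definition mom phi : 'M[R]_3 :=
  \matrix_(i, j) \int[dp R]_p (phi p * (pt p 0 i * pt p 0 j)).

Lemma quadf_frob A p : quadf A p = frob A ((pt p)^T *m pt p).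
Proof.
rewrite quadfE; apply: eq_bigr => i _; apply: eq_bigr => j _.
by rewrite !mxE big_ord1 !mxE.
Qed.

Lemma frobDl A B M : frob (A + B) M = frob A M + frob B M.
Proof.
rewrite /frob -big_split; apply: eq_bigr => i _; rewrite -big_split.
by apply: eq_bigr => j _; rewrite mxE mulrDl.
Qed.

Lemma frobZl k A M : frob (k *: A) M = k * frob A M.
Proof.
rewrite /frob mulr_sumr; apply: eq_bigr => i _; rewrite mulr_sumr.
by apply: eq_bigr => j _; rewrite mxE mulrA.
Qed.

Lemma frobC A B : frob A B = frob B A.
Proof. by apply: eq_bigr => i _; apply: eq_bigr => j _; rewrite mulrC. Qed.

Lemma frobNl A M : frob (- A) M = - frob A M.
Proof. by rewrite -scaleN1r frobZl mulN1r. Qed.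

Lemma frobBl A B M : frob (A - B) M = frob A M - frob B M.
Proof. by rewrite frobDl frobNl. Qed.

Lemma frobDr A B M : frob M (A + B) = frob M A + frob M B.
Proof. by rewrite ![frob M _]frobC frobDl. Qed.

Lemma frobZr k A M : frob M (k *: A) = k * frob M A.
Proof. by rewrite ![frob M _]frobC frobZl. Qed.

Lemma frobBr A B M : frob M (A - B) = frob M A - frob M B.
Proof. by rewrite ![frob M _]frobC frobBl. Qed.

Lemma frob_scalar A k : frob A k%:M = k * \tr A.
Proof.
rewrite /frob /mxtrace mulr_sumr; apply: eq_bigr => i _.
rewrite (bigD1 i)//= mxE eqxx mulr1n mulrC big1 ?addr0// => j ji.
by rewrite mxE eq_sym (negbTE ji) mulr0.
Qed.

Lemma mxtrace_frob A B : B^T = B -> \tr (A *m B) = frob A B.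
Proof.
move=> symB; apply: eq_bigr => i _; rewrite mxE; apply: eq_bigr => j _.
by rewrite -[in LHS]symB mxE.
Qed.

Lemma frob_eq0 A : frob A A = 0 -> A = 0.
Proof.
move=> A0; apply/matrixP => i j; rewrite mxE; apply/eqP.
have Aij : A i j ^+ 2 <= frob A A.
  rewrite /frob (bigD1 i)//= (bigD1 j)//= -expr2 -addrA lerDl.
  apply: addr_ge0; apply: sumr_ge0 => k _; first by rewrite -expr2 sqr_ge0.
  by apply: sumr_ge0 => l _; rewrite -expr2 sqr_ge0.
have : A i j ^+ 2 == 0 by rewrite eq_le sqr_ge0 -A0 Aij.
by rewrite expf_eq0.
Qed.

Lemma l1norm_ge0 A : 0 <= l1norm A.
Proof. by apply: sumr_ge0 => i _; apply: sumr_ge0. Qed.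

Lemma coord2_le1 p i j : `|pt p 0 i * pt p 0 j| <= 1.
Proof. by rewrite normrM mulr_ile1// pt_le1. Qed.

Lemma quadf_le A p : `|quadf A p| <= l1norm A.
Proof.
rewrite quadfE; apply: le_trans (ler_norm_sum _ _ _) _; apply: ler_sum => i _.
apply: le_trans (ler_norm_sum _ _ _) _; apply: ler_sum => j _.
by rewrite normrM ler_piMr// coord2_le1.
Qed.

Lemma quadfD A B p : quadf (A + B) p = quadf A p + quadf B p.
Proof. by rewrite !quadf_frob frobDl. Qed.

Lemma quadfZ k A p : quadf (k *: A) p = k * quadf A p.
Proof. by rewrite !quadf_frob frobZl. Qed.

Lemma quadfB A B p : quadf (A - B) p = quadf A p - quadf B p.
Proof. by rewrite !quadf_frob frobBl. Qed.

Lemma quadf_scalar k p : quadf k%:M p = k.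
Proof.
by rewrite /quadf mul_mx_scalar /dotp -scalemxAl mxE -/(dotp _ _) dotp_pt mulr1.
Qed.

Lemma quadf_sum I (r : seq I) (F : I -> 'M[R]_3) p :
  quadf (\sum_(i <- r) F i) p = \sum_(i <- r) quadf (F i) p.
Proof.
elim/big_ind2 : _ => //; last by move=> A x B y <- <-; rewrite quadfD.
by rewrite (_ : 0 = 0%:M) ?quadf_scalar// raddf0.
Qed.

Lemma measurable_coord2 i j : measurable_fun [set: S2 R] (fun p => pt p 0 i * pt p 0 j).
Proof. by apply: measurable_funM; exact: measurable_coord. Qed.

Lemma L1_coord2 phi i j : L1 (dp R) phi -> L1 (dp R) (fun p => phi p * (pt p 0 i * pt p 0 j)).
Proof.
by move=> I; exact: (L1_mulr I (measurable_coord2 i j) (fun p => coord2_le1 p i j)).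
Qed.

Lemma L1_quadf phi A : L1 (dp R) phi -> L1 (dp R) (fun p => phi p * quadf A p).
Proof.
by move=> I; exact: (L1_mulr I (measurable_quadf A) (quadf_le A)).
Qed.

Lemma Rint_quadf phi A : L1 (dp R) phi ->
  \int[dp R]_p (phi p * quadf A p) = frob A (mom phi).
Proof.
move=> I.
have IA i j : L1 (dp R) (fun p => A i j * (phi p * (pt p 0 i * pt p 0 j))).
  by apply: L1Z; exact: L1_coord2.
transitivity (\int[dp R]_p (\sum_i \sum_j A i j * (phi p * (pt p 0 i * pt p 0 j)))).
  apply: eq_Rintegral => p _; rewrite quadfE mulr_sumr; apply: eq_bigr => i _.
  by rewrite mulr_sumr; apply: eq_bigr => j _; rewrite mulrCA.
rewrite Rint_sum; last by move=> i; exact: L1_sum.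
apply: eq_bigr => i _; rewrite Rint_sum//; apply: eq_bigr => j _.
by rewrite RintZ ?mxE//; exact: L1_coord2.
Qed.

Lemma mom_sym phi : (mom phi)^T = mom phi.
Proof.
by apply/matrixP => i j; rewrite !mxE; apply: eq_Rintegral => p _; rewrite [pt p 0 j * _]mulrC.
Qed.

Lemma mxtrace_mom phi : L1 (dp R) phi -> \tr (mom phi) = \int[dp R]_p phi p.
Proof.
move=> I; rewrite -[LHS]mul1r -frob_scalar frobC -Rint_quadf//.
by apply: eq_Rintegral => p _; rewrite quadf_scalar mulr1.
Qed.

Lemma momD phi psi : L1 (dp R) phi -> L1 (dp R) psi ->
  mom (fun p => phi p + psi p) = mom phi + mom psi.
Proof.
move=> I1 I2; apply/matrixP => i j; rewrite !mxE -RintD; [|exact: L1_coord2..].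
by apply: eq_Rintegral => p _; rewrite mulrDl.
Qed.

Lemma momZ phi k : L1 (dp R) phi -> mom (fun p => k * phi p) = k *: mom phi.
Proof.
move=> I1; apply/matrixP => i j; rewrite !mxE -RintZ; last exact: L1_coord2.
by apply: eq_Rintegral => p _; rewrite -mulrA.
Qed.

Lemma momB phi psi : L1 (dp R) phi -> L1 (dp R) psi ->
  mom (fun p => phi p - psi p) = mom phi - mom psi.
Proof.
move=> I1 I2; apply/matrixP => i j; rewrite !mxE -RintB; [|exact: L1_coord2..].
by apply: eq_Rintegral => p _; rewrite mulrBl.
Qed.

Lemma mom_le phi c i j : measurable_fun setT phi -> (forall p, `|phi p| <= c) ->
  `|mom phi i j| <= c * fine (dp R setT).
Proof.
move=> mphi phic; have I : L1 (dp R) phi by apply: L1_bounded phic => //; exact: dp_fin.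
rewrite mxE -Rintegral_cst//; apply: le_trans (le_normr_Rintegral _ _) _ => //.
  exact: L1_coord2.
apply: Rint_ae_le.
- by apply: integrable_norm; exact: L1_coord2.
- by apply: (@L1_bounded _ _ _ _ _ `|c|) => //; exact: dp_fin.
- apply: aeW => p; rewrite normrM; apply: le_trans (phic p).
  by rewrite ler_piMr// coord2_le1.
Qed.

Lemma measurable_indic_S2 (S : set (S2 R)) : measurable S ->
  measurable_fun setT (\1_S : S2 R -> R).
Proof. by move=> mS; exact: measurable_indic. Qed.

Lemma indic_le1 (S : set (S2 R)) p : `|\1_S p| <= 1 :> R.
Proof. by rewrite indicE; case: (_ \in _); rewrite ?normr1 ?normr0. Qed.

Lemma L1_indic (S : set (S2 R)) : measurable S -> L1 (dp R) (\1_S : S2 R -> R).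
Proof.
by move=> mS; exact: (L1_bounded dp_fin (measurable_indic_S2 mS) (indic_le1 S)).
Qed.

Lemma L1_cut (S : set (S2 R)) A : measurable S -> L1 (dp R) (fun p => \1_S p * quadf A p).
Proof. by move=> mS; exact: (L1_quadf A (L1_indic mS)). Qed.

Lemma sym_skew_split A B M : A^T = A -> M^T = M -> A + (B - B^T) = M ->
  B^T = B /\ A = M.
Proof.
move=> symA symM AB.
have E i j : A i j + (B i j - B j i) = M i j by rewrite -AB !mxE.
have sA i j : A i j = A j i by rewrite -[in LHS]symA mxE.
have sM i j : M i j = M j i by rewrite -[in LHS]symM mxE.
by split; apply/matrixP => i j; rewrite ?mxE;
  have := E i j; have := E j i; rewrite (sA i) (sM i); lra.
Qed.

(* The moments of the quadratic forms cut off to S exhaust the symmetric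
   matrices. Adding B - B^T makes B |-> mom (\1_S * quadf B) injective on all
   matrices, hence bijective. *)
Lemma gram_solve (S : set (S2 R)) : measurable S -> dp R S != 0%E ->
  exists2 C, 0 <= C & forall M, M^T = M -> exists B,
    [/\ B^T = B, mom (fun p => \1_S p * quadf B p) = M &
        forall p, `|quadf B p| <= C * l1norm M].
Proof.
move=> mS S0.
pose T B := mom (fun p => \1_S p * quadf B p) + (B - B^T).
have lT : linear T.
  move=> k A B; rewrite /T.
  have -> : mom (fun p => \1_S p * quadf (k *: A + B) p) =
      k *: mom (fun p => \1_S p * quadf A p) + mom (fun p => \1_S p * quadf B p).
    rewrite -momZ; last exact: L1_cut.
    rewrite -momD; [|by apply: L1Z; exact: L1_cut|exact: L1_cut].
    by congr mom; apply/funext => p; rewrite quadfD quadfZ mulrDr mulrCA.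
  move: (mom _) (mom _) => X Y; apply/matrixP => i j; rewrite !mxE; lra.
pose TL : {linear 'M[R]_3 -> 'M[R]_3} := HB.pack T (GRing.isLinear.Build R _ _ *:%R T lT).
pose f := linfun TL.
have fE B : f B = T B by rewrite lfunE.
have symT B M : M^T = M -> T B = M ->
    B^T = B /\ mom (fun p => \1_S p * quadf B p) = M.
  by move=> symM TB; exact: (sym_skew_split (mom_sym _) symM TB).
have kerf : lker f == 0%VS.
  apply/lker0P => A B; rewrite !fE => TAB; apply/eqP; rewrite -subr_eq0; apply/eqP.
  have TAB0 : T (A - B) = 0.
    rewrite -[LHS]/(TL (A - B)) linearB; apply/eqP; rewrite subr_eq0; apply/eqP.
    exact: TAB.
  have [|symAB momAB] := symT (A - B) 0 _ TAB0; first by rewrite trmx0.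
  apply: (quadf_eq0_on mS S0 symAB).
  (* Pairing the vanishing moment with A - B itself gives the integral over S of the square of
     [quadf (A - B)]. *)
  have i0 : \int[dp R]_p (\1_S p * quadf (A - B) p * quadf (A - B) p) = 0.
    rewrite (Rint_quadf _ (L1_cut _ mS)) momAB.
    by rewrite -[0](scale0r 0) frobZr mul0r.
  have pos p : 0 <= \1_S p * quadf (A - B) p * quadf (A - B) p :> R.
    by rewrite -mulrA mulr_ge0// -expr2 sqr_ge0.
  have := Rint_eq0_ae (L1_quadf _ (L1_cut _ mS)) (aeW _ pos) i0.
  apply: filterS => p /eqP + Sp; rewrite indicE mem_set// mul1r mulf_eq0 orbb.
  by move=> /eqP.
(* The uniform constant comes from the preimages of the nine elementary matrices. *)
pose D (i j : 'I_3) := (f^-1)%VF (delta_mx i j).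
exists (\sum_i \sum_j l1norm (D i j)).
  by apply: sumr_ge0 => i _; apply: sumr_ge0 => j _; exact: l1norm_ge0.
move=> M symM; exists ((f^-1)%VF M).
have [|symB momB] := symT ((f^-1)%VF M) M symM; first by rewrite -fE lker0_lfunVK.
split => // p; rewrite [in X in quadf X](matrix_sum_delta M) !linear_sum quadf_sum.
rewrite mulrC /l1norm mulr_suml; apply: le_trans (ler_norm_sum _ _ _) _.
apply: ler_sum => i _; rewrite linear_sum quadf_sum mulr_suml.
apply: le_trans (ler_norm_sum _ _ _) _; apply: ler_sum => j _.
rewrite linearZ quadfZ normrM ler_wpM2l//; apply: le_trans (quadf_le _ _) _.
rewrite (bigD1 i)//= (bigD1 j)//= -addrA lerDl addr_ge0//.
  by apply: sumr_ge0 => k _; exact: l1norm_ge0.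
by apply: sumr_ge0 => k _; apply: sumr_ge0 => l _; exact: l1norm_ge0.
Qed.

End moments.

(** * The energy *)

(** The integrable lower bound makes the negative part integrable; then an integral below [+oo]
    forces the positive part to be integrable as well. *)
Lemma integrable_of_lower_bound d (T : measurableType d) (R : realType)
    (mu : {measure set T -> \bar R}) (k : T -> \bar R) (b : T -> R) :
  measurable_fun setT k -> L1 mu b -> {ae mu, forall x, ((- b x)%:E <= k x)%E} ->
  (\int[mu]_x k x < +oo)%E -> mu.-integrable setT k.
Proof.
move=> mk Ib bk kfin.
have kn : (\int[mu]_x k^\- x < +oo)%E.
  have /integrableP[mb nb] := Ib; apply: le_lt_trans nb.
  apply: ae_ge0_le_integral => //.
  - exact: measurable_funeneg.
  - exact: measurableT_comp.
  - apply: filterS bk => x bkx _; rewrite funenegE ge_max abse_ge0 andbT /=.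
    rewrite leeNl; apply: le_trans bkx; rewrite -EFinN lee_fin lerN2.
    exact: ler_norm.
have knfin : (\int[mu]_x k^\- x)%E \is a fin_num.
  by rewrite ge0_fin_numE//; apply: integral_ge0.
have kp : (\int[mu]_x k^\+ x < +oo)%E.
  move: kfin; rewrite integralE; rewrite lteBlDr//.
  by move=> /lt_le_trans; apply; rewrite leey.
apply/integrableP; split => //.
rewrite (_ : integral _ _ _ = (\int[mu]_x (k^\+ x + k^\- x))%E); last first.
  by apply: eq_integral => x _; rewrite -[LHS]/((abse \o k) x) fune_abse.
rewrite ge0_integralD//; last 2 first.
  exact: measurable_funepos.
  exact: measurable_funeneg.
by rewrite lte_add_pinfty.
Qed.

Lemma integrable_ae_eq d (T : measurableType d) (R : realType)
    (mu : {measure set T -> \bar R}) (k k' : T -> \bar R) :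
  mu.-integrable setT k -> measurable_fun setT k' -> {ae mu, forall x, k x = k' x} ->
  mu.-integrable setT k'.
Proof.
move=> /integrableP[mk Ik] mk' kk'; apply/integrableP; split => //.
rewrite (_ : integral _ _ _ = (\int[mu]_x `|k x|)%E)//.
apply: ae_eq_integral => //; [exact: measurableT_comp|exact: measurableT_comp|].
by apply: filterS kk' => x -> _.
Qed.

Lemma mul_ln_ge (R : realType) (x : R) : 0 <= x -> - 1 <= x * ln x.
Proof.
rewrite le_eqVlt => /predU1P[<-|x0]; first by rewrite mul0r lerN10.
have := le_ln1Dx (x := x^-1 - 1); rewrite addrCA subrr addr0.
rewrite lnV ?posrE// => /(_ _) h.
have {}h : - ln x <= x^-1 - 1 by apply: h; rewrite ltrBDl subrr invr_gt0.
have : x * (- ln x) <= x * (x^-1 - 1) by rewrite ler_wpM2l// ltW.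
by rewrite mulrBr mulfV ?gt_eqF//; lra.
Qed.

Lemma ln_le_norm (R : realType) (x : R) : ln x <= `|x|.
Proof.
have [x0|x0] := leP x 0; first by rewrite ln0.
by apply: ltW; apply: lt_le_trans (ln_sublinear x0) _; exact: ler_norm.
Qed.

Section energy.
Context {R : realType} (eta : R).
Implicit Types (p : S2 R) (A B M Q : 'M[R]_3) (f g phi : S2 R -> R).

Definition Qof g : 'M[R]_3 := mom g - (1 / 3)%:M.

Definition field Q p : R := quadf Q p - eta.

(* Agrees with the integrand of [energy] only where g = 0 or the field is
   positive, because ln is 0, not -oo, on the nonpositive numbers. *)
Definition density_energy g Q p : R := g p * ln (g p) - g p * ln (field Q p).

Lemma dotpC (v w : 'rV[R]_3) : dotp v w = dotp w v.
Proof. by rewrite !dotpE; apply: eq_bigr => i _; rewrite mulrC. Qed.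

Lemma quadf_rank1 (v : 'rV[R]_3) p : quadf (v^T *m v) p = dotp v (pt p) ^+ 2.
Proof.
rewrite /quadf mulmxA /dotp -mulmxA mxE big_ord1 expr2; congr (_ * _).
exact: (dotpC (pt p) v).
Qed.

(** The kernel (p.q)^2 - 1/3 is, in q, the quadratic form of p (x) p - I/3, so integrating it
    against g only sees the moment of g. *)
Lemma fieldE g p : L1 (dp R) g -> \int[dp R]_q g q = 1 ->
  \int[dp R]_q ((dotp (pt p) (pt q) ^+ 2 - 1 / 3) * g q) - eta = field (Qof g) p.
Proof.
move=> Ig g1; congr (_ - _).
transitivity (\int[dp R]_q (g q * quadf ((pt p)^T *m pt p - (1 / 3)%:M) q)).
  by apply: eq_Rintegral => q _; rewrite quadfB quadf_scalar quadf_rank1 mulrC.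
rewrite Rint_quadf// frobBl frobC -quadf_frob [X in _ - X]frobC frob_scalar.
by rewrite mxtrace_mom// g1 quadfB quadf_scalar mulr1.
Qed.

Lemma mx_integral_tensor0 g : L1 (dp R) g ->
  mx_integral (fun p => g p *: tensor0 p) = mom g - (1 / 3 * \int[dp R]_p g p)%:M.
Proof.
move=> Ig; apply/matrixP => i j; rewrite !mxE.
have IC : L1 (dp R) (fun p => ((1 / 3) *+ (i == j)) * g p) by exact: L1Z.
transitivity (\int[dp R]_p (g p * (pt p 0 i * pt p 0 j) - ((1 / 3) *+ (i == j)) * g p)).
  apply: eq_Rintegral => p _; rewrite !mxE big_ord1 !mxE mulrBr; congr (_ - _).
  by rewrite mulrC.
by rewrite RintB//; [rewrite RintZ// mulrnAl|exact: L1_coord2].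
Qed.

Lemma measurable_field Q : measurable_fun setT (field Q).
Proof.
apply: measurable_funB; [exact: (measurable_quadf Q)|exact: measurable_cst].
Qed.

Lemma field_le Q p : `|field Q p| <= l1norm Q + `|eta|.
Proof. by apply: le_trans (ler_normB _ _) _; rewrite lerD2r; exact: quadf_le. Qed.

Lemma measurable_density_energy g Q : measurable_fun setT g ->
  measurable_fun setT (density_energy g Q).
Proof.
move=> mg; apply: measurable_funB; apply: measurable_funM; try exact: mg.
  by apply: measurableT_comp mg; exact: measurable_ln.
by apply: measurableT_comp (measurable_field Q); exact: measurable_ln.
Qed.

(** The integrand of [energy] itself; it is infinite exactly where g is nonzero and the field is not
    positive. *)
Definition ext_density_energy g Q p : \bar R :=
  ((g p * ln (g p))%:E - (g p)%:E * lne (field Q p)%:E)%E.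

Lemma energyE g : L1 (dp R) g -> \int[dp R]_q g q = 1 ->
  energy eta g = (\int[dp R]_p ext_density_energy g (Qof g) p)%E.
Proof.
move=> Ig g1; apply: eq_integral => p _; rewrite /ext_density_energy.
by rewrite fieldE.
Qed.

Lemma measurable_ext_density_energy g Q : measurable_fun setT g ->
  measurable_fun setT (ext_density_energy g Q).
Proof.
move=> mg; apply: emeasurable_funB.
  apply/measurable_EFinP; apply: measurable_funM; first exact: mg.
  by apply: measurableT_comp mg; exact: measurable_ln.
apply: emeasurable_funM; first by apply/measurable_EFinP; exact: mg.
have -> : (fun p => lne (field Q p)%:E) =
    (fun p => if field Q p <= 0 then -oo%E else (ln (field Q p))%:E) by [].
apply: measurable_fun_ifT.
- by apply: measurable_fun_ler; [exact: measurable_field|exact: measurable_cst].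
- exact: measurable_cst.
apply/measurable_EFinP; apply: measurableT_comp (measurable_field Q); exact: measurable_ln.
Qed.

Lemma density_energy_ge g Q p : 0 <= g p ->
  - (1 + g p * (l1norm Q + `|eta|)) <= density_energy g Q p.
Proof.
move=> g0; rewrite /density_energy opprD lerB// ?mul_ln_ge//.
by rewrite ler_wpM2l// (le_trans (ln_le_norm _))// field_le.
Qed.

Lemma ext_density_energy_pos g Q p : (g p != 0 -> 0 < field Q p) ->
  ext_density_energy g Q p = (density_energy g Q p)%:E.
Proof.
rewrite /ext_density_energy /density_energy.
have [->|g0] := eqVneq (g p) 0; first by rewrite !mul0r mul0e sube0 subr0.
by move=> /(_ isT) w0; rewrite lne_EFin.
Qed.

Lemma ext_density_energy_ge g Q p : 0 <= g p ->
  ((- (1 + g p * (l1norm Q + `|eta|)))%:E <= ext_density_energy g Q p)%E.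
Proof.
move=> g0; have [w0|w0] := ltP 0 (field Q p).
  by rewrite ext_density_energy_pos// lee_fin; exact: density_energy_ge.
move: g0; rewrite le_eqVlt => /predU1P[g0|g0].
  rewrite ext_density_energy_pos; last by rewrite -g0 eqxx.
  by rewrite lee_fin /density_energy -g0 !mul0r !addr0 subr0 lerN10.
rewrite /ext_density_energy le0_lneNy ?lee_fin// gt0_muleNy ?lte_fin//.
by rewrite /= leey.
Qed.

Lemma L1_lower_bound g Q : L1 (dp R) g ->
  L1 (dp R) (fun p => 1 + g p * (l1norm Q + `|eta|)).
Proof.
move=> Ig; apply: L1D.
  by apply: (@L1_bounded _ _ _ _ _ 1); [exact: dp_fin|exact: measurable_cst|
    move=> p; rewrite normr1].
have := L1Z (l1norm Q + `|eta|) Ig.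
by apply: eq_integrable => // p _; rewrite /= mulrC.
Qed.

(** The integrand is bounded below by an integrable function because x ln x >= -1 and the field is
    bounded above. Finite energy thus makes it integrable, hence finite almost everywhere, which
    excludes g > 0 where the field is not positive. *)
Lemma energy_finite g : L1 (dp R) g -> {ae dp R, forall p, 0 <= g p} ->
  \int[dp R]_q g q = 1 -> (energy eta g < +oo)%E ->
  {ae dp R, forall p, g p != 0 -> 0 < field (Qof g) p} /\
  L1 (dp R) (density_energy g (Qof g)).
Proof.
move=> Ig g0 g1; rewrite energyE// => Efin.
have mg := L1_measurable Ig.
have I : (dp R).-integrable setT (ext_density_energy g (Qof g)).
  apply: (integrable_of_lower_bound _ (L1_lower_bound (Qof g) Ig) _ Efin).
    exact: measurable_ext_density_energy.
  by apply: filterS g0 => p; exact: ext_density_energy_ge.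
have pos : {ae dp R, forall p, g p != 0 -> 0 < field (Qof g) p}.
  have := integrable_ae measurableT I.
  apply: filterS2 g0 => p gp /(_ Logic.I) fin gn0; rewrite ltNge; apply/negP => w0.
  have gp0 : 0 < g p by rewrite lt_def gn0.
  by move: fin; rewrite /ext_density_energy le0_lneNy ?lee_fin// gt0_muleNy ?lte_fin.
split => //.
apply: (integrable_ae_eq I).
  by apply/measurable_EFinP; exact: measurable_density_energy.
by apply: filterS pos => p h; rewrite ext_density_energy_pos.
Qed.

Lemma energy_Rint g : L1 (dp R) g -> \int[dp R]_q g q = 1 ->
  {ae dp R, forall p, g p != 0 -> 0 < field (Qof g) p} ->
  energy eta g = (\int[dp R]_p (density_energy g (Qof g) p)%:E)%E.
Proof.
move=> Ig g1 pos; have mg := L1_measurable Ig; rewrite energyE//.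
apply: ae_eq_integral; first exact: measurableT.
- exact: measurable_ext_density_energy.
- by apply/measurable_EFinP; exact: measurable_density_energy.
- by apply: filterS pos => p h _ /=; rewrite ext_density_energy_pos.
Qed.

End energy.

(** * Admissible variations *)

(** For finite r the norm is at most c V^(1/r), with V the total mass, and V^(1/r) <= 1 + V because
    1/r <= 1. The constant therefore serves every r, infinity included. *)
Lemma Lnorm_bounded d (T : measurableType d) (R : realType)
    (mu : {measure set T -> \bar R}) (r : \bar R) (phi : T -> R) (c : R) :
  (1 <= r)%E -> (mu setT < +oo)%E -> measurable_fun setT phi -> 0 <= c ->
  (forall x, `|phi x| <= c) ->
  (Lnorm mu r (EFin \o phi) <= (c * (1 + fine (mu setT)))%:E)%E.
Proof.
move=> r1 muT mphi c0 phic.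
have m0 : 0 <= fine (mu setT) by apply: fine_ge0.
have muE : mu setT = (fine (mu setT))%:E by rewrite fineK// ge0_fin_numE.
rewrite unlock; case: r r1 => [r|_|//].
  rewrite lee_fin => r1; have r0 : 0 < r by apply: lt_le_trans r1.
  have step : (\int[mu]_x `|(EFin \o phi) x| `^ r <= (c `^ r)%:E * mu setT)%E.
    rewrite -(integral_cst mu measurableT); apply: ge0_le_integral; [by []| |idtac|by []|].
    - by move=> x _; exact: poweR_ge0.
    - apply: (measurableT_comp (measurable_poweR r)); apply: measurableT_comp => //.
      exact/measurable_EFinP.
    - move=> x _; rewrite /= lee_fin; apply: ge0_ler_powR; rewrite ?nnegrE//.
      exact: ltW.
  apply: (@le_trans _ _ (((c `^ r)%:E * mu setT) `^ r^-1)%E).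
    apply: gt0_ler_poweR; rewrite ?in_itv/= ?leey ?andbT//.
    - by rewrite invr_ge0 ltW.
    - by apply: integral_ge0 => x _; rewrite lee_fin powR_ge0.
    - by rewrite mule_ge0// lee_fin powR_ge0.
  rewrite muE -EFinM poweR_EFin powRM ?powR_ge0// -powRrM mulfV ?gt_eqF// powRr1//.
  rewrite lee_fin ler_wpM2l//.
  apply: (@le_trans _ _ ((1 + fine (mu setT)) `^ r^-1)).
    by apply: ge0_ler_powR; rewrite ?nnegrE ?invr_ge0 ?addr_ge0 ?lerDr// ltW.
  rewrite -[leRHS]powRr1 ?addr_ge0//; apply: ler_powR; first by rewrite lerDl.
  by rewrite invf_le1.
case: ifPn => _; last by rewrite lee_fin mulr_ge0// addr_ge0.
apply/ess_sup_inf.ess_supP; apply: aeW => x /=.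
by rewrite lee_fin; apply: le_trans (phic x) _; rewrite ler_peMr// lerDl.
Qed.

Section variation.
Context {R : realType} (eta : R) (r : \bar R) (f : S2 R -> R).
Hypotheses (r1 : (1 <= r)%E) (minf : Lr_local_minimiser eta r f).

Lemma minimiser_L1 : L1 (dp R) f.
Proof. by case: minf => -[[]]. Qed.

Lemma minimiser_ge0 : {ae dp R, forall p, 0 <= f p}.
Proof. by case: minf => -[[]]. Qed.

Lemma minimiser_mass : \int[dp R]_p f p = 1.
Proof. by case: minf => -[[]]. Qed.

Lemma minimiser_measurable : measurable_fun setT f.
Proof. exact: L1_measurable minimiser_L1. Qed.

Lemma minimiser_not_null : ~ {ae dp R, forall p, f p = 0}.
Proof.
move=> f0; have : \int[dp R]_p f p = 0 * fine (dp R setT).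
  rewrite -(Rintegral_cst (dp R) measurableT).
  by apply: Rint_ae_eq; [exact: minimiser_measurable|exact: measurable_cst|exact: f0].
by rewrite mul0r minimiser_mass => /eqP; rewrite oner_eq0.
Qed.

Local Notation Q := (Qof f).
Local Notation w := (field eta Q).
Local Notation e := (density_energy eta f Q).

Lemma minimiser_field : {ae dp R, forall p, f p != 0 -> 0 < w p}.
Proof.
have [_ Efin _] := minf.
by have [] := energy_finite minimiser_L1 minimiser_ge0 minimiser_mass Efin.
Qed.

Lemma minimiser_energy_L1 : L1 (dp R) e.
Proof.
have [_ Efin _] := minf.
by have [] := energy_finite minimiser_L1 minimiser_ge0 minimiser_mass Efin.
Qed.

(** The form in which minimality is used everywhere below. Only a pointwise upper bound [beta] for
    the increment of the energy density is requested; the finiteness of the new energy is derived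
    from it. *)
Lemma variation_inequality : exists2 eps : R, 0 < eps & forall phi beta : S2 R -> R,
  measurable_fun setT phi -> (forall p, `|phi p| <= eps) ->
  \int[dp R]_p phi p = 0 -> {ae dp R, forall p, 0 <= f p + phi p} ->
  {ae dp R, forall p, f p + phi p != 0 -> 0 < field eta (Q + mom phi) p} ->
  L1 (dp R) beta ->
  {ae dp R, forall p, density_energy eta (fun p => f p + phi p) (Q + mom phi) p <=
     e p + beta p} ->
  0 <= \int[dp R]_p beta p.
Proof.
have [[_ Lf] _ [eps eps0 minE]] := minf.
have If := minimiser_L1; have Ie := minimiser_energy_L1; have mf := minimiser_measurable.
have m0 : 0 <= fine (dp R setT) by apply: fine_ge0; exact: measure_ge0.
(* A sup norm of at most c gives an L^r norm of at most [eps / 2]. *)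
pose c := eps / (2 * (1 + fine (dp R setT))).
have c0 : 0 < c by rewrite divr_gt0// mulr_gt0// ltr_pwDl.
exists c => // phi beta mphi phic phi0 fphi0 fpos Ib le_e.
have Iphi : L1 (dp R) phi by exact: (L1_bounded dp_fin mphi phic).
have Ig : L1 (dp R) (fun p => f p + phi p) by exact: L1D.
have g1 : \int[dp R]_p (f p + phi p) = 1.
  by rewrite RintD// minimiser_mass phi0 addr0.
have QE : Qof (fun p => f p + phi p) = Q + mom phi.
  by rewrite /Qof momD// addrAC.
have normphi : (Lr_norm r phi < eps%:E)%E.
  apply: le_lt_trans (Lnorm_bounded r1 dp_fin mphi (ltW c0) phic) _.
  rewrite lte_fin; have bd (m : R) : 0 <= m -> eps / (2 * (1 + m)) * (1 + m) < eps.
    move=> m_ge0; rewrite mulrAC ltr_pdivrMr ?mulr_gt0 ?ltr_pwDl//; nra.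
  exact: (bd _ m0).
have Lphi : phi \in Lfun (dp R) r.
  rewrite inE; apply/andP; split; first by rewrite inE.
  rewrite inE /= /finite_norm; apply: lt_trans normphi _; exact: ltry.
have Lg : (fun p => f p + phi p) \in Lfun (dp R) r.
  have [_ /(_ f phi Lf Lphi)] := Lfun_addr_closed (dp R) r1; exact.
have Ele := minE (fun p => f p + phi p).
have {Ele} : (energy eta f <= energy eta (fun p => (f p + phi p)%R))%E.
  apply: Ele; first by split => //; split.
  rewrite (_ : (fun p => f p + phi p) \- f = phi)%R//.
  by apply/funext => p /=; rewrite addrAC subrr add0r.
rewrite (energy_Rint If minimiser_mass minimiser_field).
rewrite energy_Rint ?QE//.
set g := fun p => f p + phi p => Ele.
(* The new density energy lies between its general lower bound and [e + beta], both integrable. *)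
have Ieg : L1 (dp R) (density_energy eta g (Q + mom phi)).
  have Ibd : L1 (dp R) (fun p => `|e p + beta p| + (1 + g p * (l1norm (Q + mom phi) + `|eta|))).
    apply: L1D; last exact: L1_lower_bound.
    by apply: integrable_norm; exact: L1D.
  apply: (L1_ae_le _ Ibd).
    by apply: measurable_density_energy; exact: L1_measurable Ig.
  apply: filterS2 fphi0 le_e => p gp0 ep.
  have lb := density_energy_ge eta (g := g) (Q + mom phi) gp0.
  have b0 : 0 <= 1 + g p * (l1norm (Q + mom phi) + `|eta|).
    by rewrite addr_ge0// mulr_ge0// addr_ge0// l1norm_ge0.
  have nb := ler_norm (e p + beta p); have nb0 := normr_ge0 (e p + beta p).
  move: (density_energy _ g _ p) lb ep => x lb ep.
  move: (e p + beta p) nb nb0 ep => y nb nb0 ep.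
  by rewrite ler_norml; apply/andP; split; clear -lb ep nb nb0 b0; lra.
have : \int[dp R]_p e p <= \int[dp R]_p (density_energy eta g (Q + mom phi) p).
  by rewrite /Rintegral fine_le// integrable_fin_num.
have : \int[dp R]_p (density_energy eta g (Q + mom phi) p) <= \int[dp R]_p (e p + beta p).
  by apply: Rint_ae_le => //; exact: L1D.
by rewrite (RintD Ie Ib) => h1 h2; have := le_trans h2 h1; rewrite lerDl.
Qed.

End variation.

(** * The Euler-Lagrange equation where f is positive *)

Lemma measure0_ae d (T : measurableType d) (R : realType)
    (mu : {measure set T -> \bar R}) (S : set T) :
  measurable S -> mu S = 0%E -> {ae mu, forall x, ~ S x}.
Proof. by move=> mS S0; exists S; split => // x /= /contrapT. Qed.

(** Concavity gives ln (x + y) <= ln x + y / x, and multiplication by x + y produces the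
    second-order bound. It persists at x + y = 0, so a density may be lowered to 0. *)
Lemma mul_ln_add_le (R : realType) (x y : R) : 0 < x -> 0 <= x + y ->
  (x + y) * ln (x + y) <= x * ln x + y * (ln x + 1) + y ^+ 2 / x.
Proof.
move=> x0; rewrite le_eqVlt => /predU1P[xy0|xy0].
  rewrite -xy0 mul0r; have -> : y = - x by lra.
  by rewrite sqrrN expr2 -mulrA mulfV ?gt_eqF// mulr1; lra.
have E : x + y = x * (1 + y / x) by rewrite mulrDr mulr1 mulrCA mulfV ?gt_eqF// mulr1.
have yx : 0 < 1 + y / x by rewrite -(pmulr_rgt0 _ x0) -E.
have lnE : ln (x + y) <= ln x + y / x.
  by rewrite E lnM ?posrE// lerD2l le_ln1Dx// -subr_gt0 opprK addrC.
apply: le_trans (ler_wpM2l (ltW xy0) lnE) _.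
have -> : y ^+ 2 / x = y * (y / x) by rewrite expr2 mulrA.
have : x * (y / x) = y by rewrite mulrCA mulfV ?gt_eqF// mulr1.
by move: (y / x) => z zE; clear -zE; nra.
Qed.

Lemma norm_ln_le (R : realType) (x : R) : 0 < x -> `|ln x| <= x + x^-1.
Proof.
move=> x0; have xV : 0 < x^-1 by rewrite invr_gt0.
have h1 := ln_sublinear x0; have h2 := ln_sublinear xV.
rewrite lnV ?posrE// in h2; rewrite ler_norml; apply/andP; split; lra.
Qed.

Lemma linear_coef_eq0 (R : realType) (a b t0 : R) : 0 < t0 ->
  (forall t, `|t| <= t0 -> 0 <= t * a + t ^+ 2 * b) -> a = 0.
Proof.
move=> t00 h; apply: contrapT => /eqP a0.
pose t := Num.min t0 (`|a| / (2 * (`|b| + 1))).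
have b1 : 0 < `|b| + 1 by rewrite ltr_wpDl.
have ap : 0 < `|a| by rewrite normr_gt0.
have tp : 0 < t by rewrite lt_min t00 divr_gt0// mulr_gt0.
have tt0 : t <= t0 by rewrite ge_min lexx.
have tb : t * (2 * (`|b| + 1)) <= `|a|.
  by rewrite -ler_pdivlMr ?mulr_gt0// ge_min lexx orbT.
have nt s : `|s| = 1 -> `|s * t| <= t0 by move=> s1; rewrite normrM s1 mul1r gtr0_norm.
have bb := ler_norm b; have := h (t * - Num.sg a).
have sg1 : `|- Num.sg a| = 1 by rewrite normrN normr_sg a0.
rewrite [X in `|X|]mulrC nt// => /(_ isT).
have -> : t * - Num.sg a * a = - (t * `|a|) by rewrite normrEsg; lra.
rewrite exprMn sqrrN sqr_sg a0 mulr1.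
clear -bb b1 ap tp tb; nra.
Qed.

Section euler_lagrange.
Context {R : realType} (eta : R) (r : \bar R) (f : S2 R -> R).
Hypotheses (r1 : (1 <= r)%E) (minf : Lr_local_minimiser eta r f).

Local Notation Q := (Qof f).
Local Notation w := (field eta Q).
Local Notation e := (density_energy eta f Q).
Local Notation mu := (dp R).
Let u (p : S2 R) := ln (f p) - ln (w p).

Let If : L1 mu f := minimiser_L1 minf.
Let mf : measurable_fun setT f := minimiser_measurable minf.
Let mw : measurable_fun setT w := measurable_field eta Q.

(** On this set there is room for perturbations of f of both signs and size 1 / (n + 1), and ln f -
    ln w is bounded; w has a global upper bound already. *)
Definition interior_set (n : nat) : set (S2 R) :=
  [set p | n.+1%:R^-1 <= f p] `&` [set p | f p <= n.+1%:R] `&` [set p | n.+1%:R^-1 <= w p].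

Lemma measurable_level (g : S2 R -> R) c : measurable_fun setT g ->
  measurable [set p | c <= g p] /\ measurable [set p | g p <= c].
Proof.
move=> mg; split.
  rewrite (_ : [set p | _] = setT `&` (fun p => c <= g p) @^-1` [set true]); last first.
    by apply/seteqP; split => p //= [].
  exact: (measurable_fun_ler (measurable_cst c) mg).
rewrite (_ : [set p | _] = setT `&` (fun p => g p <= c) @^-1` [set true]); last first.
  by apply/seteqP; split => p //= [].
exact: (measurable_fun_ler mg (measurable_cst c)).
Qed.

Lemma measurable_interior_set n : measurable (interior_set n).
Proof.
apply: measurableI; first apply: measurableI.
- by have [] := measurable_level n.+1%:R^-1 mf.
- by have [] := measurable_level n.+1%:R mf.
- by have [] := measurable_level n.+1%:R^-1 mw.
Qed.

Lemma interior_set_mono m n : (m <= n)%N -> interior_set m `<=` interior_set n.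
Proof.
move=> mn p [[/= h1 h2] h3].
have le1 : n.+1%:R^-1 <= m.+1%:R^-1 :> R by rewrite lef_pV2 ?posrE// ler_nat.
have le2 : m.+1%:R <= n.+1%:R :> R by rewrite ler_nat.
by split; [split|] => /=; [exact: le_trans h1|exact: le_trans le2|exact: le_trans h3].
Qed.

Lemma mem_interior_set p : 0 < f p -> 0 < w p -> exists n, interior_set n p.
Proof.
move=> fp wp; pose n := Num.truncn ((f p)^-1 + f p + (w p)^-1).
have n1 : (f p)^-1 + f p + (w p)^-1 < n.+1%:R.
  have /truncn_itv/andP[] // : 0 <= (f p)^-1 + f p + (w p)^-1.
  by rewrite !addr_ge0 ?invr_ge0// ltW.
have fV : 0 < (f p)^-1 by rewrite invr_gt0.
have wV : 0 < (w p)^-1 by rewrite invr_gt0.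
exists n; split; [split|] => /=; last 1 first.
- rewrite -[leRHS]invrK lef_pV2 ?posrE//; move: fV wV n1; lra.
- rewrite -[leRHS]invrK lef_pV2 ?posrE//; move: fV wV n1; lra.
- move: fV wV n1; lra.
Qed.

Lemma interior_set_gt0 n p : interior_set n p -> 0 < f p /\ 0 < w p.
Proof.
move=> [[h1 _] h3]; split; [apply: lt_le_trans h1|apply: lt_le_trans h3];
by rewrite invr_gt0.
Qed.

Lemma interior_set_charged : exists n, mu (interior_set n) != 0%E.
Proof.
apply: contrapT => /forallNP h.
have noS n : {ae mu, forall p, ~ interior_set n p}.
  by apply: (measure0_ae (measurable_interior_set n)); apply/eqP/negPn/negP; exact: h.
apply: (minimiser_not_null minf).
apply: filterS3 (ae_foralln noS) (minimiser_ge0 minf) (minimiser_field minf).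
move=> p noSp f0 fw; apply: contrapT => /eqP fn0.
have fp : 0 < f p by rewrite lt_def fn0.
by have [n Sn] := mem_interior_set fp (fw fn0); exact: (noSp n).
Qed.

(** From |ln x| <= x + 1/x: ln f contributes twice n + 1, ln w contributes n + 1 and the global
    bound of the field. *)
Lemma interior_log_bound n p : interior_set n p ->
  `|u p| <= 3 * n.+1%:R + (l1norm Q + `|eta|).
Proof.
move=> Sp; have [fp wp] := interior_set_gt0 Sp; case: Sp => -[/= h1 h2] h3.
apply: le_trans (ler_normB _ _) _.
have hf := norm_ln_le fp; have hw := norm_ln_le wp.
have hW := le_trans (ler_norm _) (field_le eta Q p).
have fV : (f p)^-1 <= n.+1%:R by rewrite -[leRHS]invrK lef_pV2 ?posrE// invr_gt0.
have wV : (w p)^-1 <= n.+1%:R by rewrite -[leRHS]invrK lef_pV2 ?posrE// invr_gt0.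
by move: hf hw hW fV wV h2; lra.
Qed.

Let mu_u : measurable_fun setT u.
Proof.
apply: measurable_funB; first by apply: measurableT_comp mf; exact: measurable_ln.
by apply: measurableT_comp mw; exact: measurable_ln.
Qed.

Lemma interior_cut_bound n p :
  `|\1_(interior_set n) p * u p| <= 3 * n.+1%:R + (l1norm Q + `|eta|).
Proof.
rewrite indicE; have [/set_mem Sp|_] := boolP (p \in interior_set n).
  by rewrite mul1r; exact: interior_log_bound.
by rewrite mul0r normr0 !addr_ge0 ?mulr_ge0 ?l1norm_ge0.
Qed.

Lemma measurable_cut n (g : S2 R -> R) : measurable_fun setT g ->
  measurable_fun setT (fun p => \1_(interior_set n) p * g p).
Proof.
move=> mg; apply: measurable_funM mg; apply: measurable_indic_S2.
exact: measurable_interior_set.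
Qed.

(** With w fixed, [1 + u p] is the derivative of x ln x - x ln w at x = f; the remainder y^2 / f is
    controlled by the lower bound of f. *)
Lemma density_energy_variation n p y : interior_set n p -> `|y| <= n.+1%:R^-1 ->
  (f p + y) * ln (f p + y) - (f p + y) * ln (w p) <=
  e p + (y * (1 + u p) + n.+1%:R * y ^+ 2).
Proof.
move=> Sp yn; have [fp wp] := interior_set_gt0 Sp.
case: Sp => -[/= h1 h2] h3.
have fy : 0 <= f p + y.
  by move: yn; rewrite ler_norml => /andP[yn _]; move: (n.+1%:R^-1) h1 yn => z h1 yn; lra.
have fV : (f p)^-1 <= n.+1%:R by rewrite -[leRHS]invrK lef_pV2 ?posrE// invr_gt0.
have y2 : y ^+ 2 / f p <= n.+1%:R * y ^+ 2.
  by rewrite mulrC ler_wpM2r// sqr_ge0.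
have := mul_ln_add_le fp fy; rewrite /density_energy /u.
by move: y2; lra.
Qed.

(** The moment condition preserves mass and field, so f + t psi on the set is admissible for small t
    of either sign. The term 1 of the derivative [1 + u] integrates to 0 because the trace of the
    moment is the mass. *)
Lemma interior_stationary n (psi : S2 R -> R) K :
  measurable_fun setT psi -> (forall p, `|psi p| <= K) ->
  mom (fun p => \1_(interior_set n) p * psi p) = 0 ->
  \int[mu]_p (\1_(interior_set n) p * psi p * u p) = 0.
Proof.
move=> mpsi psiK mom0; set S := interior_set n.
have [eps eps0 EL] := variation_inequality r1 minf.
have K0 : 0 <= K by exact: le_trans (psiK point).
have psi1 p : `|\1_S p * psi p| <= K.
  by rewrite normrM (le_trans _ (psiK p))// ler_piMl// indic_le1.
have m1 : measurable_fun setT (fun p => \1_S p * psi p) by exact: measurable_cut.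
have I1 : L1 mu (fun p => \1_S p * psi p) by exact: (L1_bounded dp_fin m1 psi1).
have I0 : \int[mu]_p (\1_S p * psi p) = 0 by rewrite -mxtrace_mom// mom0 mxtrace0.
have Iu : L1 mu (fun p => \1_S p * psi p * u p).
  have -> : (fun p => \1_S p * psi p * u p) = (fun p => psi p * (\1_S p * u p)).
    by apply/funext => p; rewrite mulrA [psi p * _]mulrC.
  apply: (@L1_bounded _ _ _ _ _ (K * (3 * n.+1%:R + (l1norm Q + `|eta|)))).
  - exact: dp_fin.
  - by apply: measurable_funM mpsi _; exact: measurable_cut.
  - by move=> p; rewrite normrM ler_pM// interior_cut_bound.
have I2 : L1 mu (fun p => \1_S p * psi p ^+ 2).
  apply: (@L1_bounded _ _ _ _ _ (K ^+ 2)).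
  - exact: dp_fin.
  - by apply: measurable_cut; exact: measurable_funX.
  - move=> p; rewrite normrM (@le_trans _ _ `|psi p ^+ 2|)//.
      by rewrite ler_piMl// indic_le1.
    by rewrite normrX ler_pXn2r ?nnegrE.
(* Then |t psi| is at most [eps], as minimality demands, and at most 1 / (n + 1), the lower bound of
   f on the set. *)
pose t0 := Num.min eps n.+1%:R^-1 / (K + 1).
have t00 : 0 < t0 by rewrite divr_gt0 ?lt_min ?eps0 ?invr_gt0 ?ltr0n ?ltr_wpDl.
apply: (@linear_coef_eq0 _ _ (n.+1%:R * \int[mu]_p (\1_S p * psi p ^+ 2)) t0) => // t tt0.
have tK p : `|t * (\1_S p * psi p)| <= Num.min eps n.+1%:R^-1.
  rewrite normrM (@le_trans _ _ (t0 * (K + 1)))//.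
    by apply: ler_pM => //; rewrite (le_trans (psi1 p))// lerDl.
  by rewrite /t0 mulfVK// gt_eqF// ltr_wpDl.
pose beta p := t * (\1_S p * psi p) + (t * (\1_S p * psi p * u p) +
  t ^+ 2 * n.+1%:R * (\1_S p * psi p ^+ 2)).
have Ib2 : L1 mu (fun p => t * (\1_S p * psi p * u p) +
    t ^+ 2 * n.+1%:R * (\1_S p * psi p ^+ 2)).
  by apply: L1D; exact: L1Z.
have Ib : L1 mu beta by apply: L1D => //; exact: L1Z.
have : 0 <= \int[mu]_p beta p.
  have mom_t : mom (fun p => t * (\1_S p * psi p)) = 0 by rewrite momZ// mom0 scaler0.
  apply: (EL (fun p => t * (\1_S p * psi p)) beta).
  - by apply: measurable_funM m1; exact: measurable_cst.
  - by move=> p; rewrite (le_trans (tK p))// ge_min lexx.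
  - by rewrite RintZ// I0 mulr0.
  - apply: filterS (minimiser_ge0 minf) => p f0.
    rewrite indicE; have [/set_mem Sp|_] := boolP (p \in S); last first.
      by rewrite mul0r mulr0 addr0.
    have := tK p; rewrite indicE mem_set// le_min => /andP[_].
    rewrite ler_norml => /andP[+ _]; case: Sp => -[/= h1 _] _.
    by move: (n.+1%:R^-1) h1 => z h1 yn; lra.
  - apply: filterS (minimiser_field minf) => p fw; rewrite mom_t addr0.
    rewrite indicE; have [/set_mem Sp|_] := boolP (p \in S); last first.
      by rewrite mul0r mulr0 addr0.
    by move=> _; have [] := interior_set_gt0 Sp.
  - exact: Ib.
  - apply: aeW => p; rewrite mom_t addr0 /density_energy /beta.
    have [Sp|nSp] := boolP (p \in S); last first.
      by rewrite indicE (negbTE nSp) !mul0r !mulr0 !addr0.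
    have := tK p; rewrite le_min => /andP[_] tn.
    move: Sp => /set_mem Sp; have := density_energy_variation Sp tn.
    by rewrite indicE mem_set// !mul1r /density_energy; lra.
rewrite RintD//; last exact: L1Z.
rewrite RintZ// I0 mulr0 add0r RintD//; [|exact: L1Z|exact: L1Z].
by rewrite !RintZ// mulrA.
Qed.

(* Test stationarity with the part of u orthogonal to the quadratic forms. *)
Lemma interior_euler_lagrange n : mu (interior_set n) != 0%E ->
  exists B, B^T = B /\ {ae mu, forall p, interior_set n p -> u p = quadf B p}.
Proof.
move=> S0; set S := interior_set n in S0 *.
have mS : measurable S := measurable_interior_set n.
have mSu : measurable_fun setT (fun p => \1_S p * u p) by exact: measurable_cut.
have ISu : L1 mu (fun p => \1_S p * u p).
  exact: (L1_bounded dp_fin mSu (interior_cut_bound n)).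
have [C C0 solve] := gram_solve mS S0.
have [B [symB momBE _]] := solve _ (mom_sym (fun p => \1_S p * u p)).
exists B; split => //.
pose psi p := \1_S p * u p - quadf B p.
have Spsi p : \1_S p * psi p = \1_S p * u p - \1_S p * quadf B p.
  by rewrite /psi mulrBr mulrA -expr2 indicE; case: (_ \in _); rewrite ?expr1n ?expr0n.
have mom0 : mom (fun p => \1_S p * psi p) = 0.
  have -> : (fun p => \1_S p * psi p) = (fun p => \1_S p * u p - \1_S p * quadf B p).
    by apply/funext.
  by rewrite momB//; [rewrite momBE subrr|exact: L1_cut].
have mpsi : measurable_fun setT psi.
  by apply: measurable_funB mSu _; exact: measurable_quadf.
have psiK p : `|psi p| <= (3 * n.+1%:R + (l1norm Q + `|eta|)) + l1norm B.
  by apply: le_trans (ler_normB _ _) _; rewrite lerD ?quadf_le// interior_cut_bound.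
have stat := interior_stationary mpsi psiK mom0; rewrite -/S in stat.
have m1 : measurable_fun setT (fun p => \1_S p * psi p) by exact: measurable_cut.
have I1 : L1 mu (fun p => \1_S p * psi p).
  have -> : (fun p => \1_S p * psi p) = (fun p => \1_S p * u p - \1_S p * quadf B p).
    by apply/funext.
  by apply: L1B => //; exact: L1_cut.
have Iq := L1_quadf B I1.
have sq p : \1_S p * psi p * u p - \1_S p * psi p * quadf B p = \1_S p * psi p ^+ 2.
  rewrite -mulrBr /psi indicE; case: (_ \in _); rewrite ?mul0r//.
  by rewrite !mul1r expr2.
have I2 : L1 mu (fun p => \1_S p * psi p ^+ 2).
  have := L1_mulr I1 mpsi psiK; apply: eq_integrable => // p _ /=.
  by rewrite expr2 mulrA.
have Iu : L1 mu (fun p => \1_S p * psi p * u p).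
  have := L1D I2 Iq; apply: eq_integrable => // p _ /=.
  by rewrite -sq subrK.
(* On the set psi = u - [quadf B]. The integral of psi u vanishes by stationarity, that of psi
   [quadf B] because the moment of psi is 0. *)
have i0 : \int[mu]_p (\1_S p * psi p ^+ 2) = 0.
  transitivity (\int[mu]_p (\1_S p * psi p * u p - \1_S p * psi p * quadf B p)).
    by apply: eq_Rintegral => p _; rewrite sq.
  rewrite RintB// stat Rint_quadf// mom0 sub0r -[0](scale0r 0) frobZr mul0r oppr0//.
have pos p : 0 <= \1_S p * psi p ^+ 2 by rewrite mulr_ge0// sqr_ge0.
apply: filterS (Rint_eq0_ae I2 (aeW _ pos) i0) => p + Sp.
rewrite /psi indicE mem_set// !mul1r => /eqP; rewrite sqrf_eq0 subr_eq0.
by move=> /eqP.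
Qed.

Lemma log_ratio_quadratic :
  exists B, B^T = B /\ {ae mu, forall p, f p != 0 -> u p = quadf B p}.
Proof.
have [n0 S0] := interior_set_charged.
have [B [symB uB]] := interior_euler_lagrange S0.
exists B; split => //.
have uBn n : {ae mu, forall p, interior_set (n0 + n) p -> u p = quadf B p}.
  have Sn : mu (interior_set (n0 + n)) != 0%E.
    rewrite -!measure_gt0 in S0 *; apply: lt_le_trans S0 _.
    apply: le_measure; rewrite ?inE; try exact: measurable_interior_set.
    by apply: interior_set_mono; rewrite leq_addr.
  have [B' [symB' uB']] := interior_euler_lagrange Sn.
  (* Both forms represent u on [interior_set n0], which is charged, so they coincide. *)
  suff -> : B = B' by [].
  apply/eqP; rewrite -subr_eq0; apply/eqP.
  apply: (quadf_eq0_on (measurable_interior_set n0) S0).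
    by rewrite linearB/= symB symB'.
  apply: filterS2 uB uB' => p h h' Sp; rewrite quadfB -h// -h' ?subrr//.
  by apply: interior_set_mono Sp; rewrite leq_addr.
apply: filterS3 (ae_foralln uBn) (minimiser_ge0 minf) (minimiser_field minf) => p h f0 fw fn0.
have fp : 0 < f p by rewrite lt_def fn0.
have [n Sn] := mem_interior_set fp (fw fn0).
by apply: (h n); apply: interior_set_mono Sn; rewrite leq_addl.
Qed.

End euler_lagrange.

(** * Absence of vacuum *)

Lemma log_coef_le0 (R : realType) (a b c t0 : R) : 0 < t0 ->
  (forall t, 0 < t -> t <= t0 -> 0 <= t * ln t * a + t * b + t ^+ 2 * c) -> a <= 0.
Proof.
move=> t00 h; rewrite leNgt; apply/negP => a0.
(* For t <= exp (-k) the term [ln t * a] is at most -(|b| + |c| + 1), so the expression divided by t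
   is at most -1. *)
pose k := (`|b| + `|c| + 1) / a.
pose t := Num.min t0 (Num.min 1 (expR (- k))).
have tp : 0 < t by rewrite !lt_min t00 ltr01 expR_gt0.
have tt0 : t <= t0 by rewrite ge_min lexx.
have t1 : t <= 1 by rewrite /t !ge_min lexx orbT.
have lnt : ln t * a <= - (`|b| + `|c| + 1).
  rewrite -ler_pdivlMr// mulNr -/k -(expRK (- k)) ler_ln ?posrE ?expR_gt0//.
  by rewrite /t !ge_min lexx !orbT.
have := h t tp tt0; have := ler_norm b; have := ler_norm c.
have := normr_ge0 c; move: (ln t) lnt => x; move: `|b| `|c| => b' c'.
move: (t) tp t1 => s tp t1 lnt c0 cc bb.
have sc : s * c <= c' by apply: le_trans (ler_wpM2l (ltW tp) cc) _; rewrite ler_piMl.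
have -> : s * x * a + s * b + s ^+ 2 * c = s * (x * a + b + s * c) by lra.
by rewrite pmulr_rge0//; lra.
Qed.

Section vacuum.
Context {R : realType} (eta : R) (r : \bar R) (f : S2 R -> R).
Hypotheses (r1 : (1 <= r)%E) (minf : Lr_local_minimiser eta r f).

Local Notation Q := (Qof f).
Local Notation w := (field eta Q).
Local Notation e := (density_energy eta f Q).
Local Notation mu := (dp R).
Local Notation u := (fun p => ln (f p) - ln (w p)).

Let If : L1 mu f := minimiser_L1 minf.
Let mf : measurable_fun setT f := minimiser_measurable minf.
Let mw : measurable_fun setT w := measurable_field eta Q.

Definition vacuum_set (m : nat) : set (S2 R) :=
  [set p | f p <= 0] `&` [set p | m.+1%:R^-1 <= w p].

Lemma measurable_vacuum_set m : measurable (vacuum_set m).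
Proof.
apply: measurableI.
- by have [] := measurable_level 0 mf.
- by have [] := measurable_level m.+1%:R^-1 mw.
Qed.

(* Raising f by t on the vacuum set N changes the energy by t ln t mu(N) + O(t),
   so mu(N) > 0 is impossible; the moments are restored by subtracting t times
   a quadratic form on the set S where f is bounded below. *)
Lemma vacuum_set_null m : mu (vacuum_set m) = 0%E.
Proof.
set N := vacuum_set m; have mN : measurable N := measurable_vacuum_set m.
have [n S0] := interior_set_charged minf.
set S := interior_set eta f n in S0.
have mS : measurable S := measurable_interior_set minf n.
have [C C0 solve] := gram_solve mS S0.
have [B [symB momBE _]] := solve _ (mom_sym (\1_N : S2 R -> R)).
have [eps eps0 EL] := variation_inequality r1 minf.
pose K := l1norm B.
have K0 : 0 <= K by exact: l1norm_ge0.
have SN p : S p -> ~ N p.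
  by move=> Sp [/= fp _]; have [] := interior_set_gt0 Sp; rewrite ltNge fp.
have I1 : L1 mu (\1_N : S2 R -> R) by exact: L1_indic.
have ISq : L1 mu (fun p => \1_S p * quadf B p) by exact: L1_cut.
have mNw : measurable_fun setT (fun p => \1_N p * ln (w p)).
  apply: measurable_funM; first exact: measurable_indic_S2.
  by apply: measurableT_comp mw; exact: measurable_ln.
have INw : L1 mu (fun p => \1_N p * ln (w p)).
  apply: (@L1_bounded _ _ _ _ _ ((l1norm Q + `|eta|) + m.+1%:R)) => //.
    exact: dp_fin.
  move=> p; rewrite indicE; have [/set_mem [/= _ wp]|_] := boolP (p \in N); last first.
    by rewrite mul0r normr0 !addr_ge0 ?l1norm_ge0.
  have wp0 : 0 < w p by apply: lt_le_trans wp; rewrite invr_gt0.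
  rewrite mul1r; apply: le_trans (norm_ln_le wp0) _; apply: lerD.
    by rewrite (le_trans (ler_norm _))// field_le.
  by rewrite -[leRHS]invrK lef_pV2 ?posrE// invr_gt0.
have mSu : measurable_fun setT (fun p => \1_S p * u p).
  apply: (measurable_cut minf); apply: measurable_funB.
    by apply: measurableT_comp mf; exact: measurable_ln.
  by apply: measurableT_comp mw; exact: measurable_ln.
have ISu : L1 mu (fun p => \1_S p * u p).
  exact: (L1_bounded dp_fin mSu (interior_cut_bound eta f n)).
have ISuq := L1_quadf B ISu.
have Isq2 : L1 mu (fun p => \1_S p * quadf B p * quadf B p) by exact: L1_quadf.
(* The coefficient of t in the increment: -ln w on N, besides the t ln t term, and
   [- quadf B * (1 + u)] on S, where the variation is [- t * quadf B]. *)
pose b1 p := (- 1) * (\1_N p * ln (w p)) +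
  ((- 1) * (\1_S p * quadf B p) + (- 1) * (\1_S p * u p * quadf B p)).
have Ib1' : L1 mu (fun p => (- 1) * (\1_S p * quadf B p) + (- 1) * (\1_S p * u p * quadf B p)).
  by apply: L1D; exact: L1Z.
have Ib1 : L1 mu b1 by apply: L1D => //; exact: L1Z.
pose phi t p := t * (\1_N p - \1_S p * quadf B p).
pose beta t p := t * ln t * \1_N p +
  (t * b1 p + t ^+ 2 * n.+1%:R * (\1_S p * quadf B p * quadf B p)).
pose t0 := Num.min eps n.+1%:R^-1 / (K + 1).
have K1 : 0 < K + 1 by rewrite ltr_wpDl.
have t00 : 0 < t0 by rewrite divr_gt0 ?lt_min ?eps0 ?invr_gt0 ?ltr0n.
have Iphi t : L1 mu (phi t) by apply: L1Z; exact: L1B.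
have momphi t : mom (phi t) = 0.
  by rewrite momZ; [rewrite momB// momBE subrr scaler0|exact: L1B].
have intbeta t : 0 < t -> t <= t0 -> 0 <= \int[mu]_p beta t p.
  move=> tp tt0.
  have phib p : `|phi t p| <= Num.min eps n.+1%:R^-1.
    rewrite normrM (gtr0_norm tp) (@le_trans _ _ (t0 * (K + 1)))//.
      apply: ler_pM => //; first exact: ltW.
      apply: le_trans (ler_normB _ _) _; rewrite [leRHS]addrC lerD//.
        by rewrite indic_le1.
      by rewrite normrM (le_trans _ (quadf_le B p))// ler_piMl// indic_le1.
    by rewrite /t0 mulfVK// gt_eqF.
  have phiS p : S p -> phi t p = - (t * quadf B p).
    move=> Sp; rewrite /phi !indicE (mem_set Sp) memNset; last exact: SN.
    by rewrite sub0r mul1r mulrN.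
  have phiN p : N p -> phi t p = t.
    move=> Np; rewrite /phi !indicE (mem_set Np) memNset; last by move=> /SN.
    by rewrite mul0r subr0 mulr1.
  have phi0 p : ~ S p -> ~ N p -> phi t p = 0.
    by move=> nS nN; rewrite /phi !indicE !memNset// mul0r subr0 mulr0.
  apply: (EL (phi t) (beta t)).
  - exact: L1_measurable (Iphi t).
  - by move=> p; rewrite (le_trans (phib p))// ge_min lexx.
  - by rewrite -mxtrace_mom// momphi mxtrace0.
  - apply: filterS (minimiser_ge0 minf) => p f0.
    have [Sp|nSp] := pselect (S p).
      have := phib p; rewrite le_min => /andP[_].
      rewrite ler_norml => /andP[+ _]; case: Sp => -[/= h1 _] _.
      by move: (n.+1%:R^-1) h1 (phi t p) => z h1 y h2; lra.
    have [Np|nNp] := pselect (N p); first by rewrite phiN// addr_ge0// ltW.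
    by rewrite phi0// addr0.
  - apply: filterS (minimiser_field minf) => p fw; rewrite momphi addr0.
    have [Sp|nSp] := pselect (S p); first by have [] := interior_set_gt0 Sp.
    have [Np|nNp] := pselect (N p).
      by move=> _; case: Np => /= _; apply: lt_le_trans; rewrite invr_gt0.
    by rewrite phi0// addr0.
  - by apply: L1D; [exact: L1Z|apply: L1D; exact: L1Z].
  - apply: filterS (minimiser_ge0 minf) => p f0; rewrite momphi addr0.
    have [Sp|nSp] := pselect (S p).
      have := phib p; rewrite le_min => /andP[_] /(density_energy_variation Sp).
      rewrite /beta /b1 /density_energy phiS// !indicE (mem_set Sp) memNset; last exact: SN.
      by rewrite mulr0n mulr1n; lra.
    have [Np|nNp] := pselect (N p).
      have f00 : f p = 0 by apply/eqP; rewrite eq_le f0 andbT; case: Np.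
      rewrite /beta /b1 /density_energy phiN// !indicE (mem_set Np) memNset//.
      by rewrite mulr0n mulr1n f00 !add0r; lra.
    rewrite /beta /b1 /density_energy phi0// !indicE !memNset// mulr0n addr0; lra.
have NR : mu N = (fine (mu N))%:E.
  rewrite fineK// ge0_fin_numE//; apply: le_lt_trans dp_fin.
  by apply: le_measure; rewrite ?inE.
rewrite NR; congr EFin; apply/eqP; rewrite eq_le fine_ge0 ?measure_ge0// andbT.
apply: (@log_coef_le0 _ _ (\int[mu]_p b1 p)
  (n.+1%:R * \int[mu]_p (\1_S p * quadf B p * quadf B p)) t0) => // t tp tt0.
have := intbeta t tp tt0; rewrite /beta.
have intN : \int[mu]_p (\1_N p : R) = fine (mu N).
  by rewrite /Rintegral integral_indic// setIT.
rewrite RintD; [|exact: L1Z|by apply: L1D; exact: L1Z].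
rewrite RintD; [|exact: L1Z|exact: L1Z].
by rewrite !RintZ// intN -[t ^+ 2 * _ * _]mulrA addrA.
Qed.

Lemma vacuum : {ae mu, forall p, f p = 0 -> w p <= 0}.
Proof.
have noN m := measure0_ae (measurable_vacuum_set m) (vacuum_set_null m).
apply: filterS (ae_foralln noN) => p noNp f0; rewrite leNgt; apply/negP => wp.
have [m _ mw'] : exists2 m, True & m.+1%:R^-1 <= w p.
  have [k kP] := ltr_add_invr wp; rewrite add0r in kP.
  by exists k => //; apply: ltW; exact: kP.
by apply: (noNp m); split => //=; rewrite f0.
Qed.

Lemma euler_lagrange_form : exists L c, [/\ Sym0 L, 0 < c &
  {ae mu, forall p, f p = c * expR (quadf L p) * Num.max (w p) 0}].
Proof.
have [B [symB uB]] := log_ratio_quadratic r1 minf.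
(* The trace part of B is constant on the sphere and moves into the factor [expR k], which leaves a
   traceless multiplier. *)
pose k := \tr B / 3.
exists (B - k%:M), (expR k); split.
- split; first by rewrite linearB/= symB tr_scalar_mx.
  by rewrite linearB/= mxtrace_scalar /k; lra.
- exact: expR_gt0.
- apply: filterS3 (filterI uB vacuum) (minimiser_ge0 minf) (minimiser_field minf).
  move=> p [up vp] f0 fw; have [fp|fp] := eqVneq (f p) 0.
    by rewrite fp max_r ?mulr0//; exact: vp.
  have fp0 : 0 < f p by rewrite lt_def fp.
  have wp := fw fp; rewrite max_l ?ltW// quadfB quadf_scalar -expRD addrCA subrr addr0.
  rewrite -up// -ln_div ?posrE// lnK ?posrE ?divr_gt0//.
  by rewrite mulfVK// gt_eqF.
Qed.

End vacuum.

(** * The multiplier *)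

Lemma slope_ge0 (R : realType) (a b t0 : R) : 0 < t0 ->
  (forall t, 0 < t -> t <= t0 -> 0 <= t * a + t ^+ 2 * b) -> 0 <= a.
Proof.
move=> t00 h; rewrite leNgt; apply/negP => a0.
pose t := Num.min t0 (- a / (2 * (`|b| + 1))).
have b1 : 0 < `|b| + 1 by rewrite ltr_wpDl.
have tp : 0 < t by rewrite lt_min t00 divr_gt0 ?oppr_gt0// mulr_gt0.
have tb : t * (2 * (`|b| + 1)) <= - a.
  by rewrite -ler_pdivlMr ?mulr_gt0// ge_min lexx orbT.
have tt0 : t <= t0 by rewrite ge_min lexx.
have := h t tp tt0; have := ler_norm b; nra.
Qed.

Lemma pos_part_lipschitz (R : realType) (x y : R) :
  `|Num.max x 0 - Num.max y 0| <= `|x - y|.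
Proof.
have h1 := ler_norm (x - y); have h2 := ler_norm (- (x - y)); rewrite normrN in h2.
have h0 := normr_ge0 (x - y).
rewrite ler_norml; have [x0|x0] := leP x 0; have [y0|y0] := leP y 0;
  by apply/andP; split; lra.
Qed.

(** Convexity of the positive part, with slope 0 chosen at the kink. This one-sided estimate carries
    the change of Q across the boundary of {w > 0}. *)
Lemma pos_part_subgradient (R : realType) (x y : R) :
  y * (0 < x)%R%:R <= Num.max (x + y) 0 - Num.max x 0.
Proof.
have [xy0|xy0] := leP (x + y) 0; have [x0|x0] := leP x 0;
  by rewrite ?mulr0 ?mulr1; lra.
Qed.

Lemma addr_ge_norm (R : realType) (x y a b : R) : a + b <= x -> `|y| <= b -> a <= x + y.
Proof. by move=> ax; rewrite ler_norml => /andP[yb _]; lra. Qed.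

(** Here ln h = q + lw, where lw is the logarithm of the field. It cancels, and only the quadratic
    form q remains beside y and the remainder. *)
Lemma perturbed_entropy_le (R : realType) (h y lg q lw z K : R) : z <= K ->
  (h + y) * lg <= h * (q + lw) + y * (q + lw + 1) + z ->
  (h + y) * lg - (h + y) * lw <= (h + y) * q + (y + K).
Proof. lra. Qed.

Section multiplier.
Context {R : realType} (eta : R) (r : \bar R) (f : S2 R -> R).
Hypotheses (r1 : (1 <= r)%E) (minf : Lr_local_minimiser eta r f).

Local Notation Q := (Qof f).
Local Notation w := (field eta Q).
Local Notation e := (density_energy eta f Q).
Local Notation mu := (dp R).

Variables (L : 'M[R]_3) (c : R).
Hypotheses (c0 : 0 < c)
  (fE : {ae mu, forall p, f p = c * expR (quadf L p) * Num.max (w p) 0}).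

(** Almost everywhere the quotient of f by w, in a form that is visibly bounded although w is not
    bounded away from 0. *)
Definition gibbs_ratio p : R := c * expR (quadf L p) * (0 < w p)%R%:R.

Definition gibbs_weight p : R := c * expR (quadf L p).

Let G := c * expR (l1norm L).
Let G0 : 0 < G.
Proof. by rewrite mulr_gt0// expR_gt0. Qed.

Lemma gibbs_weight_gt0 p : 0 < gibbs_weight p.
Proof. by rewrite mulr_gt0// expR_gt0. Qed.

Lemma gibbs_weight_le p : gibbs_weight p <= G.
Proof. by rewrite ler_pM2l// ler_expR (le_trans (ler_norm _))// quadf_le. Qed.

Lemma gibbs_weight_ge p : c * expR (- l1norm L) <= gibbs_weight p.
Proof.
rewrite ler_pM2l// ler_expR; have := quadf_le L p.
by rewrite ler_norml => /andP[].
Qed.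

Lemma measurable_gibbs_weight : measurable_fun setT gibbs_weight.
Proof.
apply: measurable_funM; first exact: measurable_cst.
by apply: measurableT_comp (measurable_quadf L); exact: measurable_expR.
Qed.

Lemma measurable_pos_part (g : S2 R -> R) : measurable_fun setT g ->
  measurable_fun setT (fun p => Num.max (g p) 0).
Proof. by move=> mg; apply: measurable_maxr mg _; exact: measurable_cst. Qed.

Lemma measurable_positive (g : S2 R -> R) : measurable_fun setT g ->
  measurable_fun setT (fun p => (0 < g p)%R%:R : R).
Proof.
move=> mg; have -> : (fun p => (0 < g p)%R%:R : R) = (fun p => if 0 < g p then 1 else 0).
  by apply/funext => p; case: (0 < g p).
apply: measurable_fun_ifT; [|exact: measurable_cst|exact: measurable_cst].
by apply: measurable_fun_ltr mg; exact: measurable_cst.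
Qed.

Lemma measurable_gibbs_ratio : measurable_fun setT gibbs_ratio.
Proof.
apply: measurable_funM measurable_gibbs_weight _.
by apply: measurable_positive; exact: measurable_field.
Qed.

Lemma gibbs_ratio_le p : `|gibbs_ratio p| <= G.
Proof.
rewrite normrM (gtr0_norm (gibbs_weight_gt0 p)) (le_trans _ (gibbs_weight_le p))//.
by rewrite ler_piMr ?(ltW (gibbs_weight_gt0 p))//; case: (0 < w p); rewrite ?normr1 ?normr0.
Qed.

Lemma L1_gibbs_ratio : L1 mu gibbs_ratio.
Proof. exact: (L1_bounded dp_fin measurable_gibbs_ratio gibbs_ratio_le). Qed.

Lemma fieldD Q' d p : field eta (Q' + d) p = field eta Q' p + quadf d p.
Proof. by rewrite /field quadfD addrAC. Qed.

Lemma l1normZ k (A : 'M[R]_3) : l1norm (k *: A) = `|k| * l1norm A.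
Proof.
rewrite /l1norm mulr_sumr; apply: eq_bigr => i _; rewrite mulr_sumr.
by apply: eq_bigr => j _; rewrite mxE normrM.
Qed.

Lemma l1normB (A B : 'M[R]_3) : l1norm (A - B) <= l1norm A + l1norm B.
Proof.
rewrite /l1norm -big_split; apply: ler_sum => i _; rewrite -big_split.
by apply: ler_sum => j _; rewrite !mxE ler_normB.
Qed.

Lemma l1norm_mom_le (phi : S2 R -> R) (K : R) :
  measurable_fun setT phi -> (forall p, `|phi p| <= K) ->
  l1norm (mom phi) <= 9 * (K * fine (mu setT)).
Proof.
move=> mphi phiK.
apply: (@le_trans _ _ (\sum_(i < 3) \sum_(j < 3) K * fine (mu setT))).
  by apply: ler_sum => i _; apply: ler_sum => j _; exact: mom_le.
by rewrite !sumr_const !card_ord; lra.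
Qed.

(* Compare f with [gibbs_weight * max (w + t d) 0 + y], where y is of order t,
   lives on {w >= rho} and makes the second moment exactly mom f + t d. To first
   order the energy changes by the integrals of phi q and of y, where q is the
   quadratic form ln f - ln w and phi the variation: the moment constraint turns
   the first into t (L . d), and mass conservation turns the second into minus the
   integral of the other part of phi. *)
Lemma multiplier_inequality d : d^T = d -> \tr d = 0 ->
  frob d (mom gibbs_ratio) <= frob L d.
Proof.
move=> symd trd.
have [m S0] : exists m, mu [set p | m.+1%:R^-1 <= w p] != 0%E.
  have [n In] := interior_set_charged minf; exists n.
  rewrite -!measure_gt0 in In *; apply: lt_le_trans In _.
  apply: le_measure; rewrite ?inE.
  - exact: (measurable_interior_set minf).
  - by have [] := measurable_level n.+1%:R^-1 (measurable_field eta Q).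
  - by move=> p [].
pose rho : R := m.+1%:R^-1.
have rho0 : 0 < rho by rewrite invr_gt0.
pose S := [set p | rho <= w p].
have mS : measurable S by have [] := measurable_level rho (measurable_field eta Q).
have [C C0 solve] := gram_solve mS S0.
have [eps eps0 EL] := variation_inequality r1 minf.
have D0 := l1norm_ge0 d; set D := l1norm d in D0.
have V0 : 0 <= fine (mu setT) by apply: fine_ge0; exact: measure_ge0.
set V := fine (mu setT) in V0.
(* The correction y will be at most t C2: C is the Gram constant, t D bounds the norm of t d, and
   the other term bounds the nine entries of [mom k], as |k| <= t G D. *)
pose C2 := C * (D + 9 * (G * D * V)).
have C20 : 0 <= C2.
  by rewrite mulr_ge0// addr_ge0// !mulr_ge0// ltW.
(* A lower bound on S for the comparison density before correction, since w + t d p.p stays above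
   [rho / 2] there. *)
pose kappa := c * expR (- l1norm L) * (rho / 2).
have kappa0 : 0 < kappa by rewrite !mulr_gt0 ?expR_gt0 ?divr_gt0.
(* The three bounds keep the new field above [rho / 2] on S, the variation below [eps], and the
   corrected density nonnegative. *)
pose t0 := Num.min (rho / 2 / (D + 1)) (Num.min (eps / (G * D + C2 + 1)) (kappa / (C2 + 1))).
have pos1 : 0 < D + 1 by rewrite ltr_wpDl.
have pos2 : 0 < G * D + C2 + 1 by rewrite ltr_wpDl// addr_ge0// mulr_ge0// ltW.
have pos3 : 0 < C2 + 1 by rewrite ltr_wpDl.
have t00 : 0 < t0 by rewrite !lt_min !divr_gt0.
rewrite -subr_ge0; apply: (@slope_ge0 _ _ (C2 ^+ 2 / kappa * V) t0) => // t tp.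
rewrite !le_min => /andP[t1 /andP[t2 t3]].
have {}t1 : t * D <= rho / 2.
  move: t1; rewrite ler_pdivlMr//; apply: le_trans.
  by rewrite ler_pM2l// lerDl.
have {}t2 : t * (G * D + C2) <= eps.
  move: t2; rewrite ler_pdivlMr//; apply: le_trans.
  by rewrite ler_pM2l// lerDl.
have {}t3 : t * C2 <= kappa.
  move: t3; rewrite ler_pdivlMr//; apply: le_trans.
  by rewrite ler_pM2l// lerDl.
pose wt p := w p + t * quadf d p.
pose k p := gibbs_weight p * (Num.max (wt p) 0 - Num.max (w p) 0).
have mw := measurable_field eta Q.
have mwt : measurable_fun setT wt.
  apply: measurable_funD mw _; apply: measurable_funM; first exact: measurable_cst.
  exact: measurable_quadf.
have mk : measurable_fun setT k.
  by apply: measurable_funM measurable_gibbs_weight _; apply: measurable_funB;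
     exact: measurable_pos_part.
have td p : `|t * quadf d p| <= t * D.
  by rewrite normrM (gtr0_norm tp) ler_wpM2l ?quadf_le// ltW.
have kb p : `|k p| <= t * (G * D).
  rewrite normrM (gtr0_norm (gibbs_weight_gt0 p)) mulrCA.
  apply: ler_pM => //; first exact: ltW (gibbs_weight_gt0 p).
    exact: gibbs_weight_le.
  apply: le_trans (pos_part_lipschitz _ _) _.
  by rewrite /wt addrC addKr.
have Ik : L1 mu k by exact: (L1_bounded dp_fin mk kb).
have symr : (t *: d - mom k)^T = t *: d - mom k by rewrite linearB linearZ/= symd mom_sym.
have [B [symB momBE Bb]] := solve _ symr.
have {}Bb p : `|quadf B p| <= t * C2.
  apply: le_trans (Bb p) _; rewrite /C2 mulrCA ler_wpM2l//.
  apply: le_trans (l1normB _ _) _; rewrite l1normZ (gtr0_norm tp) -/D mulrDr lerD2l.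
  apply: le_trans (l1norm_mom_le mk kb) _; rewrite -/V.
  by rewrite -!mulrA mulrCA.
pose y p := \1_S p * quadf B p.
have Iy : L1 mu y by exact: L1_cut.
have yb p : `|y p| <= t * C2.
  by rewrite normrM (le_trans _ (Bb p))// ler_piMl// indic_le1.
pose phi p := k p + y p.
have Iphi : L1 mu phi by exact: L1D.
have momphi : mom phi = t *: d by rewrite momD// momBE addrCA subrr addr0.
have int0 : \int[mu]_p phi p = 0 by rewrite -mxtrace_mom// momphi linearZ/= trd mulr0.
have wS p : S p -> rho / 2 <= wt p.
  move=> Sp; apply: (addr_ge_norm _ (td p)); apply: le_trans Sp.
  by apply: le_trans (lerD (lexx _) t1) _; rewrite -splitr.
have fphi p : f p = c * expR (quadf L p) * Num.max (w p) 0 ->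
    f p + phi p = gibbs_weight p * Num.max (wt p) 0 + y p.
  by move=> ->; rewrite /phi /k addrA -mulrDr addrCA subrr addr0.
have hS p : S p -> kappa <= gibbs_weight p * Num.max (wt p) 0.
  move=> Sp; have := wS p Sp => h; rewrite max_l; last by apply: le_trans h; rewrite divr_ge0// ltW.
  apply: ler_pM => //; [by rewrite mulr_ge0 ?expR_ge0// ltW|by rewrite divr_ge0// ltW|].
  exact: gibbs_weight_ge.
have yS p : ~ S p -> y p = 0 by move=> nS; rewrite /y indicE memNset// mul0r.
pose q := L + (ln c)%:M.
have lnweight p : ln (gibbs_weight p) = quadf q p.
  by rewrite lnM ?posrE ?expR_gt0// expRK quadfD quadf_scalar addrC.
(* A uniform bound for the second-order remainder y^2 / h, because y lives on S, where h >=
   [kappa]. *)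
pose K2 := (t * C2) ^+ 2 / kappa.
have K20 : 0 <= K2 by rewrite divr_ge0 ?sqr_ge0// ltW.
pose beta p := phi p * quadf q p + (y p + K2).
have IK2 : L1 mu (fun=> K2).
  by apply: (@L1_bounded _ _ _ _ _ K2 dp_fin (measurable_cst _)) => p; rewrite ger0_norm.
have IyK : L1 mu (fun p => y p + K2) by exact: L1D.
have Iphiq : L1 mu (fun p => phi p * quadf q p) by exact: L1_quadf.
have Ibeta : L1 mu beta by exact: L1D.
have beta0 : 0 <= \int[mu]_p beta p.
  apply: (EL phi beta).
  - exact: L1_measurable Iphi.
  - move=> p; apply: le_trans (ler_normD _ _) _; apply: le_trans (lerD (kb p) (yb p)) _.
    by rewrite -mulrDr.
  - exact: int0.
  - apply: filterS fE => p fp; rewrite fphi//; have [Sp|nS] := pselect (S p).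
      apply: (addr_ge_norm _ (yb p)); rewrite add0r; exact: le_trans t3 (hS p Sp).
    by rewrite yS// addr0 mulr_ge0 ?(ltW (gibbs_weight_gt0 p))// le_max lexx orbT.
  - apply: filterS fE => p fp; rewrite fphi// momphi fieldD quadfZ -/(wt p).
    move=> h; rewrite ltNge; apply: contraNN h => wt0.
    have nS : ~ S p.
      by move=> Sp; have := le_trans (wS p Sp) wt0; rewrite leNgt divr_gt0.
    by rewrite yS// addr0 max_r// mulr0.
  - exact: Ibeta.
  - apply: filterS fE => p fp.
    rewrite /density_energy momphi fieldD quadfZ -/(wt p) fphi// /beta.
    (* Where w <= 0 both sides vanish with f; elsewhere ln f - ln w is the form q. *)
    have ef : f p * ln (f p) - f p * ln (w p) = f p * quadf q p.
      have [wp|wp] := leP (w p) 0; first by rewrite fp max_r// mulr0 !mul0r subr0.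
      rewrite -mulrBr fp max_l ?ltW// -/(gibbs_weight p) lnM ?posrE ?gibbs_weight_gt0//.
      by rewrite addrK lnweight.
    rewrite ef addrA -mulrDl fphi//.
    have [wp|wp] := leP (wt p) 0.
      have nS : ~ S p.
        by move=> Sp; have := le_trans (wS p Sp) wp; rewrite leNgt divr_gt0.
      by rewrite yS// mulr0 !addr0 !mul0r subr0 !add0r.
    set h := gibbs_weight p * wt p.
    have h0 : 0 < h by rewrite mulr_gt0// gibbs_weight_gt0.
    have hy0 : 0 <= h + y p.
      have [Sp|nS] := pselect (S p); last by rewrite yS// addr0 ltW.
      apply: (addr_ge_norm _ (yb p)); rewrite add0r; apply: le_trans t3 _.
      by have := hS p Sp; rewrite (max_l (ltW wp)).
    have lnh : ln h = quadf q p + ln (wt p).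
      by rewrite lnM ?posrE ?gibbs_weight_gt0// lnweight.
    have yh : y p ^+ 2 / h <= K2.
      have [Sp|nS] := pselect (S p); last by rewrite yS// expr0n mul0r.
      apply: ler_pM; rewrite ?sqr_ge0 ?invr_ge0 ?(ltW h0)//.
        rewrite -[y p ^+ 2]real_normK ?num_real// ler_pXn2r ?nnegrE//.
        by rewrite mulr_ge0// ltW.
      rewrite lef_pV2 ?posrE//; have := hS p Sp.
      by rewrite (max_l (ltW wp)).
    by have := mul_ln_add_le h0 hy0; rewrite lnh => /(perturbed_entropy_le yh).
have inty : \int[mu]_p y p = - \int[mu]_p k p.
  by apply/eqP; rewrite -addr_eq0 addrC -RintD// int0.
(* The integral of y is minus that of k, so the lower bound for k from the subgradient is an upper
   bound for y, as required. *)
have intk : t * frob d (mom gibbs_ratio) <= \int[mu]_p k p.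
  rewrite -Rint_quadf; last exact: L1_gibbs_ratio.
  rewrite -RintZ; last by apply: L1_quadf; exact: L1_gibbs_ratio.
  apply: Rint_ae_le => //.
    by apply: L1Z; apply: L1_quadf; exact: L1_gibbs_ratio.
  apply: aeW => p; rewrite /gibbs_ratio -/(gibbs_weight p) /k -mulrA mulrCA.
  rewrite ler_pM2l ?gibbs_weight_gt0// mulrCA mulrC.
  exact: pos_part_subgradient.
move: beta0; rewrite /beta RintD// RintD// Rint_quadf// momphi inty.
rewrite (Rintegral_cst mu measurableT) -/V frobZr frobDl [frob _%:M _]frobC frob_scalar trd.
rewrite mulr0 addr0 => h.
have -> : t ^+ 2 * (C2 ^+ 2 / kappa * V) = K2 * V by rewrite /K2 [(t * C2) ^+ 2]exprMn -!mulrA.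
rewrite mulrBr -addrA; apply: le_trans h _; rewrite lerD2l lerD2r lerN2.
exact: intk.
Qed.

(** The inequality for d and -d becomes an equality. Tested with d equal to the difference of the
    two sides, which is traceless and symmetric, it says that d has norm 0. *)
Lemma multiplier_eq : Sym0 L -> L = mom gibbs_ratio - (1 / 3 * \int[mu]_p gibbs_ratio p)%:M.
Proof.
move=> [symL trL]; set M := mom gibbs_ratio; set M' := M - _.
have symM : M^T = M by exact: mom_sym.
have trM' : \tr M' = 0.
  rewrite linearB/= mxtrace_scalar mxtrace_mom; last exact: L1_gibbs_ratio.
  by move: (\int[mu]_p _) => x; lra.
have symM' : M'^T = M' by rewrite linearB/= symM tr_scalar_mx.
pose d := L - M'.
have symd : d^T = d by rewrite linearB/= symL symM'.
have trd : \tr d = 0 by rewrite linearB/= trL trM' subrr.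
have le1 : frob d M <= frob L d by exact: multiplier_inequality.
have le2 : frob L d <= frob d M.
  have := @multiplier_inequality (- d); rewrite !linearN/= symd trd oppr0.
  by move=> /(_ erefl erefl); rewrite frobNl [frob L _]frobC frobNl lerN2 frobC.
have eqd : frob L d = frob d M by apply/eqP; rewrite eq_le le2 le1.
apply/eqP; rewrite -subr_eq0; apply/eqP; apply: frob_eq0; rewrite -/d.
rewrite {2}/d frobBr [frob d L]frobC eqd /M' frobBr frob_scalar trd mulr0 subr0.
by rewrite subrr.
Qed.

End multiplier.

(** * The dual function *)

Lemma expR_taylor2 (R : realType) (s : R) : `|s| <= 1 / 2 ->
  `|expR s - 1 - s| <= 2 * s ^+ 2.
Proof.
rewrite ler_norml => /andP[s1 s2].
have l1 := expR_ge1Dx s; have l2 := expR_ge1Dx (- s).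
have p0 := expR_gt0 s; have E : expR s * expR (- s) = 1 by rewrite -expRD subrr expR0.
have ub : expR s * (1 - s) <= 1 by rewrite -[leRHS]E ler_pM2l.
have h : expR s <= 1 + s + 2 * s ^+ 2.
  have pos : 0 < 1 - s by lra.
  rewrite -(ler_pM2r pos); apply: le_trans ub _.
  have := sqr_ge0 s; nra.
by have s0 := sqr_ge0 s; rewrite ler_norml; apply/andP; split; lra.
Qed.

Lemma ln_taylor1 (R : realType) (y : R) : `|y| <= 1 / 2 ->
  `|ln (1 + y) - y| <= 2 * y ^+ 2.
Proof.
rewrite ler_norml => /andP[y1 y2].
have y0 : 0 < 1 + y by lra.
have l1 : ln (1 + y) <= y by apply: le_ln1Dx; lra.
have l2 : - ln (1 + y) <= - (y / (1 + y)).
  rewrite -lnV ?posrE//.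
  have e : (1 + y)^-1 = 1 + - (y / (1 + y)).
    by apply: (mulIf (lt0r_neq0 y0)); rewrite mulrDl mulNr mulfVK ?gt_eqF// mulVf ?gt_eqF//; lra.
  by rewrite [X in ln X]e; apply: le_ln1Dx; rewrite ltrN2 ltr_pdivrMr//; lra.
have l3 : y - 2 * y ^+ 2 <= y / (1 + y).
  by rewrite ler_pdivlMr//; have := sqr_ge0 y; nra.
by have yy := sqr_ge0 y; rewrite ler_norml; apply/andP; split; lra.
Qed.

(** The linearisation is exact unless the kink lies within n of x. After integration the error is n
    times the measure of {|w| <= n}, which is o(n) when {w = 0} is null. *)
Lemma pos_part_taylor (R : realType) (x d n : R) : `|d| <= n ->
  `|Num.max (x + d) 0 - Num.max x 0 - d * (0 < x)%R%:R| <= n * (`|x| <= n)%R%:R.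
Proof.
move=> dn; have n0 : 0 <= n by exact: le_trans dn.
have h1 := ler_norm d; have h2 := ler_norm (- d); rewrite normrN in h2.
have x1 := ler_norm x; have x2 := ler_norm (- x); rewrite normrN in x2.
have [xn|xn] := leP `|x| n; rewrite ?mulr1 ?mulr0.
  have [x0|x0] := leP x 0; have [y0|y0] := leP (x + d) 0;
  rewrite ?mulr1 ?mulr0 ler_norml; apply/andP; split; lra.
have [x0|x0] := leP x 0; have [y0|y0] := leP (x + d) 0; rewrite ?mulr1 ?mulr0.
- by rewrite !subr0 normr0.
- by move: xn; rewrite ler0_norm// => xn; lra.
- by move: xn; rewrite gtr0_norm// => xn; lra.
- by rewrite (_ : x + d - x - d = 0) ?normr0//; lra.
Qed.

(** The error splits into the second-order error of the exponential, the product of the two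
    increments, and the linearisation error of the positive part. The first two are of order n^2. *)
Lemma partition_remainder (R : realType) (E H w W d s n : R) :
  0 <= E <= H -> `|w| <= W -> `|d| <= n -> `|s| <= n -> n <= 1 / 2 ->
  `|E * expR s * Num.max (w + d) 0 - E * Num.max w 0 -
    (E * Num.max w 0 * s + E * (0 < w)%R%:R * d)| <=
  H * (n ^+ 2 * (2 * W + 3)) + H * n * (`|w| <= n)%R%:R.
Proof.
move=> /andP[E0 EH] wW dn sn n2; have n0 : 0 <= n by exact: le_trans dn.
have sn2 := le_trans sn n2.
have s2 : s ^+ 2 <= n ^+ 2 by rewrite -[s ^+ 2]real_normK ?num_real// ler_pXn2r ?nnegrE.
have T1 : `|(expR s - 1 - s) * Num.max (w + d) 0| <= n ^+ 2 * (2 * W + 2).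
  rewrite normrM; apply: (@le_trans _ _ (2 * n ^+ 2 * (W + 1))); last by lra.
  apply: ler_pM => //; first by apply: le_trans (expR_taylor2 sn2) _; rewrite ler_pM2l.
  have h0 : 0 <= Num.max (w + d) 0 by rewrite le_max lexx orbT.
  rewrite ger0_norm// ge_max; apply/andP; split.
    have := ler_norm w; have := ler_norm d; lra.
  have := normr_ge0 w; lra.
have T2 : `|s * (Num.max (w + d) 0 - Num.max w 0)| <= n ^+ 2.
  rewrite normrM expr2; apply: ler_pM => //; apply: le_trans (pos_part_lipschitz _ _) _.
  by rewrite addrAC subrr add0r.
have T3 := pos_part_taylor w dn.
have -> : E * expR s * Num.max (w + d) 0 - E * Num.max w 0 -
    (E * Num.max w 0 * s + E * (0 < w)%R%:R * d) =
    E * ((expR s - 1 - s) * Num.max (w + d) 0 + s * (Num.max (w + d) 0 - Num.max w 0) +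
         (Num.max (w + d) 0 - Num.max w 0 - d * (0 < w)%R%:R)).
  by move: (Num.max _ _) (Num.max _ _) (expR _) => a b e; lra.
rewrite normrM (ger0_norm E0) -mulrA -mulrDr; apply: ler_pM => //.
apply: le_trans (ler_normD _ _) _; apply: lerD T3.
apply: le_trans (ler_normD _ _) _; apply: le_trans (lerD T1 T2) _; lra.
Qed.

Lemma mx_coord_le (R : realType) m n (x : 'M[R]_(m.+1, n.+1)) i j : `|x i j| <= `|x|.
Proof.
rewrite (_ : `|x| = mx_norm x :> R)// mx_normrE.
exact: (le_bigmax_cond _ (fun ij : 'I_m.+1 * 'I_n.+1 => `|x ij.1 ij.2|) (j := (i, j))).
Qed.

Section dual.
Context {R : realType} (eta : R).
Local Notation mu := (dp R).
Variables (Q L : 'M[R]_3) (Z k : R).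
Local Notation w := (field eta Q).
Hypotheses (symQ : Sym0 Q) (symL : Sym0 L) (Z0 : 0 < Z).
(* hQ and hL say that the derivatives of the dual function in L and in Q vanish
   along traceless matrices. *)
Hypothesis hQ : mom (fun p => expR (quadf L p) * Num.max (w p) 0) = Z *: (Q + (1 / 3)%:M).
Hypothesis hL : mom (fun p => expR (quadf L p) * (0 < w p)%R%:R) = Z *: (L + k%:M).
Hypothesis null0 : mu [set p | w p = 0] = 0%E.

Lemma l1norm_le_norm (A : 'M[R]_3) : l1norm A <= 9 * `|A|.
Proof.
apply: (@le_trans _ _ (\sum_(i < 3) \sum_(j < 3) `|A|)).
  by apply: ler_sum => i _; apply: ler_sum => j _; exact: mx_coord_le.
by rewrite !sumr_const !card_ord; lra.
Qed.

Let level (n : R) : set (S2 R) := [set p | `|w p| <= n].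

Lemma measurable_sublevel_norm n : measurable (level n).
Proof.
have mn : measurable_fun setT (fun p => `|w p|).
  by apply: measurableT_comp (measurable_field eta Q); exact: normr_measurable.
by have [] := measurable_level n mn.
Qed.

(** The levels decrease to {w = 0}, a null set, so continuity from above of the finite measure
    applies. *)
Lemma small_level (e : R) : 0 < e ->
  exists2 n0, 0 < n0 & forall n, n <= n0 -> fine (mu (level n)) <= e.
Proof.
move=> e0.
have mE (i : nat) : measurable (level i.+1%:R^-1) by exact: measurable_sublevel_norm.
have capE : \bigcap_i level i.+1%:R^-1 = [set p | w p = 0].
  apply/seteqP; split => [p pn|p /= w0 i _]; last by rewrite /level /= w0 normr0 invr_ge0.
  apply: contrapT => /eqP wn0; have wp : 0 < `|w p| by rewrite normr_gt0.
  have [i iP] := ltr_add_invr wp; rewrite add0r in iP.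
  by have := pn i I; rewrite /level /= leNgt iP.
have levelfin n : (mu (level n) < +oo)%E.
  apply: le_lt_trans dp_fin; apply: le_measure; rewrite ?inE//.
  exact: measurable_sublevel_norm.
have cvg0 : (mu \o (fun i => level i.+1%:R^-1)) i @[i --> \oo] --> (0 : \bar R)%E.
  rewrite -null0 -capE; apply: nonincreasing_cvg_mu => //.
    by apply: bigcapT_measurable.
  move=> i j ij; apply/subsetPset => p /= h; apply: le_trans h _.
  by rewrite lef_pV2 ?posrE// ler_nat.
move/fine_cvgP: cvg0 => [_ /cvgrPdist_le /(_ e e0)] [i _ /(_ i (leqnn i))] /=.
rewrite sub0r normrN => h; exists i.+1%:R^-1; first by rewrite invr_gt0.
move=> n ni; apply: le_trans h; apply: le_trans (ler_norm _).
have fin m : mu (level m) \is a fin_num by rewrite ge0_fin_numE ?levelfin.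
apply: (fine_le (fin _) (fin _)); apply: le_measure; rewrite ?inE.
- exact: measurable_sublevel_norm.
- exact: measurable_sublevel_norm.
- by move=> p /= h; exact: le_trans h ni.
Qed.

Let Wb := l1norm Q + `|eta|.
Let H := expR (l1norm L).
Let V := fine (mu setT).

Let E p := expR (quadf L p).
Let E0 p : 0 <= E p <= H.
Proof.
rewrite expR_ge0 ler_expR; apply: le_trans (ler_norm _) _; exact: quadf_le.
Qed.

Let mE : measurable_fun setT E.
Proof. by apply: measurableT_comp (measurable_quadf L); exact: measurable_expR. Qed.

Let V0 : 0 <= V.
Proof. by apply: fine_ge0; exact: measure_ge0. Qed.

Let H0 : 0 <= H. Proof. exact: expR_ge0. Qed.

Let Wb0 : 0 <= Wb. Proof. by rewrite addr_ge0// l1norm_ge0. Qed.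

Definition partition_function (Q' L' : 'M[R]_3) : R :=
  \int[mu]_p (expR (quadf L' p) * Num.max (field eta Q' p) 0).

Lemma L1_partition Q' L' :
  L1 mu (fun p => expR (quadf L' p) * Num.max (field eta Q' p) 0).
Proof.
apply: (@L1_bounded _ _ _ _ _ (expR (l1norm L') * (l1norm Q' + `|eta|)) dp_fin).
  apply: measurable_funM.
    by apply: measurableT_comp (measurable_quadf L'); exact: measurable_expR.
  by apply: measurable_pos_part; exact: measurable_field.
move=> p; rewrite normrM (ger0_norm (expR_ge0 _)); apply: ler_pM; rewrite ?expR_ge0//.
  by rewrite ler_expR (le_trans (ler_norm _))// quadf_le.
apply: le_trans (field_le eta Q' p); have := pos_part_lipschitz (field eta Q' p) 0.
by rewrite maxxx !subr0.
Qed.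

Lemma partition_function_eq : partition_function Q L = Z.
Proof.
rewrite /partition_function -mxtrace_mom; last exact: L1_partition.
rewrite hQ linearZ/= linearD/= mxtrace_scalar; case: symQ => _ ->; lra.
Qed.

Lemma partition_expansion (d l : 'M[R]_3) (n : R) :
  \tr d = 0 -> \tr l = 0 -> l1norm d <= n -> l1norm l <= n -> n <= 1 / 2 ->
  `|partition_function (Q + d) (L + l) - Z - Z * (frob l Q + frob d L)| <=
  H * (n ^+ 2 * (2 * Wb + 3)) * V + H * n * fine (mu (level n)).
Proof.
move=> trd trl dn l_n n2; have n0 : 0 <= n by exact: le_trans (l1norm_ge0 d) dn.
pose g0 p := E p * Num.max (w p) 0.
pose g1 p := E p * (0 < w p)%R%:R.
pose g p := expR (quadf (L + l) p) * Num.max (field eta (Q + d) p) 0.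
have Ig0 : L1 mu g0 by exact: L1_partition.
have Ig : L1 mu g by exact: L1_partition.
have Ig1 : L1 mu g1.
  apply: (@L1_bounded _ _ _ _ _ H dp_fin).
    by apply: measurable_funM mE _; apply: measurable_positive; exact: measurable_field.
  move=> p; have /andP[e0 eH] := E0 p; rewrite normrM (ger0_norm e0) (le_trans _ eH)//.
  by rewrite ler_piMr//; case: (0 < w p)%R; rewrite ?normr1 ?normr0.
have Ig0l := L1_quadf l Ig0; have Ig1d := L1_quadf d Ig1.
have Ilin : L1 mu (fun p => g0 p * quadf l p + g1 p * quadf d p) by exact: L1D.
have -> : partition_function (Q + d) (L + l) - Z - Z * (frob l Q + frob d L) =
    \int[mu]_p (g p - g0 p - (g0 p * quadf l p + g1 p * quadf d p)).
  rewrite RintB//; last exact: L1B.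
  rewrite RintB// RintD// !Rint_quadf// hQ hL -/(partition_function (Q + d) (L + l)).
  rewrite -partition_function_eq !frobZr !frobDr !frob_scalar trd trl !mulr0 !addr0.
  by rewrite mulrDr.
have Irem : L1 mu (fun p => g p - g0 p - (g0 p * quadf l p + g1 p * quadf d p)).
  by apply: L1B => //; exact: L1B.
apply: le_trans (le_normr_Rintegral measurableT Irem) _.
have IB1 : L1 mu (fun=> H * (n ^+ 2 * (2 * Wb + 3))).
  apply: (@L1_bounded _ _ _ _ _ (H * (n ^+ 2 * (2 * Wb + 3))) dp_fin (measurable_cst _)) => p.
  by rewrite ger0_norm// !mulr_ge0 ?sqr_ge0 ?addr_ge0 ?mulr_ge0.
have mlev := measurable_sublevel_norm n.
have IB2 : L1 mu (fun p => H * n * \1_(level n) p) by apply: L1Z; exact: L1_indic.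
apply: (@le_trans _ _ (\int[mu]_p (H * (n ^+ 2 * (2 * Wb + 3)) + H * n * \1_(level n) p))).
  apply: Rint_ae_le; [exact: integrable_norm|exact: L1D|].
  apply: aeW => p; rewrite /g /g0 /g1 fieldD quadfD expRD -/(E p).
  have := partition_remainder (E0 p) (field_le eta Q p) (le_trans (quadf_le d p) dn)
    (le_trans (quadf_le l p) l_n) n2.
  rewrite indicE; congr (_ <= _ + _ * (nat_of_bool _)%:R).
  by apply/idP/idP => [?|/set_mem//]; rewrite inE.
rewrite RintD// [X in _ + X <= _]RintZ; last exact: L1_indic.
rewrite (Rintegral_cst mu measurableT) -/V.
by rewrite /Rintegral integral_indic// setIT.
Qed.

Lemma frob_le (A B : 'M[R]_3) : `|frob A B| <= l1norm A * l1norm B.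
Proof.
apply: le_trans (ler_norm_sum _ _ _) _; rewrite /l1norm mulr_suml.
apply: ler_sum => i _; apply: le_trans (ler_norm_sum _ _ _) _; rewrite mulr_suml.
apply: ler_sum => j _; rewrite normrM ler_wpM2l//.
rewrite (bigD1 i)//= (bigD1 j)//= -addrA lerDl addr_ge0//; first exact: sumr_ge0.
by apply: sumr_ge0 => a _; exact: sumr_ge0.
Qed.

Lemma dual_function_increment (d l : 'M[R]_3) (n m : R) :
  Sym0 d -> Sym0 l -> l1norm d <= n -> l1norm l <= n -> n <= 1 / 2 ->
  fine (mu (level n)) <= m -> m <= V ->
  let A := H * (2 * Wb + 3) * V in
  let K := l1norm Q + l1norm L + (A + H * V) / Z in
  n * K <= 1 / 2 ->
  `|dual_function eta (Q + d, L + l) - dual_function eta (Q, L)| <=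
  n * (n * (1 + A / Z + 2 * K ^+ 2) + H / Z * m).
Proof.
move=> [symd trd] [syml trl] dn l_n n2 levm mV A K nK.
have n0 : 0 <= n by exact: le_trans (l1norm_ge0 d) dn.
have m0 : 0 <= m by apply: le_trans levm; apply: fine_ge0; exact: measure_ge0.
have A0 : 0 <= A by rewrite !mulr_ge0// addr_ge0// mulr_ge0.
pose G := partition_function (Q + d) (L + l).
pose lin := frob l Q + frob d L.
(* The relative increment of the partition function; its linear part [lin] is also the linear part
   of the increment of the trace term. *)
pose y := G / Z - 1.
have Zn0 : Z != 0 by rewrite gt_eqF.
have rho : `|y - lin| <= n * (n * (A / Z) + H / Z * m).
  have -> : y - lin = (G - Z - Z * lin) / Z.
    by rewrite !mulrBl mulfV// mulrAC mulfV// mul1r.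
  rewrite normrM normfV (gtr0_norm Z0) ler_pdivrMr//.
  apply: le_trans (partition_expansion trd trl dn l_n n2) _.
  have -> : n * (n * (A / Z) + H / Z * m) * Z = n ^+ 2 * A + H * n * m.
    have ZZ : Z^-1 * Z = 1 by rewrite mulVf.
    transitivity (n * (n * A + H * m) * (Z^-1 * Z)); first by lra.
    by rewrite ZZ; lra.
  rewrite -/V; apply: lerD; first by rewrite /A; lra.
  by rewrite ler_wpM2l// mulr_ge0.
have linb : `|lin| <= n * (l1norm Q + l1norm L).
  apply: le_trans (ler_normD _ _) _; rewrite mulrDr; apply: lerD.
    by apply: le_trans (frob_le _ _) _; rewrite ler_wpM2r// l1norm_ge0.
  by apply: le_trans (frob_le _ _) _; rewrite ler_wpM2r// l1norm_ge0.
have yb : `|y| <= n * K.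
  have -> : y = lin + (y - lin) by rewrite addrC subrK.
  apply: le_trans (ler_normD _ _) _; apply: le_trans (lerD linb rho) _.
  rewrite -mulrDr ler_wpM2l// /K lerD2l mulrDl; apply: lerD.
    by rewrite ler_piMl ?divr_ge0 ?(ltW Z0)//; lra.
  by rewrite mulrAC ler_wpM2r ?invr_ge0 ?(ltW Z0)// ler_wpM2l.
have y2 : y ^+ 2 <= n ^+ 2 * K ^+ 2.
  rewrite -exprMn -[y ^+ 2]real_normK ?num_real// ler_pXn2r ?nnegrE//.
  by apply: le_trans yb; exact: normr_ge0.
have lny := ln_taylor1 (le_trans yb nK).
have fld : `|frob l d| <= n ^+ 2.
  by apply: le_trans (frob_le _ _) _; rewrite expr2; apply: ler_pM => //; exact: l1norm_ge0.
have y1 : 0 < 1 + y.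
  by move: (le_trans yb nK); rewrite ler_norml => /andP[+ _]; lra.
have GE : G = Z * (1 + y) by rewrite /y addrCA subrr addr0 mulrCA mulfV// mulr1.
(* The two linear parts cancel. What remains is the bilinear term, the error of the partition
   function and the error of the logarithm. *)
have -> : dual_function eta (Q + d, L + l) - dual_function eta (Q, L) =
    frob l d - (y - lin) - (ln (1 + y) - y).
  rewrite /dual_function /= -/(partition_function _ _) -/(partition_function Q L).
  rewrite partition_function_eq -/G GE lnM ?posrE//.
  case: symQ => sQ _; rewrite !mxtrace_frob//; last by rewrite linearD/= sQ symd.
  rewrite frobDl !frobDr /lin [frob d L]frobC.
  by move: (ln _) (ln _) (frob _ _) (frob _ _) (frob _ _) (frob _ _) => *; lra.
apply: le_trans (ler_normB _ _) _; apply: le_trans (lerD (ler_normB _ _) lny) _.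
move: rho fld y2; move: `|y - lin| `|frob l d| (y ^+ 2) => a b e.
move: (A / Z) (H / Z * m) => u v h1 h2 h3.
have -> : n * (n * (1 + u + 2 * K ^+ 2) + v) =
  n ^+ 2 + n * (n * u + v) + 2 * (n ^+ 2 * K ^+ 2) by lra.
lra.
Qed.

Lemma dual_critical (D : set ('M[R]_3 * 'M[R]_3)%type) : D (Q, L) ->
  (forall X, D X -> Sym0 X.1 /\ Sym0 X.2) ->
  critical_point D (dual_function eta) (Q, L).
Proof.
move=> D0 DS; split=> // eps eps0.
pose A := H * (2 * Wb + 3) * V.
pose K := l1norm Q + l1norm L + (A + H * V) / Z.
have A0 : 0 <= A by rewrite !mulr_ge0// addr_ge0// mulr_ge0.
have K0 : 0 <= K.
  by rewrite !addr_ge0 ?l1norm_ge0// divr_ge0 ?(ltW Z0)// addr_ge0// mulr_ge0.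
have Hp : 0 < H by exact: expR_gt0.
pose B := 1 + A / Z + 2 * K ^+ 2.
have B0 : 0 < B.
  by rewrite /B -addrA ltr_pwDl// addr_ge0 ?divr_ge0 ?(ltW Z0)// mulr_ge0// sqr_ge0.
have e0 : 0 < eps * Z / (18 * H) by rewrite divr_gt0 ?mulr_gt0.
have [n1 n10 small] := small_level e0.
(* The entrywise norm is at most n = 9 times the sup norm, and there are two error terms: each is
   held to [n * (eps / 18)], in total [eps] times the distance. *)
pose n0 := Num.min n1 (Num.min (1 / 2) (Num.min (eps / (18 * B)) (1 / (2 * (K + 1))))).
have K1 : 0 < K + 1 by rewrite ltr_wpDl.
have n00 : 0 < n0 by rewrite !lt_min n10 !divr_gt0 ?mulr_gt0.
rewrite near_withinE; apply: (proj2 (@nbhs_normP R _ (Q, L) _)).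
exists (n0 / 9) => /=; first by rewrite divr_gt0.
move=> X /=; rewrite distrC => XN DX.
have [s1 s2] := DS X DX.
pose N := `|X - (Q, L)|; pose n := 9 * N.
have nn0 : n <= n0 by rewrite /n mulrC -ler_pdivlMr// ltW.
have N0 : 0 <= N by exact: normr_ge0.
move: nn0; rewrite !le_min => /and4P[nn1 n2 nB nK].
have bd1 : l1norm (X.1 - Q) <= n.
  apply: le_trans (l1norm_le_norm _) _; rewrite ler_pM2l//.
  by rewrite /N prod_normE le_max lexx.
have bd2 : l1norm (X.2 - L) <= n.
  apply: le_trans (l1norm_le_norm _) _; rewrite ler_pM2l//.
  by rewrite /N prod_normE le_max lexx orbT.
have SB (M M' : 'M[R]_3) : Sym0 M -> Sym0 M' -> Sym0 (M - M').
  by move=> [s t] [s' t']; split; rewrite linearB/= ?s ?s' ?t ?t' ?subrr.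
have nK2 : n * K <= 1 / 2.
  have := nK; rewrite ler_pdivlMr ?mulr_gt0// => nK'.
  have := mulr_ge0 (normr_ge0 (X - (Q, L))) K0; rewrite -/N => NK.
  by rewrite /n in nK' *; lra.
have levV : fine (mu (level n)) <= V.
  have fin (S : set (S2 R)) : measurable S -> mu S \is a fin_num.
    move=> mS; rewrite ge0_fin_numE ?measure_ge0//; apply: le_lt_trans dp_fin.
    by apply: le_measure; rewrite ?inE//; exact: measurableT.
  have ml := measurable_sublevel_norm n.
  apply: (fine_le (fin _ ml) (fin _ measurableT)).
  by apply: le_measure; rewrite ?inE//; exact: measurableT.
have := dual_function_increment (SB _ _ s1 symQ) (SB _ _ s2 symL) bd1 bd2 n2 (lexx _) levV nK2.
rewrite -/A -/K !(addrC _ (_ - _)) !subrK -surjective_pairing.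
move=> /le_trans; apply; rewrite -/B -/N.
have lev := small n nn1.
have h1 : n * B <= eps / 18.
  by move: nB; rewrite invfM mulrA ler_pdivlMr.
have h2 : H / Z * fine (mu (level n)) <= eps / 18.
  apply: (@le_trans _ _ (H / Z * (eps * Z / (18 * H)))).
    by rewrite ler_wpM2l// divr_ge0// ltW.
  rewrite le_eqVlt; apply/orP; left; apply/eqP.
  have ZZ : Z * Z^-1 = 1 by rewrite mulfV// gt_eqF.
  have HH : H * H^-1 = 1 by rewrite mulfV// gt_eqF.
  rewrite invfM; transitivity ((H * H^-1) * (Z * Z^-1) * (eps / 18)); first by lra.
  by rewrite ZZ HH !mul1r.
apply: (@le_trans _ _ (n * (eps / 18 + eps / 18))); last by rewrite /n; lra.
by rewrite ler_wpM2l ?mulr_ge0// lerD.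
Qed.

End dual.

(** * The moment of the minimiser is admissible *)

Section conclusion.
Context {R : realType} (eta : R) (r : \bar R) (f : S2 R -> R).
Hypotheses (r1 : (1 <= r)%E) (minf : Lr_local_minimiser eta r f).
Local Notation mu := (dp R).
Local Notation Q := (Qof f).
Local Notation w := (field eta Q).

Let If : L1 mu f := minimiser_L1 minf.
Let mf : measurable_fun setT f := minimiser_measurable minf.

Lemma Qof_sym0 : Sym0 Q.
Proof.
split; first by rewrite linearB/= mom_sym tr_scalar_mx.
rewrite linearB/= mxtrace_mom// mxtrace_scalar (minimiser_mass minf); lra.
Qed.

Lemma mom_minimiser : mom f = Q + (1 / 3)%:M.
Proof. by rewrite subrK. Qed.

(** The set is the quadric of Q - eta I. If that matrix were 0 the field would vanish identically,
    and finite energy would force f = 0 almost everywhere. *)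
Lemma field_zero_null : mu [set p | w p = 0] = 0%E.
Proof.
have -> : [set p | w p = 0] = quadric (Q - eta%:M).
  by apply/seteqP; split=> p; rewrite /quadric /= quadfB quadf_scalar.
have [symQ _] := Qof_sym0.
apply: dp_quadric0; first by rewrite linearB/= symQ tr_scalar_mx.
apply/eqP => Q0; apply: (minimiser_not_null minf).
apply: filterS (minimiser_field minf) => p fw.
apply: contrapT => /eqP /fw; rewrite (_ : w p = 0) ?ltxx//.
by rewrite /field -(quadf_scalar eta p) -quadfB Q0 -(scale0r 0) quadfZ mul0r.
Qed.

(** The integral of f (v.p)^2 would be 0; for v nonzero the set v.p = 0 is null, so f would vanish
    almost everywhere. *)
Lemma mom_minimiser_pos (v : 'rV[R]_3) : v *m mom f = 0 -> v = 0.
Proof.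
move=> vM; apply/eqP; apply: contra_notT (minimiser_not_null minf) => v0.
have symvv : (v^T *m v)^T = v^T *m v by rewrite trmx_mul trmxK.
have int0 : \int[mu]_p (f p * quadf (v^T *m v) p) = 0.
  rewrite Rint_quadf// -mxtrace_frob ?mom_sym// -mulmxA vM mulmx0.
  exact: mxtrace0.
have vv0 : v^T *m v != 0.
  apply: contra_neq v0 => vv; apply/rowP => j; rewrite mxE; apply/eqP.
  have := congr1 (fun M : 'M[R]_3 => M j j) vv.
  by rewrite !mxE big_ord1 !mxE => /eqP; rewrite mulf_eq0 orbb.
have fq0 : {ae mu, forall p, 0 <= f p * quadf (v^T *m v) p}.
  by apply: filterS (minimiser_ge0 minf) => p f0; rewrite mulr_ge0// quadf_rank1 sqr_ge0.
have nq := measure0_ae (measurable_quadric (v^T *m v)) (dp_quadric0 symvv vv0).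
apply: filterS2 (Rint_eq0_ae (L1_quadf _ If) fq0 int0) nq => p /eqP.
by rewrite mulf_eq0 => /orP[/eqP//|/eqP].
Qed.

Lemma Qof_admissible : Qadm Q.
Proof.
split; first exact: Qof_sym0.
have Munit : mom f \in unitmx.
  rewrite -row_free_unit -kermx_eq0; apply/eqP/row_matrixP => i.
  rewrite row0; apply: mom_minimiser_pos.
  by rewrite -row_mul mulmx_ker row0.
set N := invmx (mom f).
have N0 : 0 < l1norm N.
  rewrite lt_def l1norm_ge0 andbT; apply/eqP => N0.
  have : N = 0.
    apply/matrixP => i j; rewrite mxE; apply/eqP; rewrite -normr_le0 -N0.
    rewrite /l1norm (bigD1 i)//= (bigD1 j)//= -addrA lerDl addr_ge0//.
      exact: sumr_ge0.
    by apply: sumr_ge0 => a _; exact: sumr_ge0.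
  move=> NE; have := mulVmx Munit; rewrite -/N NE mul0mx => /esym.
  by move/matrixP/(_ 0 0)/eqP; rewrite !mxE eqxx oner_eq0.
(* [vmin] is an infimum, so a gap uniform in the eigenvalue is sought. With b = a + 1/3, v = b v N,
   and comparing the sums of absolute entries gives 1 <= b [l1norm N]. *)
have lower a : eigenvalue Q a -> - (1 / 3) + (l1norm N)^-1 <= a.
  move=> /eigenvalueP[v vQ v0].
  pose b := a + 1 / 3.
  have vM : v *m mom f = b *: v.
    by rewrite mom_minimiser mulmxDr vQ mul_mx_scalar -scalerDl.
  have bN : v = b *: (v *m N) by rewrite scalemxAl -vM mulmxK.
  have b_pos : 0 <= b.
    have vv : 0 < dotp v v.
      rewrite lt_def dotp_ge0 andbT; apply: contra_neq v0 => vv.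
      apply/rowP => j; rewrite mxE; apply/eqP; rewrite -sqrf_eq0 eq_le sqr_ge0 andbT.
      by rewrite -vv dotpE (bigD1 j)//= -expr2 lerDl sumr_ge0// => k _; rewrite -expr2 sqr_ge0.
    have : b * dotp v v = \int[mu]_p (f p * quadf (v^T *m v) p).
      rewrite Rint_quadf// -mxtrace_frob ?mom_sym// -mulmxA vM -scalemxAr linearZ/=.
      by rewrite mxtrace_mulC /mxtrace big_ord1.
    move=> bE; rewrite -(pmulr_lge0 _ vv) bE; apply: Rint_ae_ge0; first exact: L1_quadf.
    apply: filterS (minimiser_ge0 minf) => p f0.
    by rewrite mulr_ge0// quadf_rank1 sqr_ge0.
  pose nv := \sum_j `|v 0 j|.
  have nv0 : 0 < nv.
    rewrite lt_def sumr_ge0 ?andbT//; apply: contra_neq v0 => nv0.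
    apply/rowP => j; rewrite mxE; apply/eqP; rewrite -normr_le0 -nv0.
    by rewrite /nv (bigD1 j)//= lerDl sumr_ge0.
  have nvN : nv <= b * (nv * l1norm N).
    rewrite {1}/nv [in X in X <= _]bN.
    apply: (@le_trans _ _ (\sum_j b * (\sum_i `|v 0 i| * `|N i j|))).
      apply: ler_sum => j _; rewrite mxE normrM (ger0_norm b_pos) ler_wpM2l// mxE.
      by apply: le_trans (ler_norm_sum _ _ _) _; apply: ler_sum => i _; rewrite normrM.
    rewrite -mulr_sumr ler_wpM2l// exchange_big/= /nv mulr_suml.
    apply: ler_sum => i _; rewrite -mulr_sumr ler_wpM2l//.
    by rewrite /l1norm [leRHS](bigD1 i)//= lerDl; apply: sumr_ge0 => a' _; exact: sumr_ge0.
  have bl : 1 <= b * l1norm N.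
    by move: nvN; rewrite mulrCA -{1}[nv]mulr1 ler_pM2l.
  have : (l1norm N)^-1 <= b by rewrite -div1r ler_pdivrMr.
  by rewrite /b; lra.
have Npos : 0 < (l1norm N)^-1 by rewrite invr_gt0.
(* The infimum of the empty set is 0 by convention, which exceeds -1/3, so the existence of a real
   eigenvalue need not be settled here. *)
have [ne|/set0P/negP] := pselect ([set a | eigenvalue Q a] !=set0).
  apply: (@lt_le_trans _ _ (- (1 / 3) + (l1norm N)^-1)); first by rewrite ltrDl.
  by apply: lb_le_inf => // a; exact: lower.
by rewrite negbK => /eqP empty; rewrite /vmin empty inf0; lra.
Qed.

Lemma Qof_dom : domJ eta Q.
Proof.
split; first exact: Qof_admissible.
have [_ Efin _] := minf; apply: le_lt_trans Efin; apply: ereal_inf_lbound.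
exists f => //; split; first by case: minf => -[].
by rewrite mx_integral_tensor0// (minimiser_mass minf) mulr1.
Qed.

Lemma euler_lagrange_conclusion : exists L Z,
  [/\ Sym0 L, 0 < Z,
      {ae mu, forall p, f p = 1 / Z * expR (quadf L p) * Num.max (w p) 0},
      L = mx_integral (fun p => quotient_density eta f Q p *: tensor0 p) &
      critical_point (domJ eta `*` @Sym0 R) (dual_function eta) (Q, L)].
Proof.
have [L [c [symL c0 fE]]] := euler_lagrange_form r1 minf.
exists L, c^-1; rewrite div1r invrK.
have LE := multiplier_eq r1 minf c0 fE symL.
have Ig : L1 mu (gibbs_ratio eta f L c) by exact: L1_gibbs_ratio.
have qE : {ae mu, forall p, quotient_density eta f Q p = gibbs_ratio eta f L c p}.
  apply: filterS fE => p fp; rewrite /quotient_density /gibbs_ratio /field.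
  have [wp|wp] := leP (quadf Q p) eta.
    by rewrite subr_gt0 ltNge wp mulr0.
  rewrite subr_gt0 wp mulr1 fp max_l; last by rewrite /field subr_ge0 ltW.
  by rewrite /field mulfK// gt_eqF// subr_gt0.
have mq : measurable_fun setT (quotient_density eta f Q).
  (* On the branch where the field is positive its inverse is [expR (- ln (w p))], a composition of
     measurable functions. *)
  have -> : quotient_density eta f Q =
      (fun p => if quadf Q p <= eta then 0 else f p * expR (- ln (w p))).
    apply/funext => p; rewrite /quotient_density; have [//|wp] := leP (quadf Q p) eta.
    by rewrite expRN lnK// posrE subr_gt0.
  apply: measurable_fun_ifT.
  - by apply: measurable_fun_ler; [exact: measurable_quadf|exact: measurable_cst].
  - exact: measurable_cst.
  - apply: measurable_funM mf _; apply: measurableT_comp; first exact: measurable_expR.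
    apply: measurableT_comp; first exact: oppr_measurable.
    by apply: measurableT_comp (measurable_field eta Q); exact: measurable_ln.
have Iq : L1 mu (quotient_density eta f Q).
  by apply: (L1_ae_eq Ig mq); apply: filterS qE => p ->.
have IG0 := L1_partition eta Q L.
have IG1 : L1 mu (fun p => expR (quadf L p) * (0 < w p)%R%:R).
  have := L1Z c^-1 Ig; apply: eq_integrable; first exact: measurableT.
  move=> p _ /=; by rewrite /gibbs_ratio !mulrA mulVf ?gt_eqF// mul1r.
split.
- exact: symL.
- by rewrite invr_gt0.
- exact: fE.
- rewrite mx_integral_tensor0// [LHS]LE.
  have -> : \int[mu]_p quotient_density eta f Q p = \int[mu]_p gibbs_ratio eta f L c p.
    by apply: Rint_ae_eq; [exact: mq|exact: L1_measurable Ig|exact: qE].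
  congr (_ - _); apply/matrixP => i j; rewrite !mxE; apply: Rint_ae_eq.
  + by apply: measurable_funM (L1_measurable Ig) _; exact: measurable_coord2.
  + by apply: measurable_funM mq _; exact: measurable_coord2.
  + by apply: filterS qE => p ->.
(* The last argument is the scalar part subtracted in [multiplier_eq]; it is invisible to traceless
   directions. *)
- apply: (@dual_critical R eta Q L c^-1 (1 / 3 * \int[mu]_p gibbs_ratio eta f L c p)).
  + exact: Qof_sym0.
  + exact: symL.
  + by rewrite invr_gt0.
  + rewrite -mom_minimiser.
    have -> : mom f = c *: mom (fun p => expR (quadf L p) * Num.max (w p) 0).
      rewrite -momZ//; apply/matrixP => i j; rewrite !mxE; apply: Rint_ae_eq.
      * by apply: measurable_funM mf _; exact: measurable_coord2.
      * apply: measurable_funM; last exact: measurable_coord2.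
        by apply: measurable_funM; [exact: measurable_cst|exact: L1_measurable IG0].
      * by apply: filterS fE => p ->; rewrite !mulrA.
    by rewrite scalerA mulVf ?gt_eqF// scale1r.
  + rewrite (etrans (congr1 (+%R^~ _) LE) (subrK _ _)).
    have -> : mom (gibbs_ratio eta f L c) = c *: mom (fun p => expR (quadf L p) * (0 < w p)%R%:R).
      rewrite -momZ//; congr mom; apply/funext => p.
      by rewrite /gibbs_ratio mulrA.
    by rewrite scalerA mulVf ?gt_eqF// scale1r.
  + exact: field_zero_null.
  + by split; [exact: Qof_dom|exact: symL].
  + by move=> X [[[s _] _] s']; split.
Qed.

End conclusion.

Theorem theorem4p9 (R : realType) (eta : R) (f : S2 R -> R) (r : \bar R) :
  (1 <= r)%E ->
  Lr_local_minimiser eta r f ->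
  exists (Q Lambda : 'M[R]_3) (Z : R),
    [/\ Sym0 Q, Sym0 Lambda & 0 < Z] /\
    [/\ {ae dp R, forall p, f p =
           1 / Z * expR (quadf Lambda p) * Num.max (quadf Q p - eta) 0},
        Q = mx_integral (fun p => f p *: tensor0 p) &
        Lambda = mx_integral (fun p => quotient_density eta f Q p *: tensor0 p)] /\
    critical_point (domJ eta `*` @Sym0 R) (dual_function eta) (Q, Lambda).
Proof.
move=> r1 minf; have [L [Z [symL Z0 fE LE crit]]] := euler_lagrange_conclusion r1 minf.
exists (Qof f), L, Z; split; last split => //.
  by split => //; exact: (Qof_sym0 minf).
split => //; rewrite mx_integral_tensor0; last exact: (minimiser_L1 minf).
by rewrite (minimiser_mass minf) mulr1.
Qed.
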